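(* Let $\mathfrak{g}$ be a finite-dimensional complex Lie algebra and $\mathfrak{l}\subset\mathfrak{g}$ a Lie subalgebra, let $\mathfrak{m}\subset\mathfrak{g}$ be an $\mathfrak{l}$-invariant complement of $\mathfrak{l}$ (so $\mathfrak{g}=\mathfrak{l}\oplus\mathfrak{m}$ and $[\mathfrak{l},\mathfrak{m}]\subset\mathfrak{m}$), and let $\Omega\in(S^2\mathfrak{g})^{\mathfrak{g}}$ satisfy $\Omega\in(\mathfrak{l}\otimes\mathfrak{l})\oplus(\mathfrak{m}\otimes\mathfrak{m})$; write $\Omega=\Omega_{\mathfrak{l}}+\Omega_{\mathfrak{m}}$ accordingly. Let $$r_0\in\mathcal{M}_\Omega=\Big\{x\in\tfrac{\Omega}{2}+(\Lambda^2\mathfrak{m})^{\mathfrak{l}}\ \Big|\ CYB(x)=0\ \text{in}\ \Lambda^3(\mathfrak{g}/\mathfrak{l})\Big\}.$$ Then there exists a unique dynamical r-matrix $r\in Dynr(\mathfrak{g},\mathfrak{l},\Omega)$ of the form $r=r^{\mathfrak{l}}_{AM}+\frac{\Omega_{\mathfrak{m}}}{2}+t$ with $t:D\to\Lambda^2\mathfrak{m}$, such that $r(0)=r_0$.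
   Context: Functions on $D$. Let $x_1,\dots,x_r$ be a basis of $\mathfrak{l}$ and let $D$ be the formal neighbourhood of $0$ in $\mathfrak{l}^*$. For a complex vector space $V$, a function $D\to V$ is an element of $V[[x_1,\dots,x_r]]$, where the $x_i$ are regarded as linear coordinates on $\mathfrak{l}^*$; its value at $0$ is the constant term. If $V$ is an $\mathfrak{l}$-module, $\mathfrak{l}$ acts on $V[[x_1,\dots,x_r]]$ diagonally, acting on power series by the derivations extending $y\cdot x_i=[y,x_i]$; a function is $\mathfrak{l}$-equivariant if it is annihilated by this action. Tensor powers of $\mathfrak{g}$ carry the adjoint action; $S^2$ and $\Lambda^k$ denote symmetric/antisymmetric tensors. Dynamical r-matrices. For $r\in\mathfrak{g}\otimes\mathfrak{g}$ put $CYB(r)=[r^{12},r^{13}]+[r^{12},r^{23}]+[r^{13},r^{23}]\in\mathfrak{g}^{\otimes3}$ (usual leg notation). For a function $r:D\to\mathfrak{g}\otimes\mathfrak{g}$ put $\overline{dr}=\sum_i x_i\otimes\frac{\partial r}{\partial x_i}$, and for $x\in\mathfrak{g}^{\otimes3}$ put $\mathrm{Alt}(x)=x^{123}-x^{213}+x^{312}$, where $(a\otimes b\otimes c)^{ijk}$ has $a$ in slot $i$, $b$ in slot $j$, $c$ in slot $k$. For $\Omega\in(S^2\mathfrak{g})^{\mathfrak{g}}$, $Dynr(\mathfrak{g},\mathfrak{l},\Omega)$ is the set of dynamical r-matrices: $\mathfrak{l}$-equivariant functions $r:D\to\mathfrak{g}\otimes\mathfrak{g}$ with $\mathrm{Alt}(\overline{dr})+CYB(r)=0$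 and $r+r^{21}=\Omega$. ''$CYB(x)=0$ in $\Lambda^3(\mathfrak{g}/\mathfrak{l})$'' means that the image of $CYB(x)\in\Lambda^3\mathfrak{g}$ in $\Lambda^3(\mathfrak{g}/\mathfrak{l})$ vanishes. The function $r^{\mathfrak{l}}_{AM}$. Let $f(s)=\frac1s-\frac12\coth(\frac s2)$, a power series in $s$ at $0$. The element $\Omega_{\mathfrak{l}}$ lies in $(S^2\mathfrak{l})^{\mathfrak{l}}$. Then $r^{\mathfrak{l}}_{AM}:D\to\mathfrak{l}\otimes\mathfrak{l}$ is $$r^{\mathfrak{l}}_{AM}(\lambda)=\tfrac{\Omega_{\mathfrak{l}}}{2}+\big(1\otimes f(\mathrm{ad}\,\mu)\big)(\Omega_{\mathfrak{l}}),\qquad \mu=(\lambda\otimes1)(\Omega_{\mathfrak{l}})\in\mathfrak{l},\ \lambda\in D.$$ *)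

(* Defs.v *)
From HB Require Import structures.
From mathcomp Require Import all_boot all_order all_algebra.
From mathcomp Require Import boolp functions reals complex.
From mathcomp Require Import mpoly.

Set Implicit Arguments.
Unset Strict Implicit.
Unset Printing Implicit Defensive.

Import Order.TTheory GRing.Theory Num.Theory.
Local Open Scope ring_scope.

HB.mixin Record Vector_isLie (F : fieldType) g of Vector F g := {
  lie : g -> g -> g;
  lie_linearl : forall z, linear (lie^~ z);
  lie_linearr : forall z, linear (lie z);
  liexx : forall y, lie y y = 0;
  lie_jacobi : forall y z w, lie y (lie z w) + lie z (lie w y) + lie w (lie y z) = 0
}.

#[short(type="finLieType")]
HB.structure Definition FinLie (F : fieldType) :=
  { g of Vector_isLie F g & Vector F g }.

(* U (x) V is modelled by coordinates on the products of the vectors of the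
   reference bases (vbasis {:_}) of U and V. A linear map out of it is written
   as [tlift B] for a bilinear B; [tlift_linear], [tlift_tens] and [tlift_unique] are the
   universal property. Triple tensors are nested to the right. *)
Definition tensor (F : fieldType) (U V : vectType F) :=
  'M[F]_(\dim {:U}, \dim {:V}).
HB.instance Definition _ (F : fieldType) (U V : vectType F) :=
  Vector.copy (tensor U V) 'M[F]_(\dim {:U}, \dim {:V}).

Section Tensor.
Variable F : fieldType.
Implicit Types U V : vectType F.

Definition tens U V (u : U) (v : V) : tensor U V :=
  \matrix_(i, j) (coord (vbasis {:U}) i u * coord (vbasis {:V}) j v).

Definition tlift U V (W : lmodType F) (B : U -> V -> W) (t : tensor U V) : W :=
  \sum_i \sum_j t i j *: B (vbasis {:U})`_i (vbasis {:V})`_j.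

Definition bilin U V (W : lmodType F) (B : U -> V -> W) :=
  (forall v, linear (B^~ v)) /\ (forall u, linear (B u)).

Definition tensv U V (U1 : {vspace U}) (V1 : {vspace V}) : {vspace tensor U V} :=
  <<[seq tens u v | u <- vbasis U1, v <- vbasis V1]>>%VS.

Lemma tens_bilin U V : bilin (@tens U V).
Proof.
split=> w a y z; apply/matrixP=> i j; rewrite !mxE linearP /=.
  by rewrite mulrDl mulrA.
by rewrite mulrDr mulrCA.
Qed.

Lemma tlift_tens U V (W : lmodType F) (B : U -> V -> W) u v :
  bilin B -> tlift B (tens u v) = B u v.
Proof.
move=> [Bl Br]; rewrite /tlift.
pose Bu v := GRing.isLinear.Build F U W _ (B^~ v) (Bl v).
pose fl v : {linear U -> W} := HB.pack (B^~ v) (Bu v).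
pose Bv u := GRing.isLinear.Build F V W _ (B u) (Br u).
pose fr u : {linear V -> W} := HB.pack (B u) (Bv u).
rewrite -[RHS]/(fl v u) {2}(coord_vbasis (memvf u)) linear_sum.
apply: eq_bigr => i _; rewrite linearZ /=.
rewrite -[B _ v]/(fr _ v) {2}(coord_vbasis (memvf v)) linear_sum scaler_sumr.
by apply: eq_bigr => j _; rewrite linearZ /= mxE scalerA.
Qed.

Lemma tlift_linear U V (W : lmodType F) (B : U -> V -> W) : linear (tlift B).
Proof.
move=> a s t; rewrite /tlift scaler_sumr -big_split; apply: eq_bigr => i _ /=.
rewrite scaler_sumr -big_split; apply: eq_bigr => j _ /=.
by rewrite !mxE scalerDl scalerA.
Qed.

Lemma tensor_decomp U V (t : tensor U V) : t = tlift (@tens U V) t.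
Proof.
apply/matrixP=> p q; rewrite /tlift summxE (bigD1 p) //= summxE (bigD1 q) //=.
rewrite !mxE !(coord_free _ _ (basis_free (vbasisP _))) !eqxx !mulr1.
rewrite !big1 ?addr0 // => [i nip|j njq].
  rewrite summxE big1 // => j _; rewrite !mxE.
  by rewrite !(coord_free _ _ (basis_free (vbasisP _))) (negPf nip) mul0r mulr0.
rewrite !mxE !(coord_free _ _ (basis_free (vbasisP _))).
by rewrite (negPf njq) !mulr0.
Qed.

Lemma tlift_unique U V (W : lmodType F) (f g : {linear tensor U V -> W}) :
  (forall u v, f (tens u v) = g (tens u v)) -> f =1 g.
Proof.
move=> fg t; rewrite (tensor_decomp t) /tlift !linear_sum; apply: eq_bigr => i _.
by rewrite !linear_sum; apply: eq_bigr => j _; rewrite !linearZ /= fg.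
Qed.

Lemma mem_tens U V (U1 : {vspace U}) (V1 : {vspace V}) u v :
  u \in U1 -> v \in V1 -> tens u v \in tensv U1 V1.
Proof.
move=> uU vV; have [tl tr] := tens_bilin U V.
pose Tu v := GRing.isLinear.Build F U (tensor U V) _ (@tens U V ^~ v) (tl v).
pose fl v : {linear U -> tensor U V} := HB.pack (@tens U V ^~ v) (Tu v).
pose Tv u := GRing.isLinear.Build F V (tensor U V) _ (@tens U V u) (tr u).
pose fr u : {linear V -> tensor U V} := HB.pack (@tens U V u) (Tv u).
rewrite -[tens u v]/(fl v u) (coord_vbasis uU) linear_sum.
apply: rpred_sum => i _; rewrite linearZ; apply: rpredZ => /=.
rewrite -[tens _ v]/(fr _ v) (coord_vbasis vV) linear_sum.
apply: rpred_sum => j _; rewrite linearZ; apply: rpredZ => /=.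
by apply/memv_span/allpairs_f; rewrite mem_nth ?size_tuple.
Qed.

Definition flip U (t : tensor U U) : tensor U U := tlift (fun a b => tens b a) t.

Definition in_Lambda2 U (U1 : {vspace U}) (t : tensor U U) :=
  t \in tensv U1 U1 /\ flip t = - t.

(* The quotient V / U, carried by the vectors of a complement of U;
   [quotv_pi] is the canonical projection. *)
Definition quotv V (U : {vspace V}) : vectType F := subvs_of (U^C)%VS.
Definition quotv_pi V (U : {vspace V}) (v : V) : quotv U :=
  vsproj (U^C)%VS (daddv_pi (U^C)%VS U v).

Lemma quotv_pi_linear V (U : {vspace V}) : linear (@quotv_pi V U).
Proof. by move=> a u v; rewrite /quotv_pi !linearP. Qed.

Lemma quotv_pi_eq0 V (U : {vspace V}) v : (quotv_pi U v == 0) = (v \in U).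
Proof.
have tUC : (U^C :&: U)%VS = 0%VS by rewrite capvC capv_compl.
have vUU : v \in (U^C + U)%VS by rewrite addvC addv_complf memvf.
have dv := daddv_pi_add tUC vUU.
apply/eqP/idP => [p0|vU]; last first.
  have: daddv_pi (U^C) U v \in (U^C :&: U)%VS.
    rewrite memv_cap memv_pi andTb -[X in X \in U](addrK (daddv_pi U (U^C)%VS v)).
    by rewrite dv rpredB // memv_pi.
  by rewrite tUC memv0 /quotv_pi => /eqP->; rewrite linear0.
have p1 : daddv_pi (U^C) U v = 0.
  by rewrite -(vsprojK (memv_pi _ U v)) -/(quotv_pi U v) p0 linear0.
by rewrite -dv p1 add0r memv_pi.
Qed.

Lemma quotv_pi_surj V (U : {vspace V}) (w : quotv U) : exists v, quotv_pi U v = w.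
Proof.
exists (vsval w); rewrite /quotv_pi daddv_pi_id ?subvsP //.
  exact: vsvalK.
by rewrite capvC capv_compl.
Qed.

End Tensor.

Section LieTensor.
Variables (F : fieldType) (g : finLieType F).

Local Notation T2 := (tensor g g).
Local Notation T3 := (tensor g (tensor g g)).

Definition ad2 (y : g) (t : T2) : T2 :=
  tlift (fun a b => tens (lie y a) b + tens a (lie y b)) t.

Definition lie12_13 (r s : T2) : T3 :=
  tlift (fun a b => tlift (fun c d => tens (lie a c) (tens b d)) s) r.
Definition lie12_23 (r s : T2) : T3 :=
  tlift (fun a b => tlift (fun c d => tens a (tens (lie b c) d)) s) r.
Definition lie13_23 (r s : T2) : T3 :=
  tlift (fun a b => tlift (fun c d => tens a (tens c (lie b d))) s) r.

(* The bilinear map whose restriction to the diagonal is CYB. *)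
Definition CYB2 (r s : T2) : T3 := lie12_13 r s + lie12_23 r s + lie13_23 r s.
Definition CYB (r : T2) : T3 := CYB2 r r.

Definition perm213 (t : T3) : T3 :=
  tlift (fun a bc => tlift (fun b c => tens b (tens a c)) bc) t.
Definition perm312 (t : T3) : T3 :=
  tlift (fun a bc => tlift (fun b c => tens b (tens c a)) bc) t.
Definition Alt (t : T3) : T3 := t - perm213 t + perm312 t.

Definition quot3 (l : {vspace g}) (t : T3) :
    tensor (quotv l) (tensor (quotv l) (quotv l)) :=
  tlift (fun a bc => tlift (fun b c =>
    tens (quotv_pi l a) (tens (quotv_pi l b) (quotv_pi l c))) bc) t.

Definition in_M (l m : {vspace g}) (Om r0 : T2) :=
  exists s : T2, [/\ r0 = 2^-1 *: Om + s, in_Lambda2 m s,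
    (forall y, y \in l -> ad2 y s = 0) & quot3 l (CYB r0) = 0].

End LieTensor.

(* V[[x_1, ..., x_r]], as families of coefficients indexed by monomials. *)
Definition mps (r : nat) (V : Type) := 'X_{1..r} -> V.
HB.instance Definition _ r (F : fieldType) (V : lmodType F) :=
  GRing.Lmodule.copy (mps r V) ('X_{1..r} -> V).

Section PowerSeries.
Variables (F : fieldType) (r : nat).
Implicit Types U V W : lmodType F.

Definition pscst V (v : V) : mps r V := fun a => if a == 0%MM then v else 0.

Definition psmap V W (f : V -> W) (P : mps r V) : mps r W := fun a => f (P a).

Definition psder V (i : 'I_r) (P : mps r V) : mps r V :=
  fun a => (a i).+1%:R *: P (a + U_(i))%MM.

Definition psmulX V (i : 'I_r) (P : mps r V) : mps r V :=
  fun a => if (0 < a i)%N then P (a - U_(i))%MM else 0.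

(* The Cauchy product along a bilinear map B. *)
Definition psconv U V W (B : U -> V -> W) (P : mps r U) (Q : mps r V) : mps r W :=
  fun a => \sum_(k : 'X_{1..r < (mdeg a).+1, (mdeg a).+1} | a == (k.1 + k.2)%MM)
    B (P k.1) (Q k.2).

End PowerSeries.
Arguments pscst {F} r {V} v _.

(* Univariate formal power series, as sequences of coefficients. [ser_div N D]
   is the quotient N / D when D 0 != 0, by long division. *)
Section Series.
Variable F : fieldType.

Fixpoint ser_div_prefix (N D : nat -> F) (n : nat) : seq F :=
  if n is k.+1 then
    let s := ser_div_prefix N D k in
    rcons s ((N k - \sum_(j < k) s`_j * D (k - j)%N) / D 0%N)
  else [::].
Definition ser_div (N D : nat -> F) (k : nat) : F := (ser_div_prefix N D k.+1)`_k.

Lemma size_ser_div_prefix N D n : size (ser_div_prefix N D n) = n.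
Proof. by elim: n => //= n IH; rewrite size_rcons IH. Qed.

Lemma nth_ser_div_prefix N D n k :
  (k < n)%N -> (ser_div_prefix N D n)`_k = ser_div N D k.
Proof.
elim: n => // n IH; rewrite ltnS leq_eqVlt => /orP[/eqP->//|kn].
by rewrite /= nth_rcons size_ser_div_prefix kn IH.
Qed.

Lemma ser_divK (N D : nat -> F) : D 0%N != 0 ->
  forall k, \sum_(j < k.+1) ser_div N D j * D (k - j)%N = N k.
Proof.
move=> D0 k; rewrite big_ord_recr /= subnn [X in _ + X * _]/ser_div /=.
rewrite nth_rcons size_ser_div_prefix ltnn eqxx divfK //.
rewrite addrC -addrA [X in _ + X]addrC.
rewrite [X in X - _](_ : _ = \sum_(j < k) (ser_div_prefix N D k)`_j * D (k - j)%N).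
  by rewrite subrr addr0.
by apply: eq_bigr => j _; rewrite nth_ser_div_prefix.
Qed.

(* The Taylor coefficients at 0 of 2 sinh(s/2) and 2 cosh(s/2). *)
Definition sinh2 (k : nat) : F := if odd k then 2 * 2^-1 ^+ k / k`!%:R else 0.
Definition cosh2 (k : nat) : F := if odd k then 0 else 2 * 2^-1 ^+ k / k`!%:R.

(* f(s) = 1/s - coth(s/2)/2 = f_num(s) / f_den(s), with
   f_num(s) = 2 sinh(s/2) - s cosh(s/2) and f_den(s) = s * 2 sinh(s/2).
   Both are divisible by s^2, and f_den(s) / s^2 has constant term 1. *)
Definition f_num (k : nat) : F :=
  sinh2 k - (if k is j.+1 then 2^-1 * cosh2 j else 0).
Definition f_den (k : nat) : F := if k is j.+1 then sinh2 j else 0.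
Definition f_AM : nat -> F :=
  ser_div (fun k => f_num k.+2) (fun k => f_den k.+2).

End Series.

Lemma f_den2 (F : numFieldType) : f_den F 2 = 1.
Proof. by rewrite /f_den /sinh2 /= expr1 divff ?pnatr_eq0 // divr1. Qed.

Lemma f_AM_spec (F : numFieldType) k :
  \sum_(j < k.+1) f_AM F j * f_den F (k - j) = f_num F k.
Proof.
have n0 : f_num F 0 = 0 by rewrite /f_num /sinh2 /= subr0.
have n1 : f_num F 1 = 0.
  by rewrite /f_num /sinh2 /cosh2 /= !expr1 expr0 mulr1 !divr1 mulVf ?pnatr_eq0 //
    divff ?pnatr_eq0 // subrr.
case: k => [|[|k]].
- by rewrite big_ord_recr big_ord0 /= n0 mulr0 addr0.
- by rewrite !big_ord_recr big_ord0 /= n1 /sinh2 /= !mulr0 !addr0.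
rewrite 2!big_ord_recr /= subnn subSnn /f_den /sinh2 /= !mulr0 !addr0.
rewrite -[RHS](@ser_divK F (fun k => f_num F k.+2) (fun k => f_den F k.+2)).
  apply: eq_bigr => j _; congr (_ * _).
  by rewrite !subSn //= ?leqW // -ltnS.
by rewrite f_den2 oner_neq0.
Qed.

Section Dynamical.
Variables (F : fieldType) (g : finLieType F) (r : nat) (x : r.-tuple g).

Local Notation T2 := (tensor g g).
Local Notation T3 := (tensor g (tensor g g)).

(* The tuple x stands for the basis x_1, ..., x_r of l. For y in l,
   [ps_coad y] is the derivation extending x_i |-> [y, x_i]. *)
Definition ps_coad (V : lmodType F) (y : g) (P : mps r V) : mps r V :=
  \sum_(i < r) \sum_(j < r) coord x j (lie y x`_i) *: psmulX j (psder i P).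

Definition equivariant (l : {vspace g}) (P : mps r T2) :=
  forall y, y \in l -> psmap (ad2 y) P + ps_coad y P = 0.

Definition dbar (P : mps r T2) : mps r T3 :=
  \sum_(i < r) psmap (tens x`_i) (psder i P).

Definition psCYB (P : mps r T2) : mps r T3 := psconv (@CYB2 F g) P P.

Definition Dynr (l : {vspace g}) (Om : T2) (P : mps r T2) :=
  [/\ equivariant l P,
      psmap (@Alt F g) (dbar P) + psCYB P = 0
    & P + psmap (@flip F g) P = pscst r Om].

(* For lambda in D and a in l, lambda(a) is the linear function
   \sum_i coord x i a * x_i; only the restriction of [coord x i] to l matters,
   as Oml lies in l (x) l. *)
Definition mu (Oml : T2) : mps r g :=
  \sum_(i < r) psmulX i (pscst r (tlift (fun a b => coord x i a *: b) Oml)).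

(* (1 (x) (ad mu)^k)(Oml), homogeneous of degree k in the x_i. *)
Definition ad_mu_pow (Oml : T2) (k : nat) : mps r T2 :=
  iter k (psconv (fun v => tlift (fun a b => tens a (lie v b))) (mu Oml))
    (pscst r Oml).

(* By homogeneity, the terms f_k (1 (x) (ad mu)^k)(Oml) with k > mdeg a do not
   contribute to the coefficient of the monomial a. *)
Definition r_AM (Oml : T2) : mps r T2 :=
  pscst r (2^-1 *: Oml) +
  (fun a => \sum_(k < (mdeg a).+1) f_AM F k *: ad_mu_pow Oml k a).

End Dynamical.

(* Main.v *)
Require Import Defs.
From HB Require Import structures.
From mathcomp Require Import all_boot all_order all_algebra.
From mathcomp Require Import boolp functions reals complex.
From mathcomp Require Import mpoly.
From mathcomp Require Import ring.

Set Implicit Arguments.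
Unset Strict Implicit.
Unset Printing Implicit Defensive.

Import Order.TTheory GRing.Theory Num.Theory.
Local Open Scope ring_scope.

(**
Write r = Om/2 + s. The condition r + r^21 = Om says that s is antisymmetric, and
the components of the equation Alt(dr) + CYB(r) = 0 in a basis e_i of g become

  E_abc = cyc d_a s_bc + cyc [s_b, s_c]_a + (1/4) [Om_b, Om_c]_a = 0,

where s_b is the b-th column of s, cyc is the sum over cyclic permutations of
(a, b, c), and the d_a are the coefficients of sum_i x_i (x) d/dx_i in
sum_a e_a (x) d_a. Let P be the projector on l along m, let La be the matrix with entries
lambda([e_i, e_j]) (lambda being extended by zero to m), and let D be the Euler
field. The proof rests on the contraction of E with lambda. For an equivariant s
with lambda s = 0 the equation sum_a lambda_a E_abc = 0 is the Riccati equation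
along rays

  D s + P s + s P^T = s La s - (1/4) Om La Om,                        (radial)

an ordinary differential equation in the radial direction. Degree by degree, it
determines s from the component of s(0) in m (x) m.

Existence. As lambda vanishes on [l, m], the matrix La has no mixed part, and the
radial equation splits into an equation on l and one on m. On l it is solved by
the function r_AM - Om_l/2 ([sAM_radial]). Indeed with A = ad(mu) the invariance of
Om_l gives Om_l La = - A on l, hence (A^i Om_l) La (A^j Om_l) = - A^(i+j+1) Om_l, and
the equation reduces to the scalar Riccati equation s f' + 2 f = s f^2 - s/4
satisfied by f(s) = 1/s - coth(s/2)/2 ([f_AM_rec]). On m the operator P vanishes,
and a solution t with prescribed t(0) is the fixed point of a contraction
([riccati_exists]). The sum s of both parts is antisymmetric and equivariant,
because s + s^T and the action of y in l on s satisfy homogeneous linear radial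
equations, which have no nonzero solution vanishing at 0 ([linear_radial_unique]).

It remains to go back from the contracted equation to E = 0. This is the purpose of
the identity [skew_cdybe_radial], a Bianchi identity for the dynamical equation:

  (D + P_1 + P_2 + P_3) E = - cyc sum_i lambda([s_c, e_i]) E_iab,

where P_k is P acting on the k-th tensor factor. If E vanishes below degree k, then
the right-hand side vanishes below degree k + 1. The operator on the left is
semisimple on homogeneous elements of degree k, with eigenvalues k, ..., k + 3; so
E vanishes in degree k, unless k = 0, where only the component of E(0) in the third
tensor power of m is not forced to vanish. That component is the image of CYB(r_0)
in the third tensor power of g/l: the derivative terms have a leg in l. It is zero
by the hypothesis on r_0.

Uniqueness. Let d be the difference of two solutions, with values in m (x) m. If it
vanishes below degree k, then so does Alt(dd), as the difference of the two CYB
terms. Contracting Alt(dd) with lambda kills all terms but the first one, which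
becomes D d; so D d vanishes in degree k, and so does d ([cdybe_unique]).
*)

(** * Formal power series form a commutative ring *)
Lemma mps_sumE (F : fieldType) (n : nat) (V : lmodType F) I (r : seq I) (Q : pred I)
    (G : I -> mps n V) a :
  (\sum_(i <- r | Q i) G i) a = \sum_(i <- r | Q i) G i a.
Proof. by elim/big_rec2: _ => // i y1 y2 _ <-. Qed.

Section RawPowerSeries.
Variables (F : fieldType) (n : nat).

Definition rawps := mps n F^o.
HB.instance Definition _ := GRing.Lmodule.copy rawps ('X_{1..n} -> F^o).

Implicit Types (f g h : rawps) (a : 'X_{1..n}).

Definition fps_mul f g : rawps := @psconv F n F^o F^o F^o *%R f g.
Definition fps_one : rawps := pscst n (1 : F^o).

(** Coefficients of degree less than d of a product depend only on truncations, so
    the ring laws and the Leibniz rule are inherited from polynomials. *)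
Definition agree (d : nat) f (p : {mpoly F[n]}) :=
  forall a, (mdeg a < d)%N -> p@_a = f a.

Definition trunc (d : nat) f : {mpoly F[n]} :=
  \sum_(a : 'X_{1..n < d}) f a *: 'X_[a].

Lemma agree_trunc d f : agree d f (trunc d f).
Proof. by move=> a ad; rewrite /trunc (@mcoeff_mpoly _ _ f). Qed.

Lemma agree_eq f g : (forall d, exists2 p, agree d f p & agree d g p) -> f = g.
Proof. by move=> H; apply/funext => a; have [p <- // <- //] := H (mdeg a).+1. Qed.

Lemma agree_mul d f g p q : agree d f p -> agree d g q ->
  agree d (fps_mul f g) (p * q).
Proof.
move=> fp gq a ad; rewrite mcoeffM; apply: eq_bigr => k /eqP E.
have := leq_trans (bmdeg k.1) ad; have := leq_trans (bmdeg k.2) ad.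
by move=> h2 h1; rewrite fp ?gq.
Qed.

Lemma agree_add d f g p q : agree d f p -> agree d g q -> agree d (f + g) (p + q).
Proof. by move=> fp gq a ad; rewrite mcoeffD fp ?gq. Qed.

Lemma agree_one d : agree d fps_one 1.
Proof. by move=> a ad; rewrite mcoeff1 /fps_one /pscst; case: eqP. Qed.

Lemma agree_der d i f p : agree d.+1 f p -> agree d (psder i f) p^`M(i).
Proof.
move=> fp a ad; rewrite mcoeff_deriv -mulr_natl fp //.
by rewrite mdegD mdeg1 addn1.
Qed.

Lemma fps_mulA : associative fps_mul.
Proof.
move=> f g h; apply: agree_eq => d.
exists (trunc d f * (trunc d g * trunc d h)); last rewrite mulrA;
  by do 2?apply: agree_mul; apply: agree_trunc.
Qed.

Lemma fps_mulC : commutative fps_mul.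
Proof.
move=> f g; apply: agree_eq => d.
exists (trunc d f * trunc d g); first by apply: agree_mul; apply: agree_trunc.
by rewrite mulrC; apply: agree_mul; apply: agree_trunc.
Qed.

Lemma fps_mul1 : left_id fps_one fps_mul.
Proof.
move=> f; apply: agree_eq => d; exists (1 * trunc d f).
  by apply: agree_mul; [apply: agree_one|apply: agree_trunc].
by rewrite mul1r; apply: agree_trunc.
Qed.

Lemma fps_mulDl : left_distributive fps_mul +%R.
Proof.
move=> f g h; apply: agree_eq => d; exists ((trunc d f + trunc d g) * trunc d h).
  by apply: agree_mul; [apply: agree_add|]; apply: agree_trunc.
rewrite mulrDl; apply: agree_add; apply: agree_mul; apply: agree_trunc.
Qed.

Lemma fps_one_neq0 : fps_one != 0.
Proof.
apply/eqP => /(congr1 (fun f : rawps => f 0%MM)) /eqP.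
by rewrite /fps_one /pscst eqxx oner_eq0.
Qed.

HB.instance Definition _ := GRing.Zmodule_isComNzRing.Build rawps
  fps_mulA fps_mulC fps_mul1 fps_mulDl fps_one_neq0.

End RawPowerSeries.

Section PowerSeriesRing.
Variables (F : fieldType) (n : nat).
Implicit Type a : 'X_{1..n}.
Local Notation rawps := (rawps F n).

(** The ring structure is sealed behind an opaque constant: it is built on deep
    definitions whose unfolding during unification would dominate the matrix
    computations over this ring. *)
Definition fps := rawps.

Fact fps_sealed : {c : GRing.ComNzRing fps | c = GRing.ComNzRing.class rawps}.
Proof. by exists (GRing.ComNzRing.class rawps). Qed.

HB.instance Definition _ : GRing.ComNzRing fps := sval fps_sealed.

Implicit Types (f g : fps).
Local Notation mk c := (GRing.ComNzRing.Pack c).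

Lemma fps_addE f g a : (f + g) a = (f a : F) + g a.
Proof.
have H c : c = GRing.ComNzRing.class rawps ->
    (@GRing.add (mk c) f g : fps) a = (f a : F) + g a by move=> ->.
exact: (H _ (svalP fps_sealed)).
Qed.

Lemma fps_oppE f a : (- f) a = - (f a : F).
Proof.
have H c : c = GRing.ComNzRing.class rawps ->
    (@GRing.opp (mk c) f : fps) a = - (f a : F) by move=> ->.
exact: (H _ (svalP fps_sealed)).
Qed.

Lemma fps_zeroE a : (0 : fps) a = (0 : F).
Proof.
have H c : c = GRing.ComNzRing.class rawps ->
    (@GRing.zero (mk c) : fps) a = (0 : F) by move=> ->.
exact: (H _ (svalP fps_sealed)).
Qed.

Lemma fps_oneE : (1 : fps) = @fps_one F n.
Proof.
have H c : c = GRing.ComNzRing.class rawps -> @GRing.one (mk c) = @fps_one F n by move=> ->.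
exact: (H _ (svalP fps_sealed)).
Qed.

Lemma fps_mulmE f g : f * g = fps_mul f g.
Proof.
have H c : c = GRing.ComNzRing.class rawps -> @GRing.mul (mk c) f g = fps_mul f g by move=> ->.
exact: (H _ (svalP fps_sealed)).
Qed.

Definition fpsE := (fps_addE, fps_oppE, fps_zeroE).

Lemma fps_mulE f g a : (f * g) a =
  \sum_(k : 'X_{1..n < (mdeg a).+1, (mdeg a).+1} | a == (k.1 + k.2)%MM)
    (f k.1 * g k.2 : F).
Proof. by rewrite fps_mulmE. Qed.

Lemma fps_sumE I (r : seq I) (P : pred I) (G : I -> fps) a :
  (\sum_(i <- r | P i) G i) a = \sum_(i <- r | P i) (G i a : F^o).
Proof. by elim/big_rec2: _ => [|i y1 y2 _ <-]; rewrite ?fpsE. Qed.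

Definition euler f : fps := fun a => (mdeg a)%:R * f a.

Lemma euler_is_zmod : zmod_morphism euler.
Proof. by move=> f g; apply/funext => a; rewrite /euler !fpsE mulrBr. Qed.
HB.instance Definition _ := GRing.isZmodMorphism.Build fps fps euler euler_is_zmod.

Lemma eulerM f g : euler (f * g) = euler f * g + f * euler g.
Proof.
apply/funext => a; rewrite -[LHS]/(_ * (f * g) a) fpsE !fps_mulE.
rewrite mulr_sumr -big_split.
apply: eq_bigr => k /eqP ak /=; rewrite /euler {1}ak mdegD natrD; ring.
Qed.

Definition pder (i : 'I_n) f : fps := psder i f.

Lemma pder_is_zmod i : zmod_morphism (pder i).
Proof.
by move=> f g; apply/funext => a; rewrite /pder /psder !fpsE scalerBr.
Qed.
HB.instance Definition _ i :=
  GRing.isZmodMorphism.Build fps fps (pder i) (pder_is_zmod i).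

Lemma agree_addf d f g p q : agree d f p -> agree d g q -> agree d (f + g) (p + q).
Proof. by move=> fp gq a ad; rewrite mcoeffD fp ?gq // fps_addE. Qed.

Lemma pderM i f g : pder i (f * g) = pder i f * g + f * pder i g.
Proof.
apply: agree_eq => d; pose p := trunc d.+1 f; pose q := trunc d.+1 g.
have [fp gq] : agree d.+1 f p /\ agree d.+1 g q by split; apply: agree_trunc.
exists (p * q)^`M(i); first by apply: agree_der; rewrite fps_mulmE; apply: agree_mul.
have lt d' h u : agree d'.+1 h u -> agree d' h u by move=> H b bd; rewrite H // ltnW.
rewrite mderivM; apply: agree_addf; rewrite fps_mulmE; apply: agree_mul; try exact: lt;
  by apply: agree_der.
Qed.

Lemma euler_der i f : euler (pder i f) = pder i (euler f) - pder i f.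
Proof.
apply/funext => a; pose b := (a + U_(i))%MM.
have db : mdeg b = (mdeg a).+1 by rewrite mdegD mdeg1 addn1.
rewrite !fpsE -[LHS]/((mdeg a)%:R * ((a i).+1%:R * f b) : F).
rewrite -[RHS]/((a i).+1%:R * ((mdeg b)%:R * f b) - (a i).+1%:R * f b : F) db.
by rewrite -[(mdeg a).+1%:R]natr1; ring.
Qed.

Definition fpsC (c : F) : fps := pscst n (c : F^o).

Lemma fpsCE c a : fpsC c a = c *+ (a == 0%MM).
Proof. by rewrite /fpsC /pscst; case: eqP. Qed.

Lemma fpsC_mulE c f a : (fpsC c * f) a = c * f a.
Proof.
pose p := trunc (mdeg a).+1 f.
have fp : agree (mdeg a).+1 f p by apply: agree_trunc.
have cp : agree (mdeg a).+1 (fpsC c) c%:MP.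
  by move=> b _; rewrite mcoeffC fpsCE eq_sym; case: eqP => _; rewrite ?mulr1 ?mulr0.
have <- : (c%:MP * p)@_a = (fpsC c * f) a.
  by rewrite fps_mulmE; apply: (agree_mul cp fp (ltnSn _)).
by rewrite mcoeffCM fp.
Qed.

Lemma fpsC_is_zmod : zmod_morphism fpsC.
Proof. by move=> c d; apply/funext => a; rewrite !fpsE !fpsCE mulrnBl. Qed.
Lemma fpsC_is_monoid : monoid_morphism fpsC.
Proof.
split=> [|c d]; first by rewrite fps_oneE.
by apply/funext => a; rewrite fpsC_mulE !fpsCE mulrnAr.
Qed.
HB.instance Definition _ := GRing.isZmodMorphism.Build F fps fpsC fpsC_is_zmod.
HB.instance Definition _ := GRing.isMonoidMorphism.Build F fps fpsC fpsC_is_monoid.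

Lemma euler_fpsC c : euler (fpsC c) = 0 :> fps.
Proof.
apply/funext => a; rewrite /euler fpsCE fpsE.
by case: eqP => [->|_]; rewrite ?mdeg0 ?mul0r ?mulr0.
Qed.

Lemma pder_fpsC i c : pder i (fpsC c) = 0 :> fps.
Proof.
apply/funext => a; rewrite /pder /psder fpsCE.
suff -> : ((a + U_(i))%MM == 0%MM) = false by rewrite mulr0n scaler0 fpsE.
by apply/negP => /eqP/mnmP/(_ i); rewrite mnmDE mnm1E eqxx mnm0E addn1.
Qed.

Definition coordf (i : 'I_n) : fps := fun a => (a == U_(i)%MM)%:R.

Lemma psmulXE i f : psmulX i f = coordf i * f.
Proof.
apply/funext => a; pose p := trunc (mdeg a).+1 f.
have fp : agree (mdeg a).+1 f p by apply: agree_trunc.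
have cp : agree (mdeg a).+1 (coordf i) 'X_i.
  by move=> b _; rewrite mcoeffX eq_sym.
have <- : ('X_i * p)@_a = (coordf i * f) a.
  by rewrite fps_mulmE; apply: (agree_mul cp fp (ltnSn _)).
rewrite /psmulX mulrC.
case: ifP => [a0|/negbT]; last first.
  rewrite -leqNgt leqn0 => /eqP a0; rewrite mcoeffM big1 // => k /eqP E.
  rewrite mcoeffX; case: eqP => [e|_]; last by rewrite mulr0.
  move: (congr1 (fun b : 'X_{1..n} => b i) E).
  by rewrite a0 -e mnmDE mnm1E eqxx addn1.
have E : (U_(i) + (a - U_(i)) = a)%MM.
  apply/mnmP => j; rewrite mnmDE mnmBE mnm1E.
  by case: eqP => [<-|]; rewrite ?subn0 // addnC subnK.
move: (mcoeffMX p U_(i) (a - U_(i))); rewrite E => ->.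
by rewrite fp // ltnS -[X in (_ <= mdeg X)%N]E mdegD leq_addl.
Qed.

Lemma pder_coordf i j : pder i (coordf j) = (i == j)%:R :> fps.
Proof.
have -> : (i == j)%:R = fpsC (i == j)%:R by rewrite rmorph_nat.
apply/funext => a; rewrite /pder /psder /coordf fpsCE.
case: (eqVneq a 0%MM) => [->|a0].
  rewrite mnm0E add0m [_ *: _]mul1r.
  congr (_%:R); congr nat_of_bool; apply/eqP/eqP => [/mnmP/(_ j)|->//].
  by rewrite !mnm1E eqxx; case: (i =P j).
rewrite mulr0n; suff -> : ((a + U_(i))%MM == U_(j)%MM) = false by rewrite scaler0.
apply/negP => /eqP/(congr1 (@mdeg n)); rewrite mdegD !mdeg1 => /eqP.
by rewrite -[X in _ == X]add0n eqn_add2r mdeg_eq0 (negPf a0).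
Qed.

Lemma euler_coordf i : euler (coordf i) = coordf i.
Proof.
apply/funext => a; rewrite /euler /coordf.
by case: eqP => [->|_]; rewrite ?mdeg1 ?mulr0 // mul1r.
Qed.

(** The filtration by the order of vanishing at 0, along which all inductions on
    the degree are made. *)
Definition ordge (k : nat) f := forall a, (mdeg a < k)%N -> f a = 0.

Lemma ordge0 k : ordge k 0. Proof. by move=> a _; rewrite fpsE. Qed.
Lemma ordgeD k f g : ordge k f -> ordge k g -> ordge k (f + g).
Proof. by move=> fk gk a ak; rewrite fpsE fk // gk // addr0. Qed.
Lemma ordgeN k f : ordge k f -> ordge k (- f).
Proof. by move=> fk a ak; rewrite fpsE fk // oppr0. Qed.
Lemma ordgeB k f g : ordge k f -> ordge k g -> ordge k (f - g).
Proof. by move=> fk gk; apply/ordgeD/ordgeN. Qed.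
Lemma ordge_sum k I (r : seq I) (P : pred I) (G : I -> fps) :
  (forall i, P i -> ordge k (G i)) -> ordge k (\sum_(i <- r | P i) G i).
Proof. by move=> H; elim/big_rec: _ => [|i x Pi xk]; [apply: ordge0|apply/ordgeD/xk/H]. Qed.
Lemma ordgeW j k f : (j <= k)%N -> ordge k f -> ordge j f.
Proof. by move=> jk fk a aj; rewrite fk // (leq_trans aj). Qed.
Lemma ordgeM j k f g : ordge j f -> ordge k g -> ordge (j + k) (f * g).
Proof.
move=> fj gk a ajk; rewrite fps_mulE big1 // => m /eqP E.
case: (ltnP (mdeg m.1) j) => [/fj->|jm]; first by rewrite mul0r.
rewrite gk ?mulr0 // -(ltn_add2l j) (leq_ltn_trans _ ajk) //.
have /eqP := congr1 (@mdeg n) E; rewrite mdegD eqn_leq => /andP[_].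
by apply: leq_trans; rewrite leq_add2r.
Qed.
Lemma ordgeMl k f g : ordge k g -> ordge k (f * g).
Proof. exact: (@ordgeM 0). Qed.
Lemma ordgeMr k f g : ordge k f -> ordge k (f * g).
Proof. by move=> fk; rewrite mulrC; apply: ordgeMl. Qed.
Lemma ordge_coordf i : ordge 1 (coordf i).
Proof.
move=> a; rewrite ltnS leqn0 mdeg_eq0 => /eqP->; rewrite /coordf.
case: eqP => // /(congr1 (@mdeg n)); by rewrite mdeg0 mdeg1.
Qed.
Lemma ordge_eq0 f : (forall k, ordge k f) -> f = 0.
Proof. by move=> H; apply/funext => a; rewrite fpsE; apply: (H (mdeg a).+1). Qed.

End PowerSeriesRing.

(** * Bilinear brackets and derivations *)

(** The bracket of g extended to O-valued vectors, on coordinates. It is locked so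
    that conversion never unfolds the double sum. *)
HB.lock Definition brk (O : comNzRingType) (N : nat) (C : 'I_N -> 'I_N -> 'cV[O]_N)
    (u v : 'cV[O]_N) : 'cV[O]_N :=
  \sum_i \sum_j (u i 0 * v j 0) *: C i j.

Section Bracket.
Variables (O : comNzRingType) (N : nat) (C : 'I_N -> 'I_N -> 'cV[O]_N).
Implicit Types u v w : 'cV[O]_N.

Local Notation brk := (brk C).

Lemma brk_linearl v : linear (brk^~ v).
Proof.
move=> a u w; rewrite brk.unlock scaler_sumr -big_split; apply: eq_bigr => i _ /=.
rewrite scaler_sumr -big_split; apply: eq_bigr => j _ /=.
by rewrite !mxE mulrDl scalerDl scalerA mulrA.
Qed.

Lemma brk_linearr u : linear (brk u).
Proof.
move=> a v w; rewrite brk.unlock scaler_sumr -big_split; apply: eq_bigr => i _ /=.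
rewrite scaler_sumr -big_split; apply: eq_bigr => j _ /=.
by rewrite !mxE mulrDr scalerDl scalerA mulrCA.
Qed.

HB.instance Definition _ u := GRing.isLinear.Build O 'cV[O]_N 'cV[O]_N *:%R (brk u)
  (brk_linearr u).

Definition brkl v u := brk u v.
HB.instance Definition _ v := GRing.isLinear.Build O 'cV[O]_N 'cV[O]_N *:%R (brkl v)
  (brk_linearl v).

Lemma brkDl u v w : brk (u + v) w = brk u w + brk v w.
Proof. exact: (linearD (brkl w)). Qed.
Lemma brkDr u v w : brk w (u + v) = brk w u + brk w v.
Proof. exact: (linearD (brk w)). Qed.
Lemma brkNl u w : brk (- u) w = - brk u w.
Proof. exact: (linearN (brkl w)). Qed.
Lemma brkNr u w : brk w (- u) = - brk w u.
Proof. exact: (linearN (brk w)). Qed.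
Lemma brkZl c u w : brk (c *: u) w = c *: brk u w.
Proof. exact: (linearZ_LR (brkl w)). Qed.
Lemma brkZr c u w : brk w (c *: u) = c *: brk w u.
Proof. exact: (linearZ_LR (brk w)). Qed.
Lemma brk0l w : brk 0 w = 0.
Proof. exact: (linear0 (brkl w)). Qed.
Lemma brk0r w : brk w 0 = 0.
Proof. exact: (linear0 (brk w)). Qed.
Lemma brk_suml I (r : seq I) (G : I -> 'cV[O]_N) w :
  brk (\sum_(i <- r) G i) w = \sum_(i <- r) brk (G i) w.
Proof. exact: (linear_sum (brkl w)). Qed.
Lemma brk_sumr I (r : seq I) (G : I -> 'cV[O]_N) w :
  brk w (\sum_(i <- r) G i) = \sum_(i <- r) brk w (G i).
Proof. exact: (linear_sum (brk w)). Qed.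

Definition unitc (i : 'I_N) : 'cV[O]_N := delta_mx i 0.

Lemma unitc_sum u : u = \sum_i u i 0 *: unitc i.
Proof.
apply/matrixP => i j; rewrite ord1 summxE (bigD1 i) //= !mxE !eqxx mulr1 big1 ?addr0 //.
by move=> k ki; rewrite !mxE eq_sym (negPf ki) mulr0.
Qed.

Lemma brk_unitc i j : brk (unitc i) (unitc j) = C i j.
Proof.
rewrite brk.unlock (bigD1 i) //= (bigD1 j) //= !mxE !eqxx mulr1 scale1r !big1 ?addr0 //.
  move=> k ki; rewrite big1 // => p _.
  by rewrite !mxE (negPf ki) mul0r scale0r.
by move=> p pj; rewrite !mxE (negPf pj) mulr0 scale0r.
Qed.

Lemma brk_anti : (forall i j, C i j = - C j i) -> forall u v, brk u v = - brk v u.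
Proof.
move=> CN u v; rewrite brk.unlock exchange_big -sumrN; apply: eq_bigr => i _ /=.
rewrite -sumrN; apply: eq_bigr => j _ /=.
by rewrite CN scalerN mulrC.
Qed.

Definition jac u v w := brk u (brk v w) + brk v (brk w u) + brk w (brk u v).

Lemma jac_rot u v w : jac u v w = jac v w u.
Proof. by rewrite /jac -addrA addrC. Qed.

Lemma jac_suml u v w : jac u v w = \sum_i u i 0 *: jac (unitc i) v w.
Proof.
rewrite [in LHS](unitc_sum u) /jac !(brk_suml, brk_sumr) -!big_split.
by apply: eq_bigr => i _ /=; rewrite !(brkZl, brkZr) !scalerDr.
Qed.

Lemma brk_jacobi :
  (forall i j k, jac (unitc i) (unitc j) (unitc k) = 0) -> forall u v w, jac u v w = 0.
Proof.
move=> J u v w; rewrite jac_suml big1 // => i _.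
rewrite jac_rot jac_suml big1 ?scaler0 // => j _.
rewrite jac_rot jac_suml big1 ?scaler0 // => k _.
by rewrite jac_rot J scaler0.
Qed.

Definition derivation (d : O -> O) :=
  zmod_morphism d /\ (forall f g, d (f * g) = d f * g + f * d g).

Lemma derivation_sum d (dd : derivation d) I (r : seq I) (P : pred I) (G : I -> O) :
  d (\sum_(i <- r | P i) G i) = \sum_(i <- r | P i) d (G i).
Proof.
have [dB _] := dd; pose dA := GRing.isZmodMorphism.Build O O d dB.
by pose d' : {additive O -> O} := HB.pack d dA; apply: (raddf_sum d').
Qed.

Lemma derivationD d (dd : derivation d) f g : d (f + g) = d f + d g.
Proof.
have [dB _] := dd; pose dA := GRing.isZmodMorphism.Build O O d dB.
by pose d' : {additive O -> O} := HB.pack d dA; apply: (raddfD d').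
Qed.

Lemma derivationN d (dd : derivation d) f : d (- f) = - d f.
Proof.
have [dB _] := dd; pose dA := GRing.isZmodMorphism.Build O O d dB.
by pose d' : {additive O -> O} := HB.pack d dA; apply: (raddfN d').
Qed.

Lemma derivation_mulmx d (dd : derivation d) m n p (A : 'M[O]_(m, n)) (B : 'M[O]_(n, p)) :
  map_mx d (A *m B) = map_mx d A *m B + A *m map_mx d B.
Proof.
apply/matrixP => i j; rewrite !mxE (derivation_sum dd) -big_split.
by apply: eq_bigr => k _; rewrite !mxE dd.2.
Qed.

Lemma derivation_brk d u v (dd : derivation d) : (forall i j, map_mx d (C i j) = 0) ->
  map_mx d (brk u v) = brk (map_mx d u) v + brk u (map_mx d v).
Proof.
move=> dC; apply/matrixP => k z; rewrite brk.unlock mxE !summxE (derivation_sum dd).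
rewrite mxE !summxE -big_split; apply: eq_bigr => i _ /=.
rewrite !summxE (derivation_sum dd) -big_split; apply: eq_bigr => j _ /=.
have := congr1 (fun M : 'cV_N => M k z) (dC i j); rewrite !mxE !dd.2 => ->.
by rewrite mulr0 addr0 mulrDl.
Qed.

End Bracket.

(** * The contracted Bianchi identity of the dynamical equation *)

(** The setting is that of g-valued functions in coordinates: C are the structure
    constants, D is the Euler field, the dl a are the coefficients of
    sum_k x_k (x) d/dx_k with respect to the basis of g, lam a is the linear function lambda(P e_a), and S is an
    antisymmetric solution of the radial equation. In the equivariance condition
    S_equiv the coadjoint field of P u is written with the functions
    lambda([u, e_i]), which is possible for every vector u, not only for those in l,
    since lambda vanishes on [m, l]. *)
Section ContractedBianchi.
Variables (O : comNzRingType) (N : nat) (C : 'I_N -> 'I_N -> 'cV[O]_N).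
Local Notation brk := (brk C).
Hypothesis brkC : forall u v, brk u v = - brk v u.
Hypothesis brkJ : forall u v w, jac C u v w = 0.
Variables (D : O -> O) (dl : 'I_N -> O -> O).
Hypothesis D_der : derivation D.
Hypothesis dl_der : forall a, derivation (dl a).
Hypothesis DC : forall i j, map_mx D (C i j) = 0.
Hypothesis dlC : forall a i j, map_mx (dl a) (C i j) = 0.
Hypothesis D_dl : forall a f, D (dl a f) = dl a (D f) - dl a f.
Variables (lam : 'I_N -> O) (P S Om : 'M[O]_N) (kap : O).
Hypothesis dl_P : forall a i j, dl a (P i j) = 0.
Hypothesis dl_Om : forall a i j, dl a (Om i j) = 0.
Hypothesis D_Om : forall i j, D (Om i j) = 0.
Hypothesis dl_kap : forall a, dl a kap = 0.
Hypothesis D_kap : D kap = 0.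
Hypothesis dl_lam : forall a i, dl a (lam i) = P a i.
Hypothesis P_dl : forall a f, \sum_i P a i * dl i f = dl a f.
Hypothesis S_anti : forall a b, S a b = - S b a.
Hypothesis Om_sym : forall a b, Om a b = Om b a.

Definition pair_lam (u : 'cV[O]_N) : O := \sum_k lam k * u k 0.
Local Notation ll := pair_lam.

Local Notation e_ := (@unitc O N).
Local Notation Sc b := (col b S).
Local Notation Oc b := (col b Om).
Definition Srow (x : 'I_N -> O) : 'cV[O]_N := \sum_i x i *: Sc i.

Hypothesis Om_inv : forall y a b, brk y (Oc a) b 0 + brk y (Oc b) a 0 = 0.
Hypothesis S_equiv : forall u a b,
  brk (P *m u) (Sc b) a 0 - brk (P *m u) (Sc a) b 0 +
  \sum_i ll (brk u (e_ i)) * dl i (S a b) = 0.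
Hypothesis S_radial : forall a b,
  D (S a b) + \sum_i P a i * S i b + \sum_i P b i * S a i =
  - ll (brk (Sc a) (Sc b)) - kap * ll (brk (Oc a) (Oc b)).

(** The component abc of Alt(dr) + CYB(r) for r = Om / 2 + S, when kap = 1 / 4: the
    antisymmetry of S turns the signs of Alt and the legs of CYB into cyclic sums,
    and invariance of Om cancels the terms of CYB that are mixed in Om and S. *)
Definition skew_cdybe (a b c : 'I_N) : O :=
  dl a (S b c) + dl b (S c a) + dl c (S a b)
  + brk (Sc b) (Sc c) a 0 + brk (Sc c) (Sc a) b 0 + brk (Sc a) (Sc b) c 0
  + kap * brk (Oc b) (Oc c) a 0.

Implicit Types (u v w : 'cV[O]_N) (x : 'I_N -> O).
Lemma llD u v : ll (u + v) = ll u + ll v.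
Proof. by rewrite /ll -big_split; apply: eq_bigr => i _; rewrite mxE mulrDr. Qed.
Lemma llN u : ll (- u) = - ll u.
Proof. by rewrite /ll -sumrN; apply: eq_bigr => i _; rewrite mxE mulrN. Qed.
Lemma llZ c u : ll (c *: u) = c * ll u.
Proof. by rewrite /ll mulr_sumr; apply: eq_bigr => i _; rewrite mxE mulrCA. Qed.
Lemma ll_sum I (r : seq I) (G : I -> 'cV[O]_N) :
  ll (\sum_(i <- r) G i) = \sum_(i <- r) ll (G i).
Proof.
elim: r => [|i r IH]; last by rewrite !big_cons llD IH.
by rewrite !big_nil /ll big1 // => k _; rewrite mxE mulr0.
Qed.

Lemma ll_brkC u v : ll (brk u v) = - ll (brk v u).
Proof. by rewrite brkC llN. Qed.

Lemma ll_jac u v w : ll (brk u (brk v w)) + ll (brk v (brk w u)) + ll (brk w (brk u v)) = 0.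
Proof. by rewrite -!llD -/(jac C u v w) brkJ /ll big1 // => k _; rewrite mxE mulr0. Qed.

Lemma ll_contract (u v : 'cV[O]_N) : \sum_i ll (brk u (e_ i)) * v i 0 = ll (brk u v).
Proof.
rewrite {2}(unitc_sum v) brk_sumr ll_sum; apply: eq_bigr => i _.
by rewrite brkZr llZ mulrC.
Qed.

Lemma dl_ll a u : dl a (ll u) = \sum_i P a i * u i 0 + ll (map_mx (dl a) u).
Proof.
rewrite /ll (derivation_sum (dl_der a)) -big_split; apply: eq_bigr => k _ /=.
by rewrite (dl_der a).2 dl_lam mxE.
Qed.

Lemma Om_cyc a b c : brk (Oc b) (Oc c) a 0 = brk (Oc c) (Oc a) b 0.
Proof.
rewrite brkC mxE; have /eqP := Om_inv (Oc c) b a.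
by rewrite addr_eq0 => /eqP ->; rewrite opprK.
Qed.

Lemma skew_cdybe_cyc a b c : skew_cdybe a b c = skew_cdybe b c a.
Proof. by rewrite /skew_cdybe Om_cyc; ring. Qed.

Lemma brk_Srow_r u x a : brk u (Srow x) a 0 = \sum_i x i * brk u (Sc i) a 0.
Proof.
by rewrite brk_sumr summxE; apply: eq_bigr => i _; rewrite brkZr mxE.
Qed.
Lemma brk_Srow_l u x a : brk (Srow x) u a 0 = \sum_i x i * brk (Sc i) u a 0.
Proof.
by rewrite brk_suml summxE; apply: eq_bigr => i _; rewrite brkZl mxE.
Qed.

Lemma skew_cdybe_contract x b c : \sum_i x i * skew_cdybe i b c =
  \sum_i x i * dl i (S b c) + \sum_i x i * dl b (S c i) + \sum_i x i * dl c (S i b)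
  + \sum_i x i * brk (Sc b) (Sc c) i 0 + brk (Sc c) (Srow x) b 0
  + brk (Srow x) (Sc b) c 0 + kap * \sum_i x i * brk (Oc b) (Oc c) i 0.
Proof.
rewrite brk_Srow_r brk_Srow_l mulr_sumr -!big_split; apply: eq_bigr => i _ /=.
by rewrite /skew_cdybe; ring.
Qed.

(** The linear form lambda o ad(S_c): it gives the coefficients of the right-hand
    side of the identity, as well as those of the coadjoint field of P S_c. *)
Definition rho c i := ll (brk (Sc c) (e_ i)).
Definition tau c i := ll (brk (Oc c) (e_ i)).
Definition invar_corr b : 'cV[O]_N := kap *: \sum_i tau b i *: Oc i.

Lemma D_col b : map_mx D (Sc b) =
  - Srow (rho b) + invar_corr b - Srow (P b) - P *m Sc b.
Proof.
apply/matrixP => a z; rewrite ord1 !mxE !summxE.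
have R (p q r w : O) : p + q + r = w -> p = w - q - r by move=> <-; ring.
rewrite (R _ _ _ _ (S_radial a b)) (ll_brkC (Sc a)) (ll_brkC (Oc a)) -!ll_contract opprK.
rewrite (eq_bigr (fun i => - ((rho b i *: Sc i) a 0))); last first.
  by move=> i _; rewrite /rho !mxE S_anti mulrN.
rewrite sumrN [\sum_i ll (brk (Oc b) _) * _](_ : _ = \sum_i (tau b i *: Oc i) a 0); last first.
  by apply: eq_bigr => i _; rewrite /tau !mxE Om_sym.
rewrite [\sum_i P b i * _](_ : _ = \sum_i (P b i *: Sc i) a 0); last first.
  by apply: eq_bigr => i _; rewrite !mxE.
rewrite [\sum_i P a i * _](_ : _ = \sum_i P a i * Sc b i 0); last first.
  by apply: eq_bigr => i _; rewrite !mxE.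
ring.
Qed.

Lemma brk_invar_corr y a b : brk y (invar_corr b) a 0 = - (kap * ll (brk (Oc b) (brk y (Oc a)))).
Proof.
rewrite /invar_corr brkZr mxE brk_sumr summxE -ll_contract -mulrN -sumrN; congr (_ * _).
apply: eq_bigr => i _; rewrite brkZr mxE /tau -mulrN; congr (_ * _).
by apply/eqP; rewrite -addr_eq0 Om_inv.
Qed.

(** The contributions of Om to the identity cancel: after moving ad(S_c) with the
    invariance of Om, they are lambda of a Jacobi sum. *)
Lemma invar_corr_cancel a b c :
  kap * \sum_i rho c i * brk (Oc a) (Oc b) i 0 + brk (invar_corr b) (Sc c) a 0
  + brk (Sc c) (invar_corr a) b 0 = 0.
Proof.
rewrite ll_contract (brkC (invar_corr b)) mxE !brk_invar_corr opprK.
have := ll_jac (Sc c) (Oc a) (Oc b).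
rewrite (brkC (Oc b) (Sc c)) brkNr llN => J.
by rewrite -[RHS](mulr0 kap) -J; ring.
Qed.

(** Equivariance turns the derivative terms of the right-hand side into brackets. *)
Lemma rho_der a b c : \sum_i rho c i * dl i (S a b) =
  brk (Sc b) (P *m Sc c) a 0 + brk (P *m Sc c) (Sc a) b 0.
Proof.
have /eqP := S_equiv (Sc c) a b; rewrite addrC addr_eq0 => /eqP ->.
by rewrite [brk (Sc b) _]brkC mxE; ring.
Qed.

Lemma dl_S_lam a b c : \sum_i rho c i * dl a (S b i) = - ll (brk (Sc c) (map_mx (dl a) (Sc b))).
Proof.
rewrite -ll_contract -sumrN; apply: eq_bigr => i _.
rewrite S_anti (derivationN (dl_der a)) !mxE mulrN //.
Qed.

Lemma dl_S_lam' a b c : \sum_i rho c i * dl a (S i b) = ll (brk (Sc c) (map_mx (dl a) (Sc b))).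
Proof. by rewrite -ll_contract; apply: eq_bigr => i _; rewrite !mxE. Qed.

Lemma D_dl_S a b c : D (dl a (S b c)) =
  - \sum_i P a i * brk (Sc b) (Sc c) i 0 + ll (brk (Sc c) (map_mx (dl a) (Sc b)))
  - ll (brk (Sc b) (map_mx (dl a) (Sc c))) - kap * \sum_i P a i * brk (Oc b) (Oc c) i 0
  - \sum_i P b i * dl a (S i c) - \sum_i P c i * dl a (S b i) - dl a (S b c).
Proof.
rewrite D_dl; congr (_ - _).
have R (p q r w : O) : p + q + r = w -> p = w - q - r by move=> <-; ring.
rewrite (R _ _ _ _ (S_radial b c)).
have dd := dl_der a.
rewrite !(derivationD dd, derivationN dd) (dd.2 kap) dl_kap mul0r add0r !dl_ll.
rewrite !(derivation_brk _ _ dd (dlC a)).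
have z d : map_mx (dl a) (Oc d) = 0 by apply/matrixP => i j; rewrite !mxE dl_Om.
rewrite !z brk0l brk0r !addr0.
have -> : ll 0 = 0 by rewrite /ll big1 // => k _; rewrite mxE mulr0.
rewrite addr0 llD (ll_brkC (map_mx _ _)).
rewrite !(derivation_sum (dl_der a)).
have PE y : dl a (P b y * S y c) = P b y * dl a (S y c).
  by rewrite dd.2 dl_P mul0r add0r.
rewrite (eq_bigr _ (fun i _ => PE i)).
have PE' y : dl a (P c y * S b y) = P c y * dl a (S b y).
  by rewrite dd.2 dl_P mul0r add0r.
rewrite (eq_bigr _ (fun i _ => PE' i)).
ring.
Qed.

Lemma D_brk_S a b c : D (brk (Sc b) (Sc c) a 0) =
  - brk (Srow (rho b)) (Sc c) a 0 + brk (invar_corr b) (Sc c) a 0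
  - brk (Srow (P b)) (Sc c) a 0 - brk (P *m Sc b) (Sc c) a 0
  - brk (Sc b) (Srow (rho c)) a 0 + brk (Sc b) (invar_corr c) a 0
  - brk (Sc b) (Srow (P c)) a 0 - brk (Sc b) (P *m Sc c) a 0.
Proof.
have -> : D (brk (Sc b) (Sc c) a 0) = map_mx D (brk (Sc b) (Sc c)) a 0 by rewrite mxE.
rewrite (derivation_brk _ _ D_der DC) !D_col !(brkDl, brkDr, brkNl, brkNr).
have E (u v : 'cV[O]_N) : (u + v) a 0 = u a 0 + v a 0 by rewrite mxE.
have En (u : 'cV[O]_N) : (- u) a 0 = - u a 0 by rewrite mxE.
by rewrite !(E, En) !addrA.
Qed.

Lemma D_brk_Om a b c : D (kap * brk (Oc b) (Oc c) a 0) = 0.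
Proof.
rewrite D_der.2 D_kap mul0r add0r.
have z d : map_mx D (Oc d) = 0 by apply/matrixP => i j; rewrite !mxE D_Om.
move: (congr1 (fun M : 'cV_N => M a 0) (derivation_brk (Oc b) (Oc c) D_der DC)).
rewrite mxE => ->.
by rewrite !z brk0l brk0r addr0 mxE mulr0.
Qed.

(** Apply D to each term of E = skew_cdybe, commute it past the derivatives dl, and
    replace D S by the radial equation. The terms with a derivative of S match those
    of the right-hand side directly or through equivariance, the terms quadratic
    in S match, the cubic term is lambda of the Jacobi sum of S_a, S_b, S_c, and the
    terms with Om cancel by invariance. *)
Theorem skew_cdybe_radial a b c :
  D (skew_cdybe a b c) + \sum_i P a i * skew_cdybe i b c + \sum_i P b i * skew_cdybe a i c
    + \sum_i P c i * skew_cdybe a b i =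
  - (\sum_i rho c i * skew_cdybe i a b + \sum_i rho a i * skew_cdybe i b c
     + \sum_i rho b i * skew_cdybe i c a).
Proof.
rewrite [\sum_i P b i * _](eq_bigr (fun i => P b i * skew_cdybe i c a)); last first.
  by move=> i _; rewrite skew_cdybe_cyc.
rewrite [\sum_i P c i * _](eq_bigr (fun i => P c i * skew_cdybe i a b)); last first.
  by move=> i _; rewrite -skew_cdybe_cyc.
apply/eqP; rewrite -addr_eq0; apply/eqP.
rewrite !skew_cdybe_contract !rho_der !dl_S_lam !dl_S_lam' !ll_contract !P_dl.
rewrite /skew_cdybe !(derivationD D_der) D_brk_Om !D_dl_S !D_brk_S.
have W1 := invar_corr_cancel a b c; have W2 := invar_corr_cancel b c a; have W3 := invar_corr_cancel c a b.
rewrite !ll_contract in W1 W2 W3.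
have J := ll_jac (Sc a) (Sc b) (Sc c).
have lin (y w1 w2 w3 w4 : O) : w1 = 0 -> w2 = 0 -> w3 = 0 -> w4 = 0 ->
  y = w1 + w2 + w3 + w4 -> y = 0 by move=> -> -> -> -> ->; rewrite !addr0.
apply: (lin _ _ _ _ _ W1 W2 W3 J) => {lin W1 W2 W3 J}.
(* Naming the values of lambda, the sums, the derivatives and the entries leaves a
   small polynomial identity. *)
repeat match goal with |- context [pair_lam ?u] => generalize (pair_lam u) => ? end.
repeat match goal with |- context [bigop ?x ?y ?z] => generalize (bigop x y z) => ? end.
repeat match goal with |- context [dl ?a ?u] => generalize (dl a u) => ? end.
repeat match goal with |- context [fun_of_matrix ?u ?a ?z] => generalize (fun_of_matrix u a z) => ? end.
ring.
Qed.
End ContractedBianchi.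

(** * The Riccati equation of the series f *)
Section SeriesOfF.
Variable F : numFieldType.

(** Congruence to 0 modulo 'X^K: power series in one variable are represented by
    truncations to polynomials. *)
Definition vanish_below (K : nat) (q : {poly F}) := forall k, (k < K)%N -> q`_k = 0.

Implicit Types p q : {poly F}.
Lemma vanish_belowD K p q : vanish_below K p -> vanish_below K q -> vanish_below K (p + q).
Proof. by move=> pk qk k kK; rewrite coefD pk // qk // addr0. Qed.
Lemma vanish_belowN K p : vanish_below K p -> vanish_below K (- p).
Proof. by move=> pk k kK; rewrite coefN pk // oppr0. Qed.
Lemma vanish_belowMl K p q : vanish_below K q -> vanish_below K (p * q).
Proof.
move=> qk k kK; rewrite coefM big1 // => j _; rewrite qk ?mulr0 //.
exact: leq_ltn_trans (leq_subr _ _) kK.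
Qed.
Lemma vanish_below_deriv K p : vanish_below K.+1 p -> vanish_below K p^`().
Proof. by move=> pk k kK; rewrite coef_deriv pk ?mul0rn. Qed.
Lemma vanish_belowW K p : vanish_below K.+1 p -> vanish_below K p.
Proof. by move=> pk k kK; apply: pk; apply: ltnW. Qed.

Lemma vanish_below_cancel K p q : p`_0 = 0 -> p`_1 = 1 -> vanish_below K.+1 (p * q) -> vanish_below K q.
Proof.
move=> p0 p1 pq k; elim/ltn_ind: k => k IH kK.
have := pq k.+1 kK; rewrite coefM 2!big_ord_recl /= p0 mul0r add0r p1 mul1r subn1 /=.
rewrite big1 ?addr0 // => i _.
rewrite /bump /= !add1n subSS IH ?mulr0 //; last first.
  by apply: leq_ltn_trans kK; apply: leq_subr.
by rewrite ltn_subrL /= (leq_ltn_trans _ (ltn_ord i)).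
Qed.

Lemma sinh2S k : k.+1%:R * sinh2 F k.+1 = 2^-1 * cosh2 F k.
Proof.
rewrite /sinh2 /cosh2 /=; case: odd => /=; rewrite ?mulr0 //.
have kn0 : k`!%:R != 0 :> F by rewrite pnatr_eq0 -lt0n fact_gt0.
have k1 : k.+1%:R != 0 :> F by rewrite pnatr_eq0.
by rewrite factS natrM exprS; field; rewrite kn0 nat1r k1.
Qed.

Lemma cosh2S k : k.+1%:R * cosh2 F k.+1 = 2^-1 * sinh2 F k.
Proof.
rewrite /sinh2 /cosh2 /=; case: odd => /=; rewrite ?mulr0 //.
have kn0 : k`!%:R != 0 :> F by rewrite pnatr_eq0 -lt0n fact_gt0.
have k1 : k.+1%:R != 0 :> F by rewrite pnatr_eq0.
by rewrite factS natrM exprS; field; rewrite kn0 nat1r k1.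
Qed.

(** The coefficient form of s f' + 2 f = s f^2 - s / 4. With S = 2 sinh(s / 2) and
    C = 2 cosh(s / 2), f is defined by f s S = S - s C / 2. Differentiating this
    relation and using S' = C / 2, C' = S / 2 shows that S kills
    s f' + 2 f - s f^2 + s / 4, and S has order exactly 1. *)
Lemma f_AM_rec k : k.+2%:R * f_AM F k =
  (\sum_(i < k) f_AM F i * f_AM F (k.-1 - i)) - (k == 1%N)%:R / 4.
Proof.
pose K := k.+3; pose p := \poly_(i < K) f_AM F i.
pose S := \poly_(i < K) sinh2 F i; pose C := \poly_(i < K) cosh2 F i.
have pE i : (i < K)%N -> p`_i = f_AM F i by rewrite coef_poly => ->.
have SE i : (i < K)%N -> S`_i = sinh2 F i by rewrite coef_poly => ->.
have CE i : (i < K)%N -> C`_i = cosh2 F i by rewrite coef_poly => ->.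
have e1 : vanish_below K (p * 'X * S - S + 2^-1%:P * 'X * C).
  move=> i iK; rewrite -mulrA coefD coefB coefM -mulrA coefCM (coefXM C) SE //.
  rewrite (eq_bigr (fun j : 'I_i.+1 => f_AM F j * f_den F (i - j))); last first.
    move=> j _; have ji : (j <= i)%N by rewrite -ltnS.
    rewrite pE ?(leq_ltn_trans ji) // coefXM /f_den.
    case E : (i - j)%N => [|d] //=; rewrite SE //.
    by apply: leq_ltn_trans iK; rewrite (leq_trans (leqnSn _)) // -E leq_subr.
  rewrite f_AM_spec /f_num.
  case: i iK => [|i] iK /=; first by rewrite subr0 mulr0 addr0 subrr.
  by rewrite CE 1?ltnW //; ring.
have e2 : vanish_below K.-1 (S^`() - 2^-1%:P * C).
  by move=> i iK; rewrite coefB coefCM coef_deriv SE // CE 1?ltnW // -sinh2S mulr_natl subrr.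
have e3 : vanish_below K.-1 (C^`() - 2^-1%:P * S).
  by move=> i iK; rewrite coefB coefCM coef_deriv CE // SE 1?ltnW // -cosh2S mulr_natl subrr.
(* The scalar 1 / 4 is kept as a square of 1 / 2 so that ring handles it below as an
   atom. *)
pose W := 'X * p^`() + p + p - 'X * (p * p) + 2^-1%:P * 2^-1%:P * 'X.
have SW : vanish_below K.-1 (S * W).
  have := vanish_below_deriv e1; rewrite derivD derivB !derivM derivX derivC => e1'.
  have -> : S * W = (((p^`() * 'X + p * 1) * S + p * 'X * S^`() - S^`() +
      ((0 * 'X + 2^-1%:P * 1) * C + 2^-1%:P * 'X * C^`()))) +
      - (p * (p * 'X * S - S + 2^-1%:P * 'X * C)) +
      - ((p * 'X - 1) * (S^`() - 2^-1%:P * C)) +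
      - ((2^-1%:P * 'X) * (C^`() - 2^-1%:P * S)).
    by rewrite /W; move: (2^-1%:P : {poly F}) => h; ring.
  apply: vanish_belowD; last by apply/vanish_belowN/vanish_belowMl.
  apply: vanish_belowD; last by apply/vanish_belowN/vanish_belowMl.
  apply: vanish_belowD; last by apply/vanish_belowN/vanish_belowMl/vanish_belowW.
  exact: e1'.
have S0 : S`_0 = 0 by rewrite SE.
have S1 : S`_1 = 1 by rewrite SE // /sinh2 /= expr1 divr1 divff // pnatr_eq0.
have Wk : W`_k = 0 by apply: (vanish_below_cancel S0 S1 SW).
have {pE} pE i : (i <= k)%N -> p`_i = f_AM F i.
  by move=> ik; rewrite pE // (leq_ltn_trans ik) // /K !ltnS leqW.
rewrite {}/W in Wk SW; clear SW S0 S1 e1 e2 e3 SE CE S C.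
move: p pE Wk => p pE; clear K.
rewrite /= coefD coefB !coefD !coefXM -mulrA !coefCM coefX !coef_deriv coefM.
case: k pE => [|k] pE /=; rewrite !pE //.
  by rewrite !mulr0 !addr0 big_ord0 subr0 add0r mul0r subr0 => H; rewrite mulr_natl mulr2n.
rewrite (eq_bigr (fun i : 'I_k.+1 => f_AM F i * f_AM F (k - i))); last first.
  by move=> i _; rewrite !pE // ?(leq_trans (leq_subr _ _)) // ltnW.
rewrite eqSS => H.
apply/eqP; rewrite -subr_eq0 -[X in _ == X]H; apply/eqP => {H}.
move: (bigop _ _ _) (f_AM _ _) => s f.
by case: eqP => _; field.
Qed.
End SeriesOfF.

(** * Uniqueness and existence for radial equations *)
Section RadialUniqueness.
Variables (F : numFieldType).

Lemma natS_scale_eq0 (V : lmodType F) (k : nat) (v : V) : k.+1%:R *: v = 0 -> v = 0.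
Proof. by move/eqP; rewrite scaler_eq0 pnatr_eq0 /= => /eqP. Qed.

Lemma linear_rules (V W : lmodType F) (P : V -> W) : linear P ->
  [/\ {morph P : u v / u + v}, (forall k, {morph P : v / k *: v}) & P 0 = 0].
Proof.
move=> lP; have P0 : P 0 = 0.
  have := lP (-1) 0 0; rewrite !scaleN1r oppr0 !addr0 => ->.
  by rewrite addNr.
split=> // [u v|k v]; first by rewrite -{1}[u]scale1r lP scale1r.
by rewrite -[k *: v]addr0 lP P0 !addr0.
Qed.

(** Commuting projectors are simultaneously diagonalisable with eigenvalues 0 and 1,
    so the eigenvalues of k + P1 + P2 + P3 are k, ..., k + 3 and its kernel is the
    common kernel of its four terms. The proof evaluates the equation after applying
    products of the projectors, the longest ones first. *)
Lemma proj_kernel (V : lmodType F) (P1 P2 P3 : V -> V) (k : nat) (v : V) :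
  linear P1 -> linear P2 -> linear P3 ->
  (forall v, P1 (P1 v) = P1 v) -> (forall v, P2 (P2 v) = P2 v) ->
  (forall v, P3 (P3 v) = P3 v) ->
  (forall v, P1 (P2 v) = P2 (P1 v)) -> (forall v, P1 (P3 v) = P3 (P1 v)) ->
  (forall v, P2 (P3 v) = P3 (P2 v)) ->
  k%:R *: v + P1 v + P2 v + P3 v = 0 ->
  [/\ k%:R *: v = 0, P1 v = 0, P2 v = 0 & P3 v = 0].
Proof.
move=> /linear_rules[d1 z1 n10] /linear_rules[d2 z2 n20] /linear_rules[d3 z3 n30].
move=> i1 i2 i3 c12 c13 c23 h.
have n1 (w : V) : k%:R *: w + w = k.+1%:R *: w.
  by rewrite -natr1 !scalerDl !scale1r.
have n2 (w : V) : k%:R *: w + w + w = k.+2%:R *: w.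
  by rewrite -[k.+2%:R]natr1 -natr1 !scalerDl !scale1r.
have n3 (w : V) : k%:R *: w + w + w + w = k.+3%:R *: w.
  by rewrite -[k.+3%:R]natr1 -[k.+2%:R]natr1 -natr1 !scalerDl !scale1r.
have a123 : P1 (P2 (P3 v)) = 0.
  have := congr1 (fun w => P1 (P2 (P3 w))) h; rewrite !(d1, d2, d3) !(z1, z2, z3) !(n10, n20, n30) /=.
  rewrite -c13 -c12 i1 -c23 i2 i3 n3. exact: natS_scale_eq0.
have a12 : P1 (P2 v) = 0.
  have := congr1 (fun w => P1 (P2 w)) h; rewrite !(d1, d2, d3) !(z1, z2, z3) !(n10, n20, n30) /=.
  by rewrite a123 addr0 -c12 i1 i2 n2; apply: natS_scale_eq0.
have a13 : P1 (P3 v) = 0.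
  have := congr1 (fun w => P1 (P3 w)) h; rewrite !(d1, d2, d3) !(z1, z2, z3) !(n10, n20, n30) /=.
  by rewrite -c23 a123 addr0 -c13 i1 i3 n2; apply: natS_scale_eq0.
have a23 : P2 (P3 v) = 0.
  have := congr1 (fun w => P2 (P3 w)) h; rewrite !(d1, d2, d3) !(z1, z2, z3) !(n10, n20, n30) /=.
  by rewrite -c13 -c12 a123 addr0 -c23 i2 i3 n2; apply: natS_scale_eq0.
have a1 : P1 v = 0.
  have := congr1 P1 h; rewrite !(d1, d2, d3) !(z1, z2, z3) !(n10, n20, n30) /=.
  by rewrite a12 a13 !addr0 i1 n1; apply: natS_scale_eq0.
have a2 : P2 v = 0.
  have := congr1 P2 h; rewrite !(d1, d2, d3) !(z1, z2, z3) !(n10, n20, n30) /=.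
  by rewrite -c12 a12 a23 !addr0 i2 n1; apply: natS_scale_eq0.
have a3 : P3 v = 0.
  have := congr1 P3 h; rewrite !(d1, d2, d3) !(z1, z2, z3) !(n10, n20, n30) /=.
  by rewrite -c13 -c23 a13 a23 !addr0 i3 n1; apply: natS_scale_eq0.
by split=> //; move: h; rewrite a1 a2 a3 !addr0.
Qed.

Variables (n N : nat).
Local Notation O := (fps F n).

Definition cmx m p (A : 'M[F]_(m, p)) : 'M[O]_(m, p) := map_mx (@fpsC F n) A.
Definition coefmx m p (a : 'X_{1..n}) (X : 'M[O]_(m, p)) : 'M[F]_(m, p) :=
  map_mx (fun f : O => f a : F) X.
Definition ordgem (k : nat) m p (X : 'M[O]_(m, p)) := forall i j, ordge k (X i j).
Definition eulermx m p (X : 'M[O]_(m, p)) : 'M[O]_(m, p) := map_mx (@euler F n) X.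

Lemma coefmxD m p a (X Y : 'M[O]_(m, p)) : coefmx a (X + Y) = coefmx a X + coefmx a Y.
Proof. by apply/matrixP => i j; rewrite !mxE fpsE. Qed.

Lemma coefmx_cmul m p q a (A : 'M[F]_(m, p)) (X : 'M[O]_(p, q)) :
  coefmx a (cmx A *m X) = A *m coefmx a X.
Proof.
apply/matrixP => i j; rewrite !mxE fps_sumE; apply: eq_bigr => k _.
by rewrite !mxE fpsC_mulE.
Qed.

Lemma coefmx_mulc m p q a (A : 'M[F]_(p, q)) (X : 'M[O]_(m, p)) :
  coefmx a (X *m cmx A) = coefmx a X *m A.
Proof.
apply/matrixP => i j; rewrite !mxE fps_sumE; apply: eq_bigr => k _.
by rewrite !mxE mulrC fpsC_mulE mulrC.
Qed.

Lemma coefmx_euler m p a (X : 'M[O]_(m, p)) :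
  coefmx a (eulermx X) = (mdeg a)%:R *: coefmx a X.
Proof. by apply/matrixP => i j; rewrite !mxE. Qed.

Lemma ordgem_coef k m p (X : 'M[O]_(m, p)) :
  ordgem k X <-> (forall a, (mdeg a < k)%N -> coefmx a X = 0).
Proof.
split=> [H a ak|H i j a ak]; first by apply/matrixP => i j; rewrite !mxE H.
by move/matrixP: (H a ak) => /(_ i j); rewrite !mxE.
Qed.

Lemma ordgemD k m p (X Y : 'M[O]_(m, p)) : ordgem k X -> ordgem k Y -> ordgem k (X + Y).
Proof. by move=> Xk Yk i j; rewrite mxE; apply: ordgeD. Qed.
Lemma ordgemN k m p (X : 'M[O]_(m, p)) : ordgem k X -> ordgem k (- X).
Proof. by move=> Xk i j; rewrite mxE; apply: ordgeN. Qed.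
Lemma ordgemM j k m p q (X : 'M[O]_(m, p)) (Y : 'M[O]_(p, q)) :
  ordgem j X -> ordgem k Y -> ordgem (j + k) (X *m Y).
Proof. by move=> Xj Yk i l; rewrite mxE; apply: ordge_sum => h _; apply: ordgeM. Qed.
Lemma ordgem_0 m p (X : 'M[O]_(m, p)) : ordgem 0 X. Proof. by []. Qed.

(** The uniqueness statements are formulated with a hypothesis that gains one degree,
    so that they apply to nonlinear and coupled equations alike: if X vanishes below
    degree k, its coefficients of degree k lie in the kernel of the operator of
    [proj_kernel]. *)
Variable Pc : 'M[F]_N.
Hypothesis Pc_idem : Pc *m Pc = Pc.

Lemma radial_unique2 (X : 'M[O]_N) :
  (forall k, ordgem k X ->
     ordgem k.+1 (eulermx X + cmx Pc *m X + X *m (cmx Pc)^T)) ->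
  coefmx 0%MM X = 0 -> X = 0.
Proof.
move=> H X0; suff Xk k : ordgem k X.
  by apply/matrixP => i j; rewrite mxE; apply: ordge_eq0 => k; apply: Xk.
elim: k => [|k IH]; first exact: ordgem_0.
apply/ordgem_coef => a; rewrite ltnS => ak.
case: (eqVneq a 0%MM) => [->//|]; rewrite -mdeg_eq0 -lt0n => a0.
have /ordgem_coef/(_ a ak) := H k IH; rewrite !coefmxD coefmx_euler coefmx_cmul.
have -> : (cmx Pc)^T = cmx Pc^T by rewrite /cmx map_trmx.
rewrite coefmx_mulc => E.
have := @proj_kernel 'M[F]_N (mulmx Pc) (mulmxr Pc^T) (fun=> 0) (mdeg a) (coefmx a X).
case => //=.
- exact: linearP.
- exact: (linearP (mulmxr Pc^T)).
- by move=> c u v; rewrite scaler0 addr0.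
- by move=> v; rewrite mulmxA Pc_idem.
- by move=> v; rewrite -mulmxA -trmx_mul Pc_idem.
- by move=> v; rewrite mulmxA.
- by move=> v; rewrite mulmx0.
- by move=> v; rewrite mul0mx.
- by rewrite addr0.
move=> Ek _ _ _; apply: (@natS_scale_eq0 _ (mdeg a).-1).
by rewrite prednK.
Qed.

Definition cube := 'I_N -> 'I_N -> 'I_N -> F^o.
HB.instance Definition _ := GRing.Lmodule.copy cube ('I_N -> 'I_N -> 'I_N -> F^o).

Definition act1 (M : 'M[F]_N) (X : cube) : cube := fun a b c => \sum_i M a i * X i b c.
Definition act2 (M : 'M[F]_N) (X : cube) : cube := fun a b c => \sum_i M b i * X a i c.
Definition act3 (M : 'M[F]_N) (X : cube) : cube := fun a b c => \sum_i M c i * X a b i.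

Lemma act1_linear M : linear (act1 M).
Proof.
move=> k X Y; apply/funext => a; apply/funext => b; apply/funext => c.
rewrite -[RHS]/(k * (\sum_i M a i * X i b c) + \sum_i M a i * Y i b c : F).
rewrite mulr_sumr -big_split.
by apply: eq_bigr => i _ /=; rewrite mulrDr; congr (_ + _); rewrite mulrCA.
Qed.
Lemma act2_linear M : linear (act2 M).
Proof.
move=> k X Y; apply/funext => a; apply/funext => b; apply/funext => c.
rewrite -[RHS]/(k * (\sum_i M b i * X a i c) + \sum_i M b i * Y a i c : F).
rewrite mulr_sumr -big_split.
by apply: eq_bigr => i _ /=; rewrite mulrDr; congr (_ + _); rewrite mulrCA.
Qed.
Lemma act3_linear M : linear (act3 M).
Proof.
move=> k X Y; apply/funext => a; apply/funext => b; apply/funext => c.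
rewrite -[RHS]/(k * (\sum_i M c i * X a b i) + \sum_i M c i * Y a b i : F).
rewrite mulr_sumr -big_split.
by apply: eq_bigr => i _ /=; rewrite mulrDr; congr (_ + _); rewrite mulrCA.
Qed.

Lemma sum_idem (i : 'I_N) (f : 'I_N -> F) :
  \sum_j Pc i j * (\sum_k Pc j k * f k) = \sum_k Pc i k * f k.
Proof.
rewrite -[in RHS]Pc_idem; under eq_bigr => j _ do rewrite mulr_sumr.
rewrite exchange_big; apply: eq_bigr => k _; rewrite mxE mulr_suml.
by apply: eq_bigr => j _; rewrite mulrA.
Qed.

Lemma sum_comm (a b : 'I_N) (h : 'I_N -> 'I_N -> F) :
  \sum_i Pc a i * (\sum_j Pc b j * h i j) = \sum_j Pc b j * (\sum_i Pc a i * h i j).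
Proof.
under eq_bigr => j _ do rewrite mulr_sumr.
rewrite exchange_big; apply: eq_bigr => j _; rewrite mulr_sumr.
by apply: eq_bigr => i _; rewrite mulrCA.
Qed.

(** In degree 0 the kernel of P_1 + P_2 + P_3 is not zero but consists of the tensors
    with all legs in the kernel of P; this is why that component of X(0) has to be
    known to vanish. *)
Lemma radial_unique3 (X : 'I_N -> 'I_N -> 'I_N -> O) :
  (forall k, (forall a b c, ordge k (X a b c)) -> forall a b c,
     ordge k.+1 (euler (X a b c) + \sum_i (fpsC (Pc a i) : O) * X i b c
       + \sum_i (fpsC (Pc b i) : O) * X a i c + \sum_i (fpsC (Pc c i) : O) * X a b i)) ->
  (forall a b c, \sum_i (1%:M - Pc) a i * \sum_j (1%:M - Pc) b j *
     \sum_k (1%:M - Pc) c k * X i j k 0%MM = 0) ->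
  forall a b c, X a b c = 0.
Proof.
move=> H X0; suff Xk k a b c : ordge k (X a b c).
  by move=> a b c; apply: ordge_eq0.
elim: k a b c => [//|k IH] a b c d; rewrite ltnS => dk.
pose Y : cube := fun a b c => X a b c d.
have E : (mdeg d)%:R *: Y + act1 Pc Y + act2 Pc Y + act3 Pc Y = 0.
  apply/funext => a'; apply/funext => b'; apply/funext => c'.
  have := H k IH a' b' c' d dk; rewrite !fpsE !fps_sumE => H0.
  by rewrite -[RHS]H0; congr (_ + _ + _ + _); apply: eq_bigr => i _; rewrite fpsC_mulE.
have idem (p : 'M[F]_N -> cube -> cube) (v : cube) :
    (p = @act1) \/ (p = @act2) \/ (p = @act3) -> p Pc (p Pc v) = p Pc v.
  by case=> [->|[->|->]]; apply/funext => ?; apply/funext => ?; apply/funext => ?;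
    apply: sum_idem.
have c12 v : act1 Pc (act2 Pc v) = act2 Pc (act1 Pc v).
  by apply/funext => ?; apply/funext => ?; apply/funext => ?; apply: sum_comm.
have c13 v : act1 Pc (act3 Pc v) = act3 Pc (act1 Pc v).
  by apply/funext => ?; apply/funext => ?; apply/funext => ?; apply: sum_comm.
have c23 v : act2 Pc (act3 Pc v) = act3 Pc (act2 Pc v).
  by apply/funext => ?; apply/funext => ?; apply/funext => ?; apply: sum_comm.
have i1 v : act1 Pc (act1 Pc v) = act1 Pc v by apply: idem; left.
have i2 v : act2 Pc (act2 Pc v) = act2 Pc v by apply: idem; right; left.
have i3 v : act3 Pc (act3 Pc v) = act3 Pc v by apply: idem; right; right.
have [E0 E1 E2 E3] := proj_kernel (act1_linear Pc) (act2_linear Pc) (act3_linear Pc)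
  i1 i2 i3 c12 c13 c23 E.
case: (posnP (mdeg d)) => [/eqP|d0]; last first.
  have : Y = 0 by apply: (@natS_scale_eq0 _ (mdeg d).-1); rewrite prednK.
  by move/(congr1 (fun Z : cube => Z a b c)).
rewrite mdeg_eq0 => /eqP d0.
have Q (M : 'M[F]_N) (i : 'I_N) (f : 'I_N -> F) : \sum_j M i j * f j = 0 ->
    \sum_j (1%:M - M) i j * f j = f i.
  move=> Mf; rewrite -[RHS]subr0 -[X in _ = _ - X]Mf -sumrN.
  rewrite (bigD1 i) //= [in RHS](bigD1 i) //= addrA !mxE eqxx mulrBl mul1r.
  congr (_ + _); apply: eq_bigr => j ji.
  by rewrite !mxE eq_sym (negPf ji) sub0r mulNr.
have Ef (Z : cube) : Z = 0 -> forall i j k, Z i j k = 0 by move=> ->.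
rewrite d0 -[RHS](X0 a b c).
rewrite [RHS](eq_bigr (fun i => (1%:M - Pc) a i * X i b c 0%MM)); last first.
  move=> i _; congr (_ * _).
  rewrite [LHS](eq_bigr (fun j => (1%:M - Pc) b j * X i j c 0%MM)); last first.
    by move=> j _; congr (_ * _); apply: Q; have := Ef _ E3 i j c; rewrite /act3 /Y d0.
  by apply: Q; have := Ef _ E2 i b c; rewrite /act2 /Y d0.
by symmetry; apply: (Q _ _ (fun i => X i b c 0%MM)); have := Ef _ E1 a b c; rewrite /act1 /Y d0.
Qed.

(** Iterates stabilise one degree at a time, and O is complete. *)
Lemma contraction_fixpoint (Phi : 'M[O]_N -> 'M[O]_N) :
  (forall k X Y, ordgem k (X - Y) -> ordgem k.+1 (Phi X - Phi Y)) ->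
  exists t, Phi t = t.
Proof.
move=> Pk; pose u k := iter k Phi 0.
have uk j k : ordgem k (u (k + j)%N - u k).
  elim: k => [|k IH]; first exact: ordgem_0.
  by rewrite addSn; apply: Pk.
(* The coefficients of degree d no longer change after d + 1 iterations. *)
pose t : 'M[O]_N := \matrix_(i, j) ((fun a => u (mdeg a).+1 i j a) : O).
have tk k : ordgem k (t - u k).
  move=> i j a ak; rewrite !mxE !fpsE.
  by have := uk (k - (mdeg a).+1)%N (mdeg a).+1 i j a (ltnSn _); rewrite subnKC // !mxE !fpsE
    => /eqP; rewrite subr_eq0 => /eqP ->; rewrite subrr.
exists t; apply/eqP; rewrite -subr_eq0; apply/eqP/matrixP => i j.
rewrite [RHS]mxE; apply: ordge_eq0 => k; suff : ordgem k (Phi t - t) by apply.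
apply/ordgem_coef => a ak.
have /ordgem_coef/(_ a) H : ordgem k.+1 (Phi t - t).
  rewrite -[Phi t](subrK (Phi (u k))) -addrA; apply: ordgemD; first exact: Pk.
  by rewrite -opprB; apply/ordgemN/(tk k.+1).
by apply: H; apply: ltnW.
Qed.
End RadialUniqueness.

(** * Matrix identities *)

(** Identities used for the radial equation. They are stated over an arbitrary ring,
    with the images of the matrices under a derivation (CX, DX) as free variables,
    because normalisation is faster there than over the ring of power series. *)
Section MatrixIdentities.
Variables (R : comNzRingType) (N : nat).
Implicit Types (A X Y L P D : 'M[R]_N).

Let addE X Y i j : (X + Y) i j = X i j + Y i j. Proof. by rewrite mxE. Qed.
Let oppE X i j : (- X) i j = - X i j. Proof. by rewrite mxE. Qed.

Local Ltac mx_abel :=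
  let i := fresh in let j := fresh in
  apply/matrixP => i j; rewrite !(addE, oppE); ring.

Lemma action_product_mx A X Y L CX CY :
  A *m (X *m L *m Y) + X *m L *m Y *m A^T
    + ((CX *m L + X *m (A^T *m L + L *m A)) *m Y + X *m L *m CY)
  = (A *m X + X *m A^T + CX) *m L *m Y + X *m L *m (A *m Y + Y *m A^T + CY).
Proof. rewrite !(mulmxDl, mulmxDr) !mulmxA; mx_abel. Qed.

Lemma action_radial_mx A X P D CX DX : A *m P = P *m A ->
  (A *m D + D *m A^T + DX) + P *m (A *m X + X *m A^T + CX)
    + (A *m X + X *m A^T + CX) *m P^T
  = (A *m D + D *m A^T + DX) + (A *m (P *m X) + P *m X *m A^T + P *m CX)
    + (A *m (X *m P^T) + X *m P^T *m A^T + CX *m P^T).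
Proof.
move=> AP; have APT : A^T *m P^T = P^T *m A^T by rewrite -!trmx_mul AP.
rewrite !(mulmxDl, mulmxDr) !mulmxA AP -!(mulmxA X) APT; mx_abel.
Qed.

Lemma radial_symm_mx X L P D DT Z : L^T = - L -> Z^T = - Z ->
  D + P *m X + X *m P^T = X *m L *m X + Z ->
  DT + P *m X^T + X^T *m P^T = (X *m L *m X + Z)^T ->
  (D + DT) + P *m (X + X^T) + (X + X^T) *m P^T
  = (X + X^T) *m (L *m X) + - (X^T *m L) *m (X + X^T).
Proof.
move=> LT ZT E ET.
transitivity ((D + P *m X + X *m P^T) + (DT + P *m X^T + X^T *m P^T)).
  by rewrite !(mulmxDl, mulmxDr); mx_abel.
rewrite E ET linearD /= !trmx_mul LT ZT !(mulmxDl, mulmxDr, mulmxN, mulNmx) !mulmxA.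
mx_abel.
Qed.

Lemma radial_tr_mx D P X : (D + P *m X + X *m P^T)^T = D^T + P *m X^T + X^T *m P^T.
Proof. by rewrite !linearD /= !trmx_mul trmxK addrAC. Qed.

Lemma radial_sub_mx P X Y D D' :
  D + P *m X + X *m P^T - (D' + P *m Y + Y *m P^T)
  = (D - D') + P *m (X - Y) + (X - Y) *m P^T.
Proof. rewrite !(mulmxDl, mulmxDr, mulmxN, mulNmx); mx_abel. Qed.

Lemma action_add_mx A X Y CX CY :
  A *m (X + Y) + (X + Y) *m A^T + (CX + CY)
  = (A *m X + X *m A^T + CX) + (A *m Y + Y *m A^T + CY).
Proof. rewrite !(mulmxDl, mulmxDr); mx_abel. Qed.

Lemma sandwich_diff_mx X Y L Z :
  (X - Y) *m (L *m X) + Y *m L *m (X - Y) = X *m L *m X + Z - (Y *m L *m Y + Z).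
Proof. rewrite !(mulmxDl, mulmxDr, mulmxN, mulNmx) !mulmxA; mx_abel. Qed.

Lemma sandwich_sum_mx X Y L : X *m L *m Y = 0 -> Y *m L *m X = 0 ->
  (X + Y) *m L *m (X + Y) = X *m L *m X + Y *m L *m Y.
Proof. by move=> E1 E2; rewrite !(mulmxDl, mulmxDr) E1 E2 !addr0 add0r. Qed.
End MatrixIdentities.

(** * A Lie algebra in coordinates *)
Section LieCoordinates.
Variables (F : numFieldType) (g : finLieType F) (n : nat).
Local Notation O := (fps F n).
Local Notation N := (\dim {:g}).
Local Notation e := (vbasis {:g}).
Implicit Types (u v w y z : g).

Lemma lieDl u v w : lie (u + v) w = lie u w + lie v w.
Proof. by have [h _ _] := linear_rules (lie_linearl w); rewrite h. Qed.
Lemma lieDr u v w : lie w (u + v) = lie w u + lie w v.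
Proof. by have [h _ _] := linear_rules (lie_linearr w); rewrite h. Qed.
Lemma lieZl c u w : lie (c *: u) w = c *: lie u w.
Proof. by have [_ h _] := linear_rules (lie_linearl w); rewrite h. Qed.
Lemma lieZr c u w : lie w (c *: u) = c *: lie w u.
Proof. by have [_ h _] := linear_rules (lie_linearr w); rewrite h. Qed.
Lemma lie0l w : lie 0 w = 0 :> g.
Proof. by have [_ _] := linear_rules (lie_linearl w). Qed.
Lemma lie0r w : lie w 0 = 0 :> g.
Proof. by have [_ _] := linear_rules (lie_linearr w). Qed.

Lemma lieC u v : lie u v = - lie v u.
Proof.
have := liexx (u + v); rewrite lieDl !lieDr !liexx add0r addr0.
by move/eqP; rewrite addr_eq0 => /eqP.
Qed.

Lemma lie_derivation y u v : lie y (lie u v) = lie (lie y u) v + lie u (lie y v).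
Proof.
have /eqP := lie_jacobi y u v; rewrite (lieC v (lie _ _)) (lieC v y).
have -> : lie u (- lie y v) = - lie u (lie y v) by rewrite -scaleN1r lieZr scaleN1r.
by rewrite -addrA -opprD subr_eq0 addrC => /eqP.
Qed.

Lemma lie_suml I (r : seq I) (G : I -> g) w :
  lie (\sum_(i <- r) G i) w = \sum_(i <- r) lie (G i) w.
Proof. by elim: r => [|i r IH]; rewrite ?big_nil ?lie0l // !big_cons lieDl IH. Qed.
Lemma lie_sumr I (r : seq I) (G : I -> g) w :
  lie w (\sum_(i <- r) G i) = \sum_(i <- r) lie w (G i).
Proof. by elim: r => [|i r IH]; rewrite ?big_nil ?lie0r // !big_cons lieDr IH. Qed.

Definition vec v : 'cV[F]_N := \col_a coord e a v.
Definition ovec v : 'cV[O]_N := cmx n (vec v).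

Lemma vbasis_sum v : v = \sum_a coord e a v *: e`_a.
Proof. exact: coord_vbasis (memvf v). Qed.

Lemma coord_e (a b : 'I_N) : coord e a e`_b = (a == b)%:R.
Proof. by rewrite (coord_free _ _ (basis_free (vbasisP _))) eq_sym. Qed.

Lemma cmx_is_linear m p c (A A' : 'M[F]_(m, p)) :
  cmx n (c *: A + A') = (fpsC c : O) *: cmx n A + cmx n A'.
Proof. by apply/matrixP => i j; rewrite !mxE rmorphD rmorphM. Qed.

Lemma vecP c u v : vec (c *: u + v) = c *: vec u + vec v.
Proof. by apply/matrixP => i j; rewrite !mxE linearP. Qed.

Lemma cmx0 m p : cmx n (0 : 'M[F]_(m, p)) = 0.
Proof. by apply/matrixP => i j; rewrite !mxE rmorph0. Qed.

Lemma ovecP c u v : ovec (c *: u + v) = (fpsC c : O) *: ovec u + ovec v.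
Proof. by rewrite /ovec vecP cmx_is_linear. Qed.

Lemma ovec0 : ovec 0 = 0.
Proof. by apply/matrixP => i j; rewrite !mxE linear0 rmorph0. Qed.
Lemma ovecD u v : ovec (u + v) = ovec u + ovec v.
Proof. by rewrite -[u in LHS]scale1r ovecP rmorph1 scale1r. Qed.
Lemma ovecZ c u : ovec (c *: u) = (fpsC c : O) *: ovec u.
Proof. by rewrite -[_ *: u in LHS]addr0 ovecP ovec0 addr0. Qed.
Lemma ovecN u : ovec (- u) = - ovec u.
Proof. by rewrite -scaleN1r ovecZ rmorphN1 scaleN1r. Qed.

Lemma ovec_sum I (r : seq I) (G : I -> g) :
  ovec (\sum_(i <- r) G i) = \sum_(i <- r) ovec (G i).
Proof. by elim: r => [|i r IH]; rewrite ?big_nil ?ovec0 // !big_cons ovecD IH. Qed.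

Lemma ovec_e (a : 'I_N) : ovec e`_a = unitc O a.
Proof. by apply/matrixP => i j; rewrite ord1 !mxE coord_e eqxx andbT rmorph_nat. Qed.

Lemma ovecE v a : ovec v a 0 = fpsC (coord e a v).
Proof. by rewrite !mxE. Qed.

Definition strc (i j : 'I_N) : 'cV[O]_N := ovec (lie e`_i e`_j).
Local Notation B := (brk strc).

Lemma brk_ovec u v : B (ovec u) (ovec v) = ovec (lie u v).
Proof.
rewrite {2}(vbasis_sum u) lie_suml ovec_sum {1}(vbasis_sum u) ovec_sum brk_suml.
apply: eq_bigr => i _; rewrite lieZl !ovecZ brkZl; congr (_ *: _).
rewrite {2}(vbasis_sum v) lie_sumr ovec_sum {1}(vbasis_sum v) ovec_sum brk_sumr.
apply: eq_bigr => j _; rewrite lieZr !ovecZ brkZr; congr (_ *: _).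
by rewrite !ovec_e brk_unitc.
Qed.

Lemma strc_anti i j : strc i j = - strc j i.
Proof. by rewrite /strc lieC ovecN. Qed.

Lemma brk_strc_anti (u v : 'cV[O]_N) : B u v = - B v u.
Proof. exact: brk_anti strc_anti u v. Qed.

Lemma brk_strc_jacobi (u v w : 'cV[O]_N) : jac strc u v w = 0.
Proof.
apply: brk_jacobi => i j k; rewrite /jac -!ovec_e !brk_ovec.
by rewrite -!ovecD lie_jacobi ovec0.
Qed.

Definition adm (v : 'cV[O]_N) : 'M[O]_N := \matrix_(a, i) B v (unitc O i) a 0.

Lemma adm_mul (v w : 'cV[O]_N) : adm v *m w = B v w.
Proof.
rewrite [in RHS](unitc_sum w) brk_sumr; apply/matrixP => a z; rewrite ord1 !mxE summxE.
by apply: eq_bigr => i _; rewrite !mxE brkZr mxE mulrC.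
Qed.

Definition admc y : 'M[F]_N := \matrix_(a, i) coord e a (lie y e`_i).
Lemma adm_ovec y : adm (ovec y) = cmx n (admc y).
Proof. by apply/matrixP => a i; rewrite !mxE -ovec_e brk_ovec ovecE. Qed.

Lemma admc_mul y v : admc y *m vec v = vec (lie y v).
Proof.
rewrite {2}(vbasis_sum v) lie_sumr; apply/matrixP => a z; rewrite !mxE linear_sum.
by apply: eq_bigr => i _; rewrite !mxE lieZr linearZ /= mulrC.
Qed.

Lemma derivation_strc (d : O -> O) : (forall c, d (fpsC c) = 0) ->
  forall i j, map_mx d (strc i j) = 0.
Proof. by move=> dc i j; apply/matrixP => a z; rewrite !mxE dc. Qed.

End LieCoordinates.

(** * Tensors in coordinates *)
Section TensorCoordinates.
Variables (F : numFieldType) (g : finLieType F).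
Local Notation N := (\dim {:g}).
Local Notation e := (vbasis {:g}).
Local Notation T2 := (tensor g g).
Local Notation T3 := (tensor g (tensor g g)).
Implicit Types (u v w y : g) (t : T2).

Lemma sum_tensE I (r : seq I) (Q : pred I) (G : I -> T2) p q :
  (\sum_(i <- r | Q i) G i) p q = \sum_(i <- r | Q i) G i p q.
Proof. by elim/big_rec2: _ => [|i y1 y2 _ <-]; rewrite mxE. Qed.

Lemma tensE u v p q : tens u v p q = coord e p u * coord e q v.
Proof. by rewrite mxE. Qed.

Lemma tlift2E (B : g -> g -> T2) t p q :
  tlift B t p q = \sum_i \sum_j t i j * B e`_i e`_j p q.
Proof.
rewrite /tlift sum_tensE; apply: eq_bigr => i _; rewrite sum_tensE.
by apply: eq_bigr => j _; rewrite mxE.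
Qed.

Lemma sum_delta (f : 'I_N -> F) p : \sum_i f i * (p == i)%:R = f p.
Proof.
rewrite (bigD1 p) //= eqxx mulr1 big1 ?addr0 // => i ip.
by rewrite eq_sym (negPf ip) mulr0.
Qed.

Lemma flipE t : flip t = t^T :> 'M[F]_N.
Proof.
apply/matrixP => p q; rewrite mxE /flip tlift2E.
rewrite (eq_bigr (fun i => t i p * (q == i)%:R)); first exact: sum_delta.
move=> i _; rewrite (eq_bigr (fun j => (t i j * (q == i)%:R) * (p == j)%:R)).
  exact: sum_delta.
by move=> j _; rewrite tensE !coord_e; ring.
Qed.

Lemma ad2E y t : ad2 y t = admc y *m t + t *m (admc y)^T :> 'M[F]_N.
Proof.
apply/matrixP => p q; rewrite /ad2 tlift2E 3!mxE.
rewrite (eq_bigr (fun i => admc y p i * t i q + (\sum_j t i j * admc y q j) * (p == i)%:R)).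
  rewrite big_split sum_delta; congr (_ + _); apply: eq_bigr => j _.
  by rewrite [(admc y)^T _ _]mxE.
move=> i _; rewrite (eq_bigr (fun j => admc y p i * t i j * (q == j)%:R +
   t i j * admc y q j * (p == i)%:R)).
  by rewrite big_split sum_delta mulr_suml.
by move=> j _; rewrite mxE !tensE !coord_e ![admc y _ _]mxE; ring.
Qed.

Lemma tens_vec u v : tens u v = vec u *m (vec v)^T :> 'M[F]_N.
Proof. by apply/matrixP => p q; rewrite !mxE big_ord1 !mxE. Qed.

Lemma span_ind (V : vectType F) (S : seq V) (Q : V -> Prop) :
  Q 0 -> (forall c (u v : V), Q u -> Q v -> Q (c *: u + v)) ->
  (forall u : V, u \in S -> Q u) -> forall v : V, v \in <<S>>%VS -> Q v.
Proof.
move=> Q0 QP QS v vS; rewrite (@coord_span _ _ _ (in_tuple S) v vS).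
elim/big_ind: _ => // [u w Qu Qw|i _]; first by rewrite -[u]scale1r; apply: QP.
rewrite -[_ *: _]addr0; apply: QP => //; apply: QS; exact: mem_nth.
Qed.

Lemma tensv_ind (U V : {vspace g}) (Q : T2 -> Prop) :
  Q 0 -> (forall c (t t' : T2), Q t -> Q t' -> Q (c *: t + t')) ->
  (forall u v, u \in U -> v \in V -> Q (tens u v)) -> forall t, t \in tensv U V -> Q t.
Proof.
move=> Q0 QP QS; apply: span_ind => // t /allpairsP[[u v] /= [uU vV ->]].
by apply: QS; apply: vbasis_mem.
Qed.

(** A triple tensor is stored as a matrix over bases of g and of g (x) g, the latter
    not being the basis of products e_i (x) e_j. Slicing along the first leg gives
    access to the coordinates on products. *)
Definition slice (a : 'I_N) (t : T3) : T2 := \sum_j t a j *: (vbasis {:T2})`_j.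

Lemma slice_linear a : linear (slice a).
Proof.
move=> c s t; rewrite /slice scaler_sumr -big_split; apply: eq_bigr => j _ /=.
by rewrite !mxE scalerDl scalerA.
Qed.
HB.instance Definition _ a := GRing.isLinear.Build F T3 T2 *:%R (slice a) (slice_linear a).

Lemma slice_tens a u (w : T2) : slice a (tens u w) = coord e a u *: w.
Proof.
rewrite /slice {2}(coord_vbasis (memvf w)) scaler_sumr; apply: eq_bigr => j _.
by rewrite mxE scalerA.
Qed.

Lemma slice_inj (t : T3) : (forall a, slice a t = 0) -> t = 0.
Proof.
move=> H; apply/matrixP => a j; rewrite [RHS]mxE.
have /freeP/(_ (fun j => t a j) (H a) j) := basis_free (vbasisP {:T2}).
by [].
Qed.

Definition ev (a b c : 'I_N) (t : T3) : F := slice a t b c.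

Lemma evD a b c (s t : T3) : ev a b c (s + t) = ev a b c s + ev a b c t.
Proof. by rewrite /ev linearD mxE. Qed.
Lemma evN a b c (t : T3) : ev a b c (- t) = - ev a b c t.
Proof. by rewrite /ev linearN mxE. Qed.
Lemma evZ a b c k (t : T3) : ev a b c (k *: t) = k * ev a b c t.
Proof. by rewrite /ev linearZ mxE. Qed.
Lemma ev0 a b c : ev a b c 0 = 0.
Proof. by rewrite /ev linear0 mxE. Qed.
Lemma ev_sum a b c I (r : seq I) (P : pred I) (G : I -> T3) :
  ev a b c (\sum_(i <- r | P i) G i) = \sum_(i <- r | P i) ev a b c (G i).
Proof.
elim/big_rec2: _ => [|i y1 y2 _ <-]; first exact: ev0.
exact: evD.
Qed.

Lemma ev_tens a b c u (w : T2) : ev a b c (tens u w) = coord e a u * w b c.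
Proof. by rewrite /ev slice_tens mxE. Qed.

Lemma ev_inj (t : T3) : (forall a b c, ev a b c t = 0) -> t = 0.
Proof.
by move=> H; apply: slice_inj => a; apply/matrixP => b c; rewrite [RHS]mxE; apply: H.
Qed.

Lemma tlift3E (W : lmodType F) (G : g -> g -> g -> W) (t : T3) :
  tlift (fun a (w : T2) => tlift (G a) w) t =
  \sum_i \sum_k \sum_p ev i k p t *: G e`_i e`_k e`_p.
Proof.
rewrite /tlift; apply: eq_bigr => i _.
under eq_bigr => j _ do rewrite scaler_sumr.
rewrite exchange_big; apply: eq_bigr => k _ /=.
under eq_bigr => j _ do rewrite scaler_sumr.
rewrite exchange_big; apply: eq_bigr => p _ /=.
rewrite /ev /slice sum_tensE scaler_suml; apply: eq_bigr => j _.
by rewrite mxE scalerA.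
Qed.

Lemma sum_delta3 (h : 'I_N -> 'I_N -> 'I_N -> F) a b c :
  \sum_i \sum_k \sum_p h i k p * ((a == i)%:R * ((b == k)%:R * (c == p)%:R)) = h a b c.
Proof.
transitivity (\sum_i h i b c * (a == i)%:R); last exact: sum_delta.
apply: eq_bigr => i _.
transitivity (\sum_k (h i k c * (a == i)%:R) * (b == k)%:R); last exact: sum_delta.
apply: eq_bigr => k _.
transitivity (\sum_p (h i k p * (a == i)%:R * (b == k)%:R) * (c == p)%:R).
  by apply: eq_bigr => p _; rewrite !mulrA.
by rewrite sum_delta mulrAC.
Qed.

Lemma ev_perm213 a b c (t : T3) : ev a b c (perm213 t) = ev b a c t.
Proof.
rewrite /perm213 tlift3E ev_sum -[RHS](sum_delta3 (fun i k p => ev i k p t)).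
apply: eq_bigr => i _; rewrite ev_sum; apply: eq_bigr => k _; rewrite ev_sum.
by apply: eq_bigr => p _; rewrite evZ ev_tens tensE !coord_e; ring.
Qed.

Lemma ev_perm312 a b c (t : T3) : ev a b c (perm312 t) = ev c a b t.
Proof.
rewrite /perm312 tlift3E ev_sum -[RHS](sum_delta3 (fun i k p => ev i k p t)).
apply: eq_bigr => i _; rewrite ev_sum; apply: eq_bigr => k _; rewrite ev_sum.
by apply: eq_bigr => p _; rewrite evZ ev_tens tensE !coord_e; ring.
Qed.

Lemma ev_Alt a b c (t : T3) : ev a b c (Alt t) = ev a b c t - ev b a c t + ev c a b t.
Proof. by rewrite /Alt !evD evN ev_perm213 ev_perm312. Qed.

Lemma ev_tlift2 (G : g -> g -> T3) t a b c :
  ev a b c (tlift G t) = \sum_i \sum_j t i j * ev a b c (G e`_i e`_j).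
Proof.
rewrite /tlift ev_sum; apply: eq_bigr => i _; rewrite ev_sum; apply: eq_bigr => j _.
exact: evZ.
Qed.

Definition cst3 (i k a : 'I_N) : F := coord e a (lie e`_i e`_k).

Lemma sum_delta2 (h : 'I_N -> 'I_N -> F) b c :
  \sum_j \sum_p h j p * ((b == j)%:R * (c == p)%:R) = h b c.
Proof.
transitivity (\sum_j h j c * (b == j)%:R); last exact: sum_delta.
apply: eq_bigr => j _.
transitivity (\sum_p (h j p * (b == j)%:R) * (c == p)%:R); last exact: sum_delta.
by apply: eq_bigr => p _; rewrite mulrA.
Qed.

Lemma ev_lie12_13 r s a b c : ev a b c (lie12_13 r s) =
  \sum_i \sum_k r i b * s k c * cst3 i k a.
Proof.
rewrite /lie12_13 ev_tlift2; apply: eq_bigr => i _.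
under eq_bigr => j _ do rewrite ev_tlift2 mulr_sumr.
rewrite exchange_big; apply: eq_bigr => k _ /=.
rewrite -[RHS](sum_delta2 (fun j p => r i j * s k p * cst3 i k a)).
apply: eq_bigr => j _; rewrite mulr_sumr; apply: eq_bigr => p _.
by rewrite ev_tens tensE !coord_e -/(cst3 i k a); ring.
Qed.

Lemma ev_lie12_23 r s a b c : ev a b c (lie12_23 r s) =
  \sum_j \sum_k r a j * s k c * cst3 j k b.
Proof.
rewrite /lie12_23 ev_tlift2 exchange_big; apply: eq_bigr => j _ /=.
under eq_bigr => i _ do rewrite ev_tlift2 mulr_sumr.
rewrite exchange_big; apply: eq_bigr => k _ /=.
rewrite -[RHS](sum_delta2 (fun i p => r i j * s k p * cst3 j k b)).
apply: eq_bigr => i _; rewrite mulr_sumr; apply: eq_bigr => p _.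
by rewrite ev_tens tensE !coord_e -/(cst3 j k b); ring.
Qed.

Lemma ev_lie13_23 r s a b c : ev a b c (lie13_23 r s) =
  \sum_j \sum_p r a j * s b p * cst3 j p c.
Proof.
rewrite /lie13_23 ev_tlift2 exchange_big; apply: eq_bigr => j _ /=.
under eq_bigr => i _.
  rewrite ev_tlift2 exchange_big mulr_sumr; over.
rewrite exchange_big; apply: eq_bigr => p _ /=.
rewrite -[RHS](sum_delta2 (fun i k => r i j * s k p * cst3 j p c)).
apply: eq_bigr => i _; rewrite mulr_sumr; apply: eq_bigr => k _.
by rewrite ev_tens tensE !coord_e -/(cst3 j p c); ring.
Qed.

End TensorCoordinates.

(** * The splitting of g and the derivations it defines *)
Definition reductive_splitting (F : numFieldType) (g : finLieType F)
    (l m : {vspace g}) (n : nat) (x : n.-tuple g) :=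
  [/\ forall y z, y \in l -> z \in l -> lie y z \in l, (l + m)%VS = fullv,
      (l :&: m)%VS = 0%VS, forall y z, y \in l -> z \in m -> lie y z \in m
    & basis_of l x].

Section Splitting.
Variables (F : numFieldType) (g : finLieType F) (l m : {vspace g}) (n : nat) (x : n.-tuple g).
Local Notation O := (fps F n).
Local Notation N := (\dim {:g}).
Local Notation e := (vbasis {:g}).
Hypothesis sp : reductive_splitting l m x.

Let l_subalg y z : y \in l -> z \in l -> lie y z \in l.
Proof. by case: sp => h _ _ _ _; apply: h. Qed.
Let lm_full : (l + m)%VS = fullv.
Proof. by case: sp. Qed.
Let lm_direct : (l :&: m)%VS = 0%VS.
Proof. by case: sp. Qed.
Let m_invariant y z : y \in l -> z \in m -> lie y z \in m.
Proof. by case: sp => _ _ _ h _; apply: h. Qed.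
Let x_basis : basis_of l x.
Proof. by case: sp. Qed.

Implicit Types (u v w y z : g).
Local Notation B := (brk (@strc F g n)).
Local Notation T2 := (tensor g g).
Local Notation T3 := (tensor g (tensor g g)).
Local Notation quarter := (fpsC (4^-1 : F) : O).

Definition pil v : g := daddv_pi l m v.

Lemma pilP v : pil v \in l. Proof. exact: memv_pi. Qed.
Lemma pilD u v : pil (u + v) = pil u + pil v. Proof. exact: linearD. Qed.
Lemma pilZ c v : pil (c *: v) = c *: pil v. Proof. exact: linearZ. Qed.
Lemma pil_id v : v \in l -> pil v = v.
Proof. exact: daddv_pi_id. Qed.
Lemma pil_compl v : v - pil v \in m.
Proof.
have vlm : v \in (l + m)%VS by rewrite lm_full memvf.
have := daddv_pi_add lm_direct vlm; rewrite -/(pil v) => {1}<-.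
by rewrite addrC addKr memv_pi.
Qed.
Lemma pil_m v : v \in m -> pil v = 0.
Proof.
move=> vm; apply/eqP; rewrite -memv0 -lm_direct memv_cap pilP /=.
by rewrite -[pil v](subKr v) rpredB // pil_compl.
Qed.
Lemma pil_sum I (r : seq I) (G : I -> g) :
  pil (\sum_(i <- r) G i) = \sum_(i <- r) pil (G i).
Proof. exact: linear_sum. Qed.

Lemma pil_lie y v : y \in l -> pil (lie y v) = lie y (pil v).
Proof.
move=> yl; rewrite -{1}[v](subrK (pil v)) lieDr pilD.
have h1 := m_invariant yl (pil_compl v); have h2 := l_subalg yl (pilP v).
by rewrite (pil_m h1) add0r (pil_id h2).
Qed.

Definition Pc : 'M[F]_N := \matrix_(a, b) coord e a (pil e`_b).
Local Notation P := (cmx n Pc).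
Local Notation Q := (1%:M - Pc).

Lemma Pc_vec v : Pc *m vec v = vec (pil v).
Proof.
rewrite {2}(vbasis_sum v) pil_sum; apply/matrixP => a z; rewrite !mxE linear_sum.
by apply: eq_bigr => i _; rewrite !mxE pilZ linearZ /= mulrC.
Qed.

Lemma cmxM p q r (A : 'M[F]_(p, q)) (A' : 'M[F]_(q, r)) : cmx n (A *m A') = cmx n A *m cmx n A'.
Proof. exact: map_mxM. Qed.

Lemma P_ovec v : P *m ovec n v = ovec n (pil v).
Proof. by rewrite /ovec -cmxM Pc_vec. Qed.

Lemma vec_inj (A A' : 'M[F]_N) : (forall v, A *m vec v = A' *m vec v) -> A = A'.
Proof.
move=> H; apply/matrixP => i j; have /matrixP/(_ i 0) := H e`_j.
rewrite !mxE (bigD1 j) //= [in X in _ = X](bigD1 j) //= !mxE !coord_e eqxx !mulr1.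
by rewrite !big1 ?addr0 // => k kj; rewrite !mxE coord_e (negPf kj) mulr0.
Qed.

Lemma Pc_idem : Pc *m Pc = Pc.
Proof. by apply: vec_inj => v; rewrite -mulmxA !Pc_vec pil_id ?pilP. Qed.

Lemma admc_Pc y : y \in l -> admc y *m Pc = Pc *m admc y.
Proof.
move=> yl; apply: vec_inj => v; rewrite -!mulmxA Pc_vec !admc_mul Pc_vec.
by rewrite pil_lie.
Qed.

Lemma x_in i : x`_i \in l.
Proof.
case: (ltnP i (size x)) => h; last by rewrite nth_default // mem0v.
by apply: (basis_mem x_basis); rewrite mem_nth.
Qed.

(** The linear function lambda(v) on the dual of l, extended by zero to m: x_k is the
    k-th coordinate function. *)
Definition lamf v : O := \sum_(k < n) (fpsC (coord x k (pil v)) : O) * coordf F k.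
Definition lam (b : 'I_N) : O := lamf e`_b.
Local Notation ll := (pair_lam lam).

Lemma lamfP c u v : lamf (c *: u + v) = fpsC c * lamf u + lamf v.
Proof.
rewrite /lamf mulr_sumr -big_split; apply: eq_bigr => k _ /=.
by rewrite pilD pilZ linearP /= rmorphD rmorphM; ring.
Qed.

Lemma lamf0 : lamf 0 = 0.
Proof.
by rewrite /lamf big1 // => k _; rewrite /pil !linear0 rmorph0 mul0r.
Qed.

Lemma ll_ovec v : ll (ovec n v) = lamf v.
Proof.
have D u w : lamf (u + w) = lamf u + lamf w.
  by rewrite -[u in LHS]scale1r lamfP rmorph1 mul1r.
have Z c u : lamf (c *: u) = fpsC c * lamf u.
  by rewrite -[_ *: u in LHS]addr0 lamfP lamf0 addr0.
have S I (r : seq I) (G : I -> g) : lamf (\sum_(i <- r) G i) = \sum_(i <- r) lamf (G i).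
  by elim: r => [|i r IH]; rewrite ?big_nil ?lamf0 // !big_cons D IH.
rewrite [in RHS](vbasis_sum v) S; apply: eq_bigr => i _.
by rewrite ovecE Z /lam mulrC.
Qed.

Lemma lamf_pil v : lamf (pil v) = lamf v.
Proof. by rewrite /lamf; apply: eq_bigr => k _; rewrite (pil_id (pilP v)). Qed.

Lemma lamf_m v : v \in m -> lamf v = 0.
Proof. by move=> vm; rewrite -lamf_pil pil_m // lamf0. Qed.

Lemma lam_row : (\row_i lam i) *m P = \row_i lam i.
Proof.
apply/matrixP => z b; rewrite !mxE.
transitivity (ll (P *m ovec n e`_b)).
  rewrite ovec_e /pair_lam; apply: eq_bigr => k _; rewrite !mxE; congr (_ * _).
  rewrite (bigD1 b) //= !mxE !eqxx mulr1 big1 ?addr0 // => i ib.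
  by rewrite !mxE (negPf ib) mulr0.
by rewrite P_ovec ll_ovec lamf_pil.
Qed.

(** The component e_a of the leg in l of dr: the leg sum_k x_k (x) d/dx_k expanded in
    the basis of g. *)
Definition dl (a : 'I_N) (f : O) : O :=
  \sum_(k < n) (fpsC (coord e a x`_k) : O) * pder k f.

Lemma pder_derivation k : derivation (@pder F n k).
Proof. by split; [exact: raddfB|exact: pderM]. Qed.

Lemma euler_derivation : derivation (@euler F n).
Proof. by split; [exact: raddfB|exact: eulerM]. Qed.

Lemma derivation_comb (c : 'I_n -> O) (d : 'I_n -> O -> O) :
  (forall k, derivation (d k)) -> derivation (fun f => \sum_(k < n) c k * d k f).
Proof.
move=> dd; split=> f h.
  by rewrite -sumrB; apply: eq_bigr => k _; rewrite (dd k).1 mulrBr.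
rewrite mulr_suml mulr_sumr -big_split; apply: eq_bigr => k _ /=.
by rewrite (dd k).2; ring.
Qed.

Lemma dl_derivation a : derivation (dl a).
Proof. by apply: derivation_comb => k; apply: pder_derivation. Qed.

Lemma dl_const a c : dl a (fpsC c) = 0.
Proof. by rewrite /dl big1 // => k _; rewrite pder_fpsC mulr0. Qed.

Lemma euler_dl a f : euler (dl a f) = dl a (euler f) - dl a f.
Proof.
rewrite /dl (derivation_sum euler_derivation) -sumrB; apply: eq_bigr => k _.
by rewrite eulerM euler_fpsC mul0r add0r euler_der mulrBr.
Qed.

Lemma coord_e_mem v a : v \in l -> coord e a v = \sum_(k < n) coord x k v * coord e a x`_k.
Proof.
move=> vl; rewrite {1}(coord_basis x_basis vl) linear_sum.
by apply: eq_bigr => k _; rewrite linearZ.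
Qed.

Lemma dl_lam a i : dl a (lam i) = fpsC (Pc a i).
Proof.
rewrite mxE coord_e_mem ?pilP // rmorph_sum /dl /lam /lamf; apply: eq_bigr => k _.
rewrite rmorphM mulrC (derivation_sum (pder_derivation k)) (bigD1 k) //=; congr (_ * _).
rewrite pderM pder_fpsC mul0r add0r pder_coordf eqxx mulr1 big1 ?addr0 // => j jk.
by rewrite pderM pder_fpsC mul0r add0r pder_coordf eq_sym (negPf jk) mulr0.
Qed.

Lemma euler_lamf v : euler (lamf v) = lamf v.
Proof.
rewrite /lamf (derivation_sum euler_derivation); apply: eq_bigr => k _.
by rewrite eulerM euler_fpsC mul0r add0r euler_coordf.
Qed.

Lemma ordge_lamf v : ordge 1 (lamf v).
Proof. by apply: ordge_sum => k _; apply/ordgeMl/ordge_coordf. Qed.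

Lemma Pc_x a k : \sum_i Pc a i * coord e i x`_k = coord e a x`_k.
Proof.
have /matrixP/(_ a 0) := Pc_vec x`_k; rewrite !mxE pil_id ?x_in // => <-.
by apply: eq_bigr => i _; rewrite !mxE.
Qed.

Lemma P_dl a f : \sum_i P a i * dl i f = dl a f.
Proof.
rewrite /dl; under eq_bigr => i _ do rewrite mulr_sumr.
rewrite exchange_big; apply: eq_bigr => k _; rewrite -Pc_x rmorph_sum mulr_suml.
by apply: eq_bigr => i _; rewrite rmorphM !mxE mulrA.
Qed.

Definition coad y (f : O) : O := ps_coad x y (f : mps n F^o).

Lemma coadE y f : y \in l -> coad y f = \sum_(k < n) lamf (lie y x`_k) * pder k f.
Proof.
move=> yl; apply/funext => a; rewrite /coad /ps_coad mps_sumE fps_sumE.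
apply: eq_bigr => k _; rewrite mps_sumE /lamf mulr_suml fps_sumE; apply: eq_bigr => j _.
by rewrite pil_id ?l_subalg ?x_in // -mulrA fpsC_mulE -psmulXE.
Qed.

Lemma coad_derivation y : y \in l -> derivation (coad y).
Proof.
move=> yl; rewrite (_ : coad y = fun f => \sum_(k < n) lamf (lie y x`_k) * pder k f).
  by apply: derivation_comb => k; apply: pder_derivation.
by apply/funext => f; apply: coadE.
Qed.

Lemma coad_const y c : y \in l -> coad y (fpsC c) = 0.
Proof. by move=> yl; rewrite coadE // big1 // => k _; rewrite pder_fpsC mulr0. Qed.

Lemma coad_euler y f : y \in l -> coad y (euler f) = euler (coad y f).
Proof.
move=> yl; rewrite !coadE // (derivation_sum euler_derivation); apply: eq_bigr => k _.
by rewrite eulerM euler_lamf euler_der mulrBr addrCA subrr addr0.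
Qed.

Lemma lamf_sumZ I (r : seq I) (c : I -> F) (G : I -> g) :
  lamf (\sum_(i <- r) c i *: G i) = \sum_(i <- r) fpsC (c i) * lamf (G i).
Proof. by elim: r => [|i r IH]; rewrite ?big_nil ?lamf0 // !big_cons lamfP IH. Qed.

Lemma coad_lamf y v : y \in l -> coad y (lamf v) = lamf (lie y v).
Proof.
move=> yl; rewrite coadE // -[RHS]lamf_pil pil_lie //.
rewrite [in RHS](coord_basis x_basis (pilP v)) lie_sumr.
under [in RHS]eq_bigr => k _ do rewrite lieZr.
rewrite lamf_sumZ; apply: eq_bigr => k _; rewrite mulrC; congr (_ * _).
rewrite /lamf (derivation_sum (pder_derivation k)) (bigD1 k) //= pderM pder_fpsC mul0r add0r pder_coordf.
rewrite eqxx mulr1 big1 ?addr0 // => j jk.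
by rewrite pderM pder_fpsC mul0r add0r pder_coordf eq_sym (negPf jk) mulr0.
Qed.

(** The coadjoint field has coefficients lambda([y, e_i]) also with respect to the
    overcomplete family dl i; in this form it makes sense without choosing a basis
    of l. *)
Lemma coad_dl y (f : O) : y \in l -> coad y f = \sum_(i < N) lamf (lie y e`_i) * dl i f.
Proof.
move=> yl; rewrite coadE // /dl; under [RHS]eq_bigr => i _ do rewrite mulr_sumr.
rewrite exchange_big; apply: eq_bigr => k _ /=.
rewrite {1}(vbasis_sum x`_k) lie_sumr; under [X in lamf X]eq_bigr => i _ do rewrite lieZr.
rewrite lamf_sumZ mulr_suml; apply: eq_bigr => i _.
by rewrite mulrA [_ * lamf _]mulrC.
Qed.

(** * The radial equation *)
Definition lam_lie : 'M[O]_N := \matrix_(i, j) ll (strc n i j).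
Local Notation La := lam_lie.

Lemma lam_lieE i j : La i j = lamf (lie e`_i e`_j).
Proof. by rewrite mxE ll_ovec. Qed.

Lemma ll_lam_lie (u v : 'cV[O]_N) : ll (B u v) = \sum_i \sum_j u i 0 * La i j * v j 0.
Proof.
rewrite {1}(unitc_sum u) brk_suml ll_sum; apply: eq_bigr => i _.
rewrite {1}(unitc_sum v) brk_sumr ll_sum; apply: eq_bigr => j _.
by rewrite brkZl brkZr !llZ brk_unitc mxE; ring.
Qed.

Lemma sandwich_lam_lie (X Y : 'M[O]_N) a b :
  (X *m La *m Y) a b = ll (B (col a X^T) (col b Y)).
Proof.
rewrite ll_lam_lie mxE exchange_big; apply: eq_bigr => j _.
rewrite !mxE mulr_suml; apply: eq_bigr => i _.
by rewrite !mxE.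
Qed.

Lemma lam_lie_anti : La^T = - La.
Proof.
by apply/matrixP => i j; rewrite !mxE strc_anti llN.
Qed.

Lemma ordgem_lam_lie : ordgem 1 La.
Proof. by move=> i j; rewrite lam_lieE; apply: ordge_lamf. Qed.

Lemma col_P (a : 'I_N) : col a P = ovec n (pil e`_a).
Proof. by rewrite -P_ovec ovec_e -colE. Qed.

(** lambda vanishes on m, hence on [l, m]: the blocks of La that pair l with m are
    zero. *)
Lemma lam_lie_lm : P^T *m La *m (1%:M - P) = 0.
Proof.
apply/matrixP => a b; rewrite sandwich_lam_lie trmxK mxE.
have -> : col b (1%:M - P) = ovec n (e`_b - pil e`_b).
  by rewrite linearB /= col_P col1 ovecD ovecN ovec_e.
rewrite col_P brk_ovec ll_ovec lamf_m //.
by case: sp => _ _ _ h _; apply: h; rewrite ?pilP // pil_compl.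
Qed.

Lemma lam_lie_ml : (1%:M - P)^T *m La *m P = 0.
Proof.
apply: trmx_inj; rewrite trmx0 !trmx_mul lam_lie_anti trmxK mulNmx mulmxN.
by rewrite mulmxA lam_lie_lm oppr0.
Qed.

Lemma lam_lie_mixed (X Y : 'M[O]_N) : X *m P^T = X -> P *m Y = 0 -> X *m La *m Y = 0.
Proof.
move=> XP PY; have -> : Y = (1%:M - P) *m Y by rewrite mulmxBl mul1mx PY subr0.
by rewrite -XP -!mulmxA (mulmxA La) (mulmxA P^T) (mulmxA P^T) lam_lie_lm mul0mx mulmx0.
Qed.

Lemma lam_lie_mixed' (X Y : 'M[O]_N) : X *m P^T = 0 -> P *m Y = Y -> X *m La *m Y = 0.
Proof.
move=> XP PY; have -> : X = X *m (1%:M - P)^T.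
  by rewrite linearB /= trmx1 mulmxBr mulmx1 XP subr0.
rewrite -PY -!mulmxA (mulmxA La) (mulmxA _ (La *m P)) (mulmxA (1%:M - P)^T) lam_lie_ml.
by rewrite mul0mx mulmx0.
Qed.

(** delta y is the action of y in l on functions with values in g (x) g, adjoint on
    values and coadjoint on the argument. *)
Definition coadmx y (X : 'M[O]_N) : 'M[O]_N := map_mx (coad y) X.
Definition delta y (X : 'M[O]_N) : 'M[O]_N :=
  cmx n (admc y) *m X + X *m (cmx n (admc y))^T + coadmx y X.

Lemma coad_lam_lie y : y \in l ->
  coadmx y La = (cmx n (admc y))^T *m La + La *m cmx n (admc y).
Proof.
move=> yl; apply/matrixP => i j; rewrite mxE lam_lieE coad_lamf //.
have lD u v : lamf (u + v) = lamf u + lamf v.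
  by rewrite -[u in LHS]scale1r lamfP rmorph1 mul1r.
rewrite lie_derivation lD mxE; congr (_ + _); rewrite mxE.
  rewrite [in LHS](vbasis_sum (lie y e`_i)) lie_suml.
  under [X in lamf X]eq_bigr => k _ do rewrite lieZl.
  by rewrite lamf_sumZ; apply: eq_bigr => k _; rewrite lam_lieE !mxE.
rewrite [in LHS](vbasis_sum (lie y e`_j)) lie_sumr.
under [X in lamf X]eq_bigr => k _ do rewrite lieZr.
by rewrite lamf_sumZ; apply: eq_bigr => k _; rewrite lam_lieE !mxE mulrC.
Qed.

Lemma coadmxM y (X Y : 'M[O]_N) : y \in l ->
  coadmx y (X *m Y) = coadmx y X *m Y + X *m coadmx y Y.
Proof. by move=> yl; exact: (derivation_mulmx (coad_derivation yl)). Qed.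
Lemma coadmxD y (X Y : 'M[O]_N) : y \in l -> coadmx y (X + Y) = coadmx y X + coadmx y Y.
Proof.
by move=> yl; apply/matrixP => i j; rewrite !mxE (derivationD (coad_derivation yl)).
Qed.
Lemma coadmx_c y (A : 'M[F]_N) : y \in l -> coadmx y (cmx n A) = 0.
Proof. by move=> yl; apply/matrixP => i j; rewrite !mxE coad_const. Qed.
Lemma coadmx_euler y (X : 'M[O]_N) : y \in l -> coadmx y (eulermx X) = eulermx (coadmx y X).
Proof. by move=> yl; apply/matrixP => i j; rewrite !mxE coad_euler. Qed.

Lemma eulermxM (X Y : 'M[O]_N) : eulermx (X *m Y) = eulermx X *m Y + X *m eulermx Y.
Proof. exact: (derivation_mulmx euler_derivation). Qed.
Lemma eulermxD (X Y : 'M[O]_N) : eulermx (X + Y) = eulermx X + eulermx Y.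
Proof. by apply/matrixP => i j; rewrite !mxE raddfD. Qed.
Lemma eulermxB (X Y : 'M[O]_N) : eulermx (X - Y) = eulermx X - eulermx Y.
Proof. by apply/matrixP => i j; rewrite !mxE raddfB. Qed.
Lemma eulermxZ c (X : 'M[O]_N) : eulermx ((fpsC c : O) *: X) = (fpsC c : O) *: eulermx X.
Proof. by apply/matrixP => i j; rewrite !mxE eulerM euler_fpsC mul0r add0r. Qed.
Lemma eulermx_sum I (r : seq I) (G : I -> 'M[O]_N) :
  eulermx (\sum_(i <- r) G i) = \sum_(i <- r) eulermx (G i).
Proof.
elim: r => [|i r IH]; last by rewrite !big_cons eulermxD IH.
by rewrite !big_nil; apply/matrixP => i j; rewrite !mxE raddf0.
Qed.
Lemma eulermx_c (A : 'M[F]_N) : eulermx (cmx n A) = 0.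
Proof. by apply/matrixP => i j; rewrite !mxE euler_fpsC. Qed.

(** La is equivariant, so X La Y is an invariant product of functions. *)
Lemma delta_mul y (X Y : 'M[O]_N) : y \in l ->
  delta y (X *m La *m Y) = delta y X *m La *m Y + X *m La *m delta y Y.
Proof.
move=> yl; rewrite /delta !(coadmxM _ _ yl) coad_lam_lie //; exact: action_product_mx.
Qed.

Definition radial (X Z : 'M[O]_N) :=
  eulermx X + P *m X + X *m P^T = X *m La *m X + Z.

(** Since D + P_1 + P_2 raises no degree and U, V raise it by one, X vanishes in one
    degree after the other. *)
Lemma linear_radial_unique (X U V : 'M[O]_N) : ordgem 1 U -> ordgem 1 V ->
  eulermx X + P *m X + X *m P^T = X *m U + V *m X -> coefmx 0%MM X = 0 -> X = 0.
Proof.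
move=> U1 V1 E X0; apply: (radial_unique2 Pc_idem) X0 => k Xk.
rewrite E; apply: ordgemD; first by rewrite -addn1; apply: ordgemM.
by rewrite -add1n; apply: ordgemM.
Qed.

Lemma ordgem_mulLa (X : 'M[O]_N) : ordgem 1 (X *m La).
Proof. exact: (@ordgemM _ _ 0 1 _ _ _ _ _ (@ordgem_0 _ _ _ _ X) ordgem_lam_lie). Qed.
Lemma ordgem_Lamul (X : 'M[O]_N) : ordgem 1 (La *m X).
Proof. exact: (@ordgemM _ _ 1 0 _ _ _ _ _ ordgem_lam_lie (@ordgem_0 _ _ _ _ X)). Qed.

(** X + X^T satisfies a homogeneous linear equation, obtained by adding the equation
    of X to its transpose. *)
Lemma radial_anti (X Z : 'M[O]_N) : radial X Z -> Z^T = - Z ->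
  (coefmx 0%MM X)^T = - coefmx 0%MM X -> X^T = - X.
Proof.
move=> RX ZT X0; suff : X + X^T = 0 by move/eqP; rewrite addrC addr_eq0 => /eqP.
apply: (linear_radial_unique (U := La *m X) (V := - (X^T *m La))).
- exact: ordgem_Lamul.
- exact/ordgemN/ordgem_mulLa.
- rewrite eulermxD; apply: (radial_symm_mx lam_lie_anti ZT RX).
  have -> : eulermx X^T = (eulermx X)^T by rewrite /eulermx map_trmx.
  by rewrite -RX radial_tr_mx.
- by rewrite coefmxD; have -> : coefmx 0%MM X^T = (coefmx 0%MM X)^T by [rewrite /coefmx map_trmx];
    rewrite X0 subrr.
Qed.

Lemma admc_P y : y \in l -> cmx n (admc y) *m P = P *m cmx n (admc y).
Proof. by move=> yl; rewrite -!cmxM admc_Pc. Qed.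

(** y commutes with D, P and the product X La Y, so its application to the equation of
    X gives a homogeneous linear equation for delta y X. *)
Lemma delta_radial y (X Z : 'M[O]_N) : y \in l -> radial X Z ->
  delta y Z = 0 -> coefmx 0%MM (delta y X) = 0 -> delta y X = 0.
Proof.
move=> yl RX Z0; apply: (linear_radial_unique (ordgem_Lamul X) (ordgem_mulLa X)).
have dD (A A' : 'M[O]_N) : delta y (A + A') = delta y A + delta y A'.
  by rewrite /delta coadmxD // action_add_mx.
have := congr1 (delta y) RX; rewrite !dD Z0 addr0 delta_mul // -mulmxA => <-.
have PT : P^T = cmx n Pc^T by rewrite /cmx map_trmx.
have aT : (cmx n (admc y))^T = cmx n (admc y)^T by rewrite /cmx map_trmx.
rewrite /delta !(coadmxM _ _ yl) PT !coadmx_c // mul0mx mulmx0 add0r addr0 -PT.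
rewrite coadmx_euler // !eulermxD !eulermxM aT !eulermx_c mul0mx mulmx0 add0r addr0 -aT.
exact: (action_radial_mx _ _ _ _ (admc_P yl)).
Qed.

(** Integration along rays, which divides the coefficients of degree k by k, inverts D
    in positive degree; it turns the equation into a fixed point problem, contracting
    because La has order 1. *)
Lemma riccati_exists (X0 : 'M[F]_N) (Z : 'M[O]_N) : ordgem 1 Z ->
  exists X, eulermx X = X *m La *m X + Z /\ coefmx 0%MM X = X0.
Proof.
move=> Z1; pose G X := X *m La *m X + Z.
pose I (f : O) : O := fun a => if mdeg a == 0%N then 0 else f a / (mdeg a)%:R.
pose Phi X := cmx n X0 + map_mx I (G X) : 'M[O]_N.
have PhiE X i j a : Phi X i j a =
    cmx n X0 i j a + (if mdeg a == 0%N then 0 else G X i j a / (mdeg a)%:R).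
  by rewrite /Phi mxE fpsE [(map_mx I _) _ _]mxE.
have [|X PX] := @contraction_fixpoint F n N Phi.
  move=> k X Y XY i j a; rewrite mxE fpsE [(- Phi Y) _ _]mxE fpsE !PhiE.
  case: ifP => [_ _|_ ak]; first by rewrite !addr0 subrr.
  have {ak} E : G X i j a - G Y i j a = 0.
    have /(_ i j a ak) : ordgem k.+1 (G X - G Y); last by rewrite mxE fpsE [(- G Y) _ _]mxE fpsE.
    rewrite -sandwich_diff_mx; apply: ordgemD.
      by rewrite -addn1; apply: ordgemM => //; apply: ordgem_Lamul.
    by rewrite -add1n; apply: ordgemM => //; apply: ordgem_mulLa.
  by rewrite opprD addrACA subrr add0r -mulrBl E mul0r.
have XE i j a : X i j a = (if a == 0%MM then X0 i j else G X i j a / (mdeg a)%:R).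
  rewrite -{1}PX PhiE mxE fpsCE mdeg_eq0; case: eqP => _; first by rewrite addr0.
  by rewrite add0r.
exists X; split; last by apply/matrixP => i j; rewrite !mxE XE eqxx.
apply/matrixP => i j; rewrite mxE; apply/funext => a; rewrite /euler XE.
case: eqP => [->|/eqP]; last first.
  by rewrite -mdeg_eq0 => a0; rewrite mulrC divfK // pnatr_eq0.
rewrite mdeg0 mul0r; have /(_ i j 0%MM) -> // : ordgem 1 (G X); last by rewrite mdeg0.
by apply: ordgemD => //; apply: (ordgemM (ordgem_mulLa X) (ordgem_0 X)).
Qed.

(** * The Alekseev-Meinrenken solution on l *)
Section AMPart.
Variable Ol : 'M[F]_N.
Hypothesis P_Ol : Pc *m Ol = Ol.
Hypothesis Ol_P : Ol *m Pc^T = Ol.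
Hypothesis Ol_inv : forall y, y \in l -> admc y *m Ol + Ol *m (admc y)^T = 0.
Local Notation Om := (cmx n Ol).

(** The function mu, with lambda contracted into the second leg of Om_l so that it is
    a matrix product. Below, A = ad(mu). *)
Definition lamc : 'cV[O]_N := \col_i lam i.
Definition muv : 'cV[O]_N := Om *m lamc.
Local Notation A := (adm muv).

Lemma cmxD p q (M M' : 'M[F]_(p, q)) : cmx n (M + M') = cmx n M + cmx n M'.
Proof. by apply/matrixP => i j; rewrite !mxE rmorphD. Qed.
Lemma cmxT p q (M : 'M[F]_(p, q)) : (cmx n M)^T = cmx n M^T.
Proof. by rewrite /cmx map_trmx. Qed.

Lemma Om_inv_mx y : y \in l ->
  cmx n (admc y) *m Om = - (Om *m (cmx n (admc y))^T).
Proof.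
move=> yl; apply/eqP; rewrite -addr_eq0 cmxT -!cmxM -cmxD Ol_inv //.
by rewrite cmx0.
Qed.

Lemma La_ovec y : La *m ovec n y = - ((cmx n (admc y))^T *m lamc).
Proof.
apply/matrixP => i z; rewrite ord1 mxE [in RHS]mxE [in RHS]mxE.
transitivity (ll (B (ovec n e`_i) (ovec n y))).
  rewrite ll_lam_lie [RHS](bigD1 i) //= [X in _ = _ + X]big1 ?addr0 => [|j ji].
    by apply: eq_bigr => j _; rewrite ovec_e !mxE !eqxx mul1r.
  by apply: big1 => k _; rewrite ovec_e !mxE (negPf ji) !mul0r.
rewrite brk_strc_anti llN brk_ovec /pair_lam; congr (- _); apply: eq_bigr => k _.
by rewrite !mxE mulrC.
Qed.

Definition mucol (j : 'I_N) : g := \sum_a Ol a j *: e`_a.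

Lemma vec_sumZ (c : 'I_N -> F) : vec (\sum_a c a *: e`_a) = \col_a c a.
Proof.
apply/matrixP => i z; rewrite !mxE linear_sum (bigD1 i) //= linearZ /= coord_e eqxx mulr1.
by rewrite big1 ?addr0 // => k ki; rewrite linearZ /= coord_e eq_sym (negPf ki) mulr0.
Qed.

Lemma vec_injective (u v : g) : vec u = vec v -> u = v.
Proof.
move=> uv; rewrite (vbasis_sum u) (vbasis_sum v); apply: eq_bigr => a _.
by move/matrixP: uv => /(_ a 0); rewrite !mxE => ->.
Qed.

Lemma mucol_l j : mucol j \in l.
Proof.
have -> : mucol j = pil (mucol j); last exact: pilP.
apply: vec_injective; rewrite -Pc_vec vec_sumZ.
have -> : \col_a Ol a j = col j Ol by apply/matrixP => i z; rewrite !mxE.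
by rewrite colE mulmxA P_Ol.
Qed.

Lemma muvE : muv = \sum_j lam j *: ovec n (mucol j).
Proof.
apply/matrixP => a z; rewrite ord1 mxE summxE; apply: eq_bigr => j _.
by rewrite /ovec vec_sumZ !mxE mulrC.
Qed.

Lemma A_sum : A = \sum_j lam j *: cmx n (admc (mucol j)).
Proof.
apply/matrixP => a i; rewrite mxE muvE brk_suml !summxE; apply: eq_bigr => j _.
by rewrite brkZl -adm_ovec !mxE.
Qed.

(** mu has values in l, and Om_l is invariant under l. *)
Lemma A_Om : Om *m A^T = - (A *m Om).
Proof.
rewrite A_sum mulmx_suml linear_sum /= mulmx_sumr -sumrN; apply: eq_bigr => j _.
rewrite linearZ /= -scalemxAr -scalemxAl -scalerN; congr (_ *: _).
by rewrite (Om_inv_mx (mucol_l j)) opprK.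
Qed.

Lemma A_P : A *m P = P *m A.
Proof.
rewrite A_sum mulmx_suml mulmx_sumr; apply: eq_bigr => j _.
by rewrite -scalemxAr -scalemxAl (admc_P (mucol_l j)).
Qed.

Lemma euler_A : eulermx A = A.
Proof.
rewrite A_sum; apply/matrixP => a i; rewrite mxE !summxE.
rewrite (derivation_sum euler_derivation); apply: eq_bigr => j _.
by rewrite !mxE eulerM euler_fpsC mulr0 addr0 euler_lamf.
Qed.

Lemma ordgem_A : ordgem 1 A.
Proof.
move=> a i; rewrite A_sum summxE; apply: ordge_sum => j _; rewrite !mxE.
by apply/ordgeMr/ordge_lamf.
Qed.

(** By invariance of Om_l, contracting Om_l with lambda([., v]) gives [v, mu] for v in
    l. *)
Lemma Om_La_P : Om *m La *m P = - (A *m P).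
Proof.
apply/matrixP => a b.
have E (M : 'M[O]_N) : (M *m P) a b = (M *m ovec n (pil e`_b)) a 0.
  by rewrite -col_P !mxE; apply: eq_bigr => k _; rewrite !mxE.
have N1 (M : 'cV[O]_N) : (- M) a 0 = - M a 0 by rewrite mxE.
rewrite [RHS]mxE !E adm_mul brk_strc_anti N1 opprK -adm_mul adm_ovec /muv -!mulmxA La_ovec.
by rewrite !mulmxA (Om_inv_mx (pilP _)) mulmxN mulNmx -mulmxA.
Qed.

(** The function (ad(mu)^k (x) 1)(Om_l). The operator acts on the left leg, where it is
    a left multiplication; the definition of r_AM has it on the right leg, which
    costs the sign (-1)^k by invariance. *)
Definition adpow k : 'M[O]_N := iter k (mulmx A) Om.

Lemma adpowS k : adpow k.+1 = A *m adpow k. Proof. by []. Qed.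

Lemma P_adpow k : P *m adpow k = adpow k.
Proof.
elim: k => [|k IH]; first by rewrite -cmxM P_Ol.
by rewrite adpowS mulmxA -A_P -mulmxA IH.
Qed.

Lemma adpow_P k : adpow k *m P^T = adpow k.
Proof.
elim: k => [|k IH]; first by rewrite cmxT -cmxM Ol_P.
by rewrite adpowS -mulmxA IH.
Qed.

Lemma euler_adpow k : eulermx (adpow k) = k%:R *: adpow k.
Proof.
elim: k => [|k IH]; first by rewrite eulermx_c scale0r.
by rewrite adpowS eulermxM IH euler_A -scalemxAr -[k.+1]add1n natrD scalerDl scale1r.
Qed.

Lemma ordgem_adpow k : ordgem k (adpow k).
Proof.
elim: k => [|k IH]; first exact: ordgem_0.
by rewrite adpowS -add1n; apply: ordgemM => //; apply: ordgem_A.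
Qed.

(** The identity by which the quadratic term of the radial equation becomes the square
    of a series in one variable. *)
Lemma adpow_sandwich i j : adpow i *m La *m adpow j = - adpow (i + j).+1.
Proof.
elim: i => [|i IH].
  by rewrite -{1}(P_adpow j) !mulmxA Om_La_P mulNmx -mulmxA P_adpow add0n.
by rewrite addSn [adpow (i + j).+2]adpowS -mulmxN -IH adpowS !mulmxA.
Qed.

Lemma adpow_transposed k : iter k (mulmxr A^T) Om = (-1) ^+ k *: adpow k.
Proof.
have UA j : adpow j *m A^T = - adpow j.+1.
  elim: j => [|j IH]; first by rewrite A_Om.
  by rewrite adpowS -mulmxA IH mulmxN.
elim: k => [|k IH]; first by rewrite expr0 scale1r.
by rewrite /= IH -scalemxAl UA scalerN exprS mulN1r scaleNr.
Qed.

(** The coefficients of f(- s), see [adpow_transposed]. *)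
Definition g_AM (k : nat) : F := (-1) ^+ k * f_AM F k.

Lemma g_AM_rec k : k.+2%:R * g_AM k =
  - (\sum_(i < k) g_AM i * g_AM (k.-1 - i)) + (k == 1%N)%:R / 4.
Proof.
rewrite /g_AM mulrCA f_AM_rec mulrBr; congr (_ + _); last first.
  by case: eqP => [->|_]; rewrite ?mul0r ?mulr0 ?oppr0 // expr1 mulN1r opprK.
rewrite mulr_sumr -sumrN; apply: eq_bigr => i _; rewrite mulrACA -exprD.
by case: k i => [[]//|k] i /=; rewrite subnKC ?leq_ord // exprS mulN1r mulNr.
Qed.

(** The series sum_k g_AM k *: adpow k. Since adpow k has order k, only the terms
    with k up to the degree of a contribute to the coefficient at a. *)
Definition sAM : 'M[O]_N :=
  \matrix_(i, j) ((fun a => \sum_(k < (mdeg a).+1) g_AM k * adpow k i j a : F) : O).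

Definition sAM_trunc (K : nat) : 'M[O]_N := \sum_(k < K) (fpsC (g_AM k) : O) *: adpow k.

Lemma sAM_truncE K i j a : sAM_trunc K i j a = \sum_(k < K) g_AM k * adpow k i j a.
Proof.
rewrite summxE fps_sumE; apply: eq_bigr => k _.
by rewrite mxE fpsC_mulE.
Qed.

Lemma sAM_approx K : ordgem K (sAM - sAM_trunc K).
Proof.
move=> i j a aK; rewrite mxE fpsE [(- sAM_trunc K) _ _]mxE fpsE sAM_truncE mxE; apply/eqP.
rewrite subr_eq0; apply/eqP.
rewrite (big_ord_widen_cond K predT (fun k => g_AM k * adpow k i j a)) //.
rewrite [RHS](bigID (fun k : 'I_K => (k < (mdeg a).+1)%N)) /= [X in _ + X]big1 ?addr0 //.
by move=> k; rewrite -leqNgt => ak; rewrite (@ordgem_adpow k i j) ?mulr0.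
Qed.

Lemma sAM0 : coefmx 0%MM sAM = 0.
Proof.
apply/matrixP => i j; rewrite !mxE mdeg0 big_ord1.
suff -> : g_AM 0 = 0 by rewrite mul0r.
have := g_AM_rec 0; rewrite big_ord0 mul0r oppr0 addr0 => /eqP.
by rewrite mulf_eq0 pnatr_eq0 => /eqP.
Qed.

(** A square sum regrouped by the value k = i + j + 1; what does not fit under K is
    collected separately. *)
Lemma convolution_sum (V : zmodType) (h : nat -> nat -> V) K :
  \sum_(i < K) \sum_(j < K) h i j = \sum_(k < K) \sum_(i < k) h i (k.-1 - i)%N
    + \sum_(i < K) \sum_(j < K | (K <= (i + j).+1)%N) h i j.
Proof.
have -> : \sum_(i < K) \sum_(j < K) h i j =
    \sum_(i < K) \sum_(j < K | ((i + j).+1 < K)%N) h i j +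
    \sum_(i < K) \sum_(j < K | (K <= (i + j).+1)%N) h i j.
  rewrite -big_split; apply: eq_bigr => i _ /=.
  rewrite (bigID (fun j : 'I_K => ((i + j).+1 < K)%N)) /=; congr (_ + _).
  by apply: eq_bigl => j; rewrite -leqNgt.
congr (_ + _).
transitivity (\sum_(i < K) \sum_(j < K) \sum_(k < K | k == (i + j).+1 :> nat) h i j).
  apply: eq_bigr => i _; rewrite [LHS]big_mkcond; apply: eq_bigr => j _ /=.
  case: ifP => [ijK|ijK].
    by rewrite (big_pred1 (Ordinal ijK)) // => k; rewrite -val_eqE.
  by rewrite big1 // => k /eqP kE; move: (ltn_ord k); rewrite kE ijK.
transitivity (\sum_(k < K) \sum_(i < K) \sum_(j < K | k == (i + j).+1 :> nat) h i j).
  rewrite [RHS]exchange_big; apply: eq_bigr => i _.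
  by rewrite (exchange_big_dep predT).
apply: eq_bigr => k _.
rewrite (big_ord_widen_cond K predT (fun i => h i (k.-1 - i)%N)) ?(ltnW (ltn_ord k)) //.
rewrite [RHS]big_mkcond; apply: eq_bigr => i _ /=; case: ifP => [ik|ik]; last first.
  rewrite big1 // => j /eqP kE; move: ik; rewrite kE ltnS leq_addr //.
have jK : (k.-1 - i < K)%N.
  by apply: leq_ltn_trans (leq_subr _ _) (leq_ltn_trans (leq_pred _) (ltn_ord k)).
have k0 : (0 < k)%N by apply: leq_ltn_trans ik.
rewrite (big_pred1 (Ordinal jK)) // => j.
apply/eqP/eqP => [kE|/(congr1 val)/= ->]; first by apply: val_inj; rewrite /= kE addKn.
by rewrite subnKC ?prednK // -ltnS prednK.
Qed.

(** Comparison of the coefficients of adpow k on both sides is [g_AM_rec]. The series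
    is replaced by truncations of order K + 2, and every error term vanishes to that
    order. *)
Lemma sAM_radial : radial sAM (- (fpsC (4^-1 : F) : O) *: (Om *m La *m Om)).
Proof.
have -> : Om *m La *m Om = - adpow 1 by rewrite -[Om]/(adpow 0) adpow_sandwich.
rewrite /radial scaleNr scalerN opprK; apply/eqP; rewrite -subr_eq0; apply/eqP/matrixP => i j.
rewrite [RHS]mxE; apply: ordge_eq0 => K; move: i j.
pose lhs (X : 'M[O]_N) := eulermx X + P *m X + X *m P^T.
pose rhs (X : 'M[O]_N) := X *m La *m X + (fpsC (4^-1 : F) : O) *: adpow 1.
rewrite -/(lhs _) -/(rhs _).
have W (X : 'M[O]_N) : ordgem K.+2 X -> ordgem K X.
  by move=> H i j; apply: ordgeW (H i j); rewrite leqW.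
apply: W; set K' := K.+2; set S := sAM_trunc K'; have SK := @sAM_approx K'.
have lhsB : lhs sAM - lhs S = lhs (sAM - S).
  by rewrite /lhs radial_sub_mx // eulermxB.
have rhsB : rhs sAM - rhs S = (sAM - S) *m (La *m sAM) + S *m La *m (sAM - S).
  by rewrite (sandwich_diff_mx _ _ _ ((fpsC (4^-1 : F) : O) *: adpow 1)).
(* For the truncation S the defect consists of the terms of the product S La S that
   lie in order at least K'. *)
have main : ordgem K' (lhs S - rhs S).
  have lhsS : lhs S = \sum_(k < K') (fpsC (k.+2%:R * g_AM k) : O) *: adpow k.
    rewrite /lhs /S /sAM_trunc mulmx_sumr mulmx_suml eulermx_sum -!big_split.
    apply: eq_bigr => k _ /=; rewrite eulermxZ euler_adpow -scalemxAr P_adpow -scalemxAl adpow_P.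
    rewrite !scalerA -!scalerDl; congr (_ *: _).
    rewrite (rmorphM _ k.+2%:R) rmorph_nat -[k.+2]addn2 natrD; ring.
  pose h i j := (fpsC (g_AM i * g_AM j) : O) *: adpow (i + j).+1.
  have SLS : S *m La *m S = - \sum_(i < K') \sum_(j < K') h i j.
    rewrite /S /sAM_trunc !mulmx_suml -sumrN; apply: eq_bigr => i _.
    rewrite mulmx_sumr -sumrN; apply: eq_bigr => j _.
    rewrite -scalemxAr -!scalemxAl adpow_sandwich !scalerN scalerA /h; congr (- (_ *: _)).
    by rewrite (rmorphM _ (g_AM i)) mulrC.
  have -> : lhs S - rhs S =
      \sum_(i < K') \sum_(j < K' | (K' <= (i + j).+1)%N) h i j.
    have key : lhs S = (fpsC (4^-1 : F) : O) *: adpow 1 -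
        \sum_(k < K') \sum_(i < k) h i (k.-1 - i)%N.
      rewrite lhsS; have o1 : (1 < K')%N by [].
      have -> : (fpsC (4^-1 : F) : O) *: adpow 1 =
          \sum_(k < K') (fpsC ((k == 1%N :> nat)%:R / 4) : O) *: adpow k.
        rewrite (bigD1 (Ordinal o1)) //= -[true%:R]/(1 : F) mul1r big1 ?addr0 // => k.
        by rewrite -val_eqE /= => /negPf ->; rewrite mul0r rmorph0 scale0r.
      rewrite -sumrB; apply: eq_bigr => k _; rewrite g_AM_rec addrC rmorphD rmorphN.
      rewrite scalerDl scaleNr; congr (_ - _).
      rewrite rmorph_sum scaler_suml; apply: eq_bigr => i _; rewrite /h.
      have k0 : (0 < k)%N by apply: leq_ltn_trans (ltn_ord i).
      have -> : (i + (k.-1 - i)).+1 = k by rewrite subnKC ?prednK // -ltnS prednK.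
      by [].
    rewrite key /rhs SLS (convolution_sum h) opprD opprK addrA addrA subrK addrAC.
    by rewrite subrr add0r.
  move=> i j; rewrite summxE; apply: ordge_sum => p _; rewrite summxE.
  apply: ordge_sum => q pq; rewrite mxE; apply: ordgeMl.
  exact: ordgeW pq (@ordgem_adpow _ i j).
have -> : lhs sAM - rhs sAM = (lhs sAM - lhs S) + (lhs S - rhs S) - (rhs sAM - rhs S).
  by rewrite addrA subrK opprB addrA subrK.
apply: ordgemD; first apply: ordgemD main.
- rewrite lhsB /lhs; apply: ordgemD; first apply: ordgemD.
  + by move=> i j a aK; rewrite mxE /euler SK ?mulr0.
  + exact: (ordgemM (ordgem_0 _) SK).
  + by rewrite -[K']addn0; apply: ordgemM SK (ordgem_0 _).
- rewrite rhsB; apply/ordgemN/ordgemD.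
  + by rewrite -[K']addn0; apply: ordgemM SK (ordgem_0 _).
  + exact: (ordgemM (ordgem_0 _) SK).
Qed.

Lemma coef_sAM a : coefmx a sAM = \sum_(k < (mdeg a).+1) g_AM k *: coefmx a (adpow k).
Proof. by apply/matrixP => i j; rewrite !mxE summxE; apply: eq_bigr => k _; rewrite !mxE. Qed.

Lemma coefmx_inj p q (X Y : 'M[O]_(p, q)) : (forall a, coefmx a X = coefmx a Y) -> X = Y.
Proof.
move=> H; apply/matrixP => i j; apply/funext => a.
by move/matrixP: (H a) => /(_ i j); rewrite !mxE.
Qed.

Lemma P_sAM : P *m sAM = sAM.
Proof.
apply: coefmx_inj => a; rewrite coefmx_cmul coef_sAM mulmx_sumr; apply: eq_bigr => k _.
by rewrite -scalemxAr -coefmx_cmul P_adpow.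
Qed.

Lemma sAM_P : sAM *m P^T = sAM.
Proof.
apply: coefmx_inj => a; rewrite cmxT coefmx_mulc coef_sAM mulmx_suml; apply: eq_bigr => k _.
by rewrite -scalemxAl -coefmx_mulc -cmxT adpow_P.
Qed.
End AMPart.

(** * Translation of the dynamical equation into coordinates *)
Definition toM (r : mps n T2) : 'M[O]_N :=
  \matrix_(i, j) ((fun a => (r a : 'M[F]_N) i j) : O).
Definition fromM (X : 'M[O]_N) : mps n T2 := fun a => coefmx a X.

Lemma toM_coef r a : coefmx a (toM r) = r a :> 'M[F]_N.
Proof. by apply/matrixP => i j; rewrite !mxE. Qed.

Lemma toME r i j a : toM r i j a = (r a : 'M[F]_N) i j.
Proof. by rewrite mxE. Qed.

Lemma fromMK X : toM (fromM X) = X.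
Proof. by apply: coefmx_inj => a; rewrite toM_coef. Qed.

Lemma toMK r : fromM (toM r) = r.
Proof. by apply/funext => a; apply: toM_coef. Qed.

Lemma toMD r r' : toM (r + r') = toM r + toM r'.
Proof.
by apply/matrixP => i j; apply/funext => a; rewrite toME 2!mxE fpsE !toME.
Qed.

Lemma toM_cst (t : T2) : toM (pscst n t) = cmx n (t : 'M[F]_N).
Proof.
apply/matrixP => i j; apply/funext => a; rewrite toME mxE fpsCE /pscst.
by case: ifP => _; rewrite ?mulr1n // mxE mulr0n.
Qed.

Lemma toM_coad y r i j a : (ps_coad x y r a : 'M[F]_N) i j = coad y (toM r i j) a.
Proof.
rewrite /coad /ps_coad !mps_sumE sum_tensE; apply: eq_bigr => k _.
rewrite !mps_sumE sum_tensE; apply: eq_bigr => p _.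
rewrite -[LHS]/((coord x p (lie y x`_k) *: (psmulX p (psder k r) a : 'M[F]_N)) i j).
rewrite -[RHS]/(coord x p (lie y x`_k) * (psmulX p (psder k (toM r i j : mps n F^o)) a : F)).
rewrite mxE /psmulX; case: ifP => _; rewrite ?mxE //.
Qed.

Lemma toM_delta y r : delta y (toM r) = 0 <-> psmap (ad2 y) r + ps_coad x y r = 0.
Proof.
have E i j b : delta y (toM r) i j b = ((psmap (ad2 y) r + ps_coad x y r) b : 'M[F]_N) i j.
  rewrite mxE fpsE [coadmx _ _ _ _]mxE -[RHS]/((ad2 y (r b) + ps_coad x y r b : 'M[F]_N) i j).
  rewrite [RHS]mxE toM_coad; congr (_ + _).
  transitivity (coefmx b (cmx n (admc y) *m toM r + toM r *m (cmx n (admc y))^T) i j).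
    by rewrite [in RHS]mxE.
  by rewrite coefmxD coefmx_cmul cmxT coefmx_mulc toM_coef ad2E.
split=> [H|H].
  apply/funext => b; apply/matrixP => i j; rewrite -E H.
  by rewrite mxE fpsE mxE.
by apply/matrixP => i j; apply/funext => b; rewrite E H !mxE fpsE.
Qed.

(** The component abc of Alt(dr) + CYB(r) for the function r with matrix X. *)
Definition cdybe (X : 'M[O]_N) (a b c : 'I_N) : O :=
  dl a (X b c) - dl b (X a c) + dl c (X a b)
  + (B (col b X) (col c X) a 0 + B (col a X^T) (col c X) b 0
     + B (col a X^T) (col b X^T) c 0).

Lemma brk_entry (u v : 'cV[O]_N) a b :
  B u v a 0 b = \sum_i \sum_j cst3 i j a * (u i 0 * v j 0) b.
Proof.
rewrite brk.unlock summxE fps_sumE; apply: eq_bigr => i _.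
rewrite summxE fps_sumE; apply: eq_bigr => j _.
by rewrite !mxE mulrC fpsC_mulE.
Qed.

Lemma ev_psCYB r a b c k : ev a b c (psCYB r k) =
  (B (col b (toM r)) (col c (toM r)) a 0 + B (col a (toM r)^T) (col c (toM r)) b 0
     + B (col a (toM r)^T) (col b (toM r)^T) c 0) k.
Proof.
rewrite /psCYB /psconv ev_sum !fpsE !brk_entry.
under eq_bigr => q _ do rewrite /CYB2 !evD ev_lie12_13 ev_lie12_23 ev_lie13_23.
rewrite !big_split; congr (_ + _ + _).
- rewrite exchange_big; apply: eq_bigr => i _; rewrite exchange_big; apply: eq_bigr => j _.
  rewrite fps_mulE mulr_sumr; apply: eq_bigr => q _.
  by rewrite ![col _ _ _ _]mxE !toME; ring.
- rewrite exchange_big; apply: eq_bigr => i _; rewrite exchange_big; apply: eq_bigr => j _.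
  rewrite fps_mulE mulr_sumr; apply: eq_bigr => q _.
  by rewrite ![col _ _ _ _]mxE [(toM r)^T _ _]mxE !toME; ring.
- rewrite exchange_big; apply: eq_bigr => i _; rewrite exchange_big; apply: eq_bigr => j _.
  rewrite fps_mulE mulr_sumr; apply: eq_bigr => q _.
  by rewrite ![col _ _ _ _]mxE ![(toM r)^T _ _]mxE !toME; ring.
Qed.

Lemma ev_dbar r a b c k : ev a b c (dbar x r k) = dl a (toM r b c) k.
Proof.
rewrite /dbar mps_sumE ev_sum /dl fps_sumE; apply: eq_bigr => i _.
rewrite fpsC_mulE /psmap ev_tens; congr (_ * _).
by rewrite /pder /psder mxE toME.
Qed.

Lemma ev_cdybe r a b c k :
  ev a b c ((psmap (@Alt F g) (dbar x r) + psCYB r) k) = cdybe (toM r) a b c k.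
Proof.
rewrite -[(_ + _) k]/(Alt (dbar x r k) + psCYB r k) evD ev_Alt !ev_dbar ev_psCYB.
by rewrite /cdybe !fpsE.
Qed.

Lemma cdybe_eq0 r : psmap (@Alt F g) (dbar x r) + psCYB r = 0 <->
  (forall a b c, cdybe (toM r) a b c = 0).
Proof.
split=> [H a b c|H].
  by apply/funext => k; rewrite -ev_cdybe H ev0 fpsE.
by apply/funext => k; apply: ev_inj => a b c; rewrite ev_cdybe H fpsE.
Qed.

Lemma toM_flip r (t : T2) : r + psmap (@flip F g) r = pscst n t <->
  toM r + (toM r)^T = cmx n (t : 'M[F]_N).
Proof.
have E : toM (r + psmap (@flip F g) r) = toM r + (toM r)^T.
  rewrite toMD; congr (_ + _); apply/matrixP => i j; apply/funext => a.
  by rewrite toME /psmap flipE !mxE.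
split=> [H|H]; first by rewrite -E H toM_cst.
by rewrite -[LHS]toMK E H -toM_cst toMK.
Qed.

Section Antisymmetric.
Variable Om : 'M[F]_N.
Hypothesis Om_sym : Om^T = Om.
Hypothesis Om_inv : forall y, admc y *m Om + Om *m (admc y)^T = 0.
Local Notation Oc b := (col b (cmx n Om)).

(** Invariance of Om in the form of a bracket with an arbitrary vector of functions;
    it holds for constant vectors, and both sides are O-linear. *)
Lemma invariant_brk (u : 'cV[O]_N) a b : B u (Oc a) b 0 + B u (Oc b) a 0 = 0.
Proof.
have H y : B (ovec n y) (Oc a) b 0 + B (ovec n y) (Oc b) a 0 = 0.
  have H a' b' : B (ovec n y) (Oc a') b' 0 = fpsC ((admc y *m Om) b' a').
    by rewrite -adm_mul adm_ovec colE mulmxA -colE -cmxM [col _ _ _ _]mxE mxE.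
  rewrite !H -rmorphD.
  have -> : (admc y *m Om) a b = (Om *m (admc y)^T) b a.
    by rewrite -[in RHS]Om_sym -trmx_mul [RHS]mxE.
  have -> : (admc y *m Om) b a + (Om *m (admc y)^T) b a = 0.
    by have /matrixP/(_ b a) := Om_inv y; rewrite mxE [RHS]mxE.
  exact: rmorph0.
rewrite (unitc_sum u) !brk_suml !summxE -big_split big1 // => i _ /=.
have e3 (t : O) (v : 'cV[O]_N) j : (t *: v) j 0 = t * v j 0 by rewrite mxE.
by rewrite !brkZl !e3 -mulrDr -ovec_e H mulr0.
Qed.

(** Mixed terms: [Om_b, S_c]_a and its companions cancel in pairs by invariance, and
    the three brackets quadratic in Om / 2 are equal up to sign and add up to one. *)
Lemma cdybe_skew (S : 'M[O]_N) a b c : S^T = - S ->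
  cdybe (cmx n (2^-1 *: Om) + S) a b c =
  skew_cdybe (strc n) dl S (cmx n Om) (fpsC (4^-1 : F)) a b c.
Proof.
move=> ST; pose h : O := fpsC (2^-1 : F).
have hh : fpsC (4^-1 : F) = h * h :> O.
  by rewrite /h -rmorphM -invfM -natrM.
have Sa i j : S i j = - S j i by move/matrixP: ST => /(_ j i); rewrite !mxE.
have colE' b' : col b' (cmx n (2^-1 *: Om) + S) = h *: Oc b' + col b' S.
  by apply/matrixP => i j; rewrite !mxE rmorphM.
have colT b' : col b' (cmx n (2^-1 *: Om) + S)^T = h *: Oc b' - col b' S.
  apply/matrixP => i j; rewrite !mxE rmorphM -Sa; congr (_ * fpsC _ + _).
  by move/matrixP: Om_sym => /(_ i b'); rewrite mxE.
have dlE a' i j : dl a' ((cmx n (2^-1 *: Om) + S) i j) = dl a' (S i j).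
  by rewrite mxE (derivationD (dl_derivation a')) mxE dl_const add0r.
rewrite /cdybe !dlE !colE' !colT /skew_cdybe hh.
rewrite (Sa a c) (derivationN (dl_derivation b)).
rewrite !(brkDl, brkDr, brkZl, brkZr, brkNl, brkNr).
have e1 (u v : 'cV[O]_N) i : (u + v) i 0 = u i 0 + v i 0 by rewrite mxE.
have e2 (u : 'cV[O]_N) i : (- u) i 0 = - u i 0 by rewrite mxE.
have e3 (t : O) (u : 'cV[O]_N) i : (t *: u) i 0 = t * u i 0 by rewrite mxE.
rewrite !(e1, e2, e3).
have K (u : 'cV[O]_N) i j : B u (Oc i) j 0 = - B u (Oc j) i 0.
  by apply/eqP; rewrite -addr_eq0 invariant_brk.
have swap (u v : 'cV[O]_N) i : B u v i 0 = - B v u i 0 by rewrite brk_strc_anti e2.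
rewrite (swap (Oc b) (col c S)) (swap (Oc a) (col c S)) (swap (Oc a) (col b S)).
rewrite (swap (col a S) (col c S)) (K (col c S) a b) (K (col b S) a c) (K (col a S) b c).
rewrite (K (Oc a) b c); ring.
Qed.
End Antisymmetric.

(** * Existence *)
Lemma ordge_ll (u : 'cV[O]_N) : ordge 1 (ll u).
Proof. by apply: ordge_sum => k _; apply/ordgeMr/ordge_lamf. Qed.

(** The fields dl only see directions in l, and lambda vanishes on [m, l]. *)
Lemma lamf_dl_m z f : z \in m -> \sum_(i < N) lamf (lie z e`_i) * dl i f = 0.
Proof.
move=> zm; transitivity (\sum_(j < N) lamf (lie z (pil e`_j)) * dl j f); last first.
  apply: big1 => j _; rewrite lamf_m ?mul0r // lieC rpredN.
  by case: sp => _ _ _ h _; apply: h => //; apply: pilP.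
under eq_bigr => i _.
  rewrite -P_dl mulr_sumr; over.
rewrite exchange_big; apply: eq_bigr => j _ /=.
rewrite [pil e`_j]vbasis_sum lie_sumr; under [X in lamf X]eq_bigr => i _ do rewrite lieZr.
rewrite lamf_sumZ mulr_suml; apply: eq_bigr => i _.
by rewrite !mxE mulrA [lamf _ * _]mulrC.
Qed.

(** Equivariance under l, extended from constant vectors y to vectors u of functions
    by O-linearity; the m-component of u contributes nothing to the last sum. *)
Lemma equivariance_brk (S : 'M[O]_N) : S^T = - S ->
  (forall y, y \in l -> delta y S = 0) ->
  forall (u : 'cV[O]_N) a b, B (P *m u) (col b S) a 0 - B (P *m u) (col a S) b 0
    + \sum_i ll (B u (unitc O i)) * dl i (S a b) = 0.
Proof.
move=> ST SE u a b.
have H y : B (P *m ovec n y) (col b S) a 0 - B (P *m ovec n y) (col a S) b 0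
    + \sum_i ll (B (ovec n y) (unitc O i)) * dl i (S a b) = 0.
  have y'l := pilP y; set y' := pil y in y'l.
  have lE i : ll (B (ovec n y) (unitc O i)) = lamf (lie y' e`_i) + lamf (lie (y - y') e`_i).
    rewrite -ovec_e brk_ovec ll_ovec.
    rewrite -[lamf (lie y' _)]mul1r -[X in X * _](rmorph1 (@fpsC F n)) -lamfP scale1r.
    by rewrite -lieDl addrC subrK.
  under [X in _ + X]eq_bigr => i _ do rewrite lE mulrDl.
  rewrite big_split /= (lamf_dl_m _ (pil_compl y)).
  rewrite addr0 -(coad_dl _ y'l) P_ovec -/y'.
  have /matrixP/(_ a b) := SE y' y'l; rewrite [RHS]mxE => H0.
  rewrite -[RHS]H0 /delta [RHS]mxE [in RHS]mxE [coadmx _ _ _ _]mxE; congr (_ + _ + _).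
    by rewrite -adm_mul adm_ovec colE mulmxA -colE mxE.
  rewrite -adm_mul adm_ovec colE mulmxA -colE mxE -[LHS]mulN1r.
  have SN i j : S i j = - S j i by move/matrixP: ST => /(_ j i); rewrite !mxE.
  rewrite mulN1r [in LHS]mxE [in RHS]mxE -sumrN; apply: eq_bigr => k _.
  by rewrite [(cmx _ _)^T _ _]mxE (SN a k) mulNr mulrC.
have e3 (t : O) (v : 'cV[O]_N) j : (t *: v) j 0 = t * v j 0 by rewrite mxE.
rewrite {1 2}(unitc_sum u) mulmx_sumr !brk_suml !summxE -sumrB.
under [X in _ + X]eq_bigr => i _.
  rewrite {1}(unitc_sum u) brk_suml ll_sum mulr_suml; over.
rewrite [X in _ + X]exchange_big -big_split big1 // => j _ /=.
rewrite -scalemxAr !brkZl !e3 -mulrBr.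
under eq_bigr => i _ do rewrite brkZl llZ -mulrA.
by rewrite -mulr_sumr -mulrDr -(ovec_e n j) H mulr0.
Qed.

Section Vanishing.
Variables (Om : 'M[F]_N) (S : 'M[O]_N).
Hypothesis Om_sym : Om^T = Om.
Hypothesis Om_inv : forall y, admc y *m Om + Om *m (admc y)^T = 0.
Hypothesis S_anti : S^T = - S.
Hypothesis S_equiv : forall y, y \in l -> delta y S = 0.
Hypothesis S_radial : radial S (- quarter *: (cmx n Om *m La *m cmx n Om)).
Local Notation X := (cmx n (2^-1 *: Om) + S).

(** Each of the three sums in [skew_cdybe_radial] has the factor lambda([S_c, e_i]) of
    order 1, so the identity is of the kind to which [radial_unique3] applies. *)
Lemma cdybe_vanish :
  (forall a b c, \sum_i (1%:M - Pc) a i * \sum_j (1%:M - Pc) b j *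
     \sum_k (1%:M - Pc) c k * cdybe X i j k 0%MM = 0) ->
  forall a b c, cdybe X a b c = 0.
Proof.
move=> X0; pose E a b c := skew_cdybe (strc n) dl S (cmx n Om) quarter a b c.
have XE a b c : cdybe X a b c = E a b c by apply: cdybe_skew.
move=> a b c; rewrite XE; move: a b c.
apply: (radial_unique3 Pc_idem) => [k Ek a b c|a b c]; last first.
  rewrite -[RHS](X0 a b c); apply: eq_bigr => i _; congr (_ * _).
  by apply: eq_bigr => j _; congr (_ * _); apply: eq_bigr => p _; rewrite XE.
have SN i j : S i j = - S j i by move/matrixP: S_anti => /(_ j i); rewrite !mxE.
have PE i j : (fpsC (Pc i j) : O) = P i j by rewrite [RHS]mxE.
have sumPE (z : 'I_N) (f : 'I_N -> O) : \sum_i (fpsC (Pc z i) : O) * f i = \sum_i P z i * f i.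
  by apply: eq_bigr => i _; rewrite PE.
rewrite !sumPE.
have O_sym i j : cmx n Om i j = cmx n Om j i.
  by rewrite !mxE; move/matrixP: Om_sym => /(_ j i); rewrite mxE => ->.
have S_rad i j : euler (S i j) + \sum_p P i p * S p j + \sum_p P j p * S i p =
    - ll (B (col i S) (col j S)) - quarter * ll (B (col i (cmx n Om)) (col j (cmx n Om))).
  have /matrixP/(_ i j) := S_radial.
  have -> : (eulermx S + P *m S + S *m P^T) i j =
      euler (S i j) + \sum_p P i p * S p j + \sum_p P j p * S i p.
    rewrite mxE [in LHS]mxE mxE [in LHS]mxE; congr (_ + _ + _).
    by rewrite mxE; apply: eq_bigr => p _; rewrite [P^T _ _]mxE mulrC.
  move=> ->; rewrite mxE [X in _ + X]mxE !sandwich_lam_lie.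
  have -> : col i S^T = - col i S by rewrite S_anti; apply/matrixP => p q; rewrite !mxE.
  have -> : (cmx n Om)^T = cmx n Om by rewrite cmxT Om_sym.
  by rewrite brkNl llN mulNr.
have dl_P a' i j : dl a' (P i j) = 0 by rewrite -PE dl_const.
have dl_Om a' i j : dl a' (cmx n Om i j) = 0 by rewrite mxE dl_const.
have D_Om i j : euler (cmx n Om i j) = 0 by rewrite mxE euler_fpsC.
have dl_lamP a' i : dl a' (lam i) = P a' i by rewrite -PE dl_lam.
have -> := @skew_cdybe_radial O N (strc n) (@brk_strc_anti F g n) (@brk_strc_jacobi F g n) (@euler F n) dl
  euler_derivation (dl_derivation) (derivation_strc (@euler_fpsC F n))
  (fun a => derivation_strc (dl_const a)) (euler_dl) lam P S (cmx n Om) quarter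
  dl_P dl_Om D_Om (fun a => dl_const a _) (euler_fpsC _ _) dl_lamP P_dl SN O_sym
  (invariant_brk Om_sym Om_inv) (equivariance_brk S_anti S_equiv) S_rad a b c.
apply: ordgeN; do 2?apply: ordgeD; apply: ordge_sum => i _;
  by rewrite -add1n; apply: ordgeM (Ek _ _ _); apply: ordge_ll.
Qed.
End Vanishing.

(** The case P = 0 of the uniqueness for linear radial equations. *)
Lemma linear_euler_unique (X U V : 'M[O]_N) : ordgem 1 U -> ordgem 1 V ->
  eulermx X = X *m U + V *m X -> coefmx 0%MM X = 0 -> X = 0.
Proof.
move=> U1 V1 E X0; apply: (radial_unique2 (mulmx0 _ _ : (0 : 'M[F]_N) *m 0 = 0)) X0 => k Xk.
rewrite cmx0 trmx0 mul0mx mulmx0 !addr0 E.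
apply: ordgemD; first by rewrite -addn1; apply: ordgemM.
by rewrite -add1n; apply: ordgemM.
Qed.

Section Existence.
Variables (Om Ol Mm s0 : 'M[F]_N).
Hypothesis Om_dec : Om = Ol + Mm.
Hypothesis Om_sym : Om^T = Om.
Hypothesis Om_inv : forall y, admc y *m Om + Om *m (admc y)^T = 0.
Hypothesis P_Ol : Pc *m Ol = Ol.
Hypothesis Ol_P : Ol *m Pc^T = Ol.
Hypothesis P_Mm : Pc *m Mm = 0.
Hypothesis Mm_P : Mm *m Pc^T = 0.
Hypothesis s0_anti : s0^T = - s0.
Hypothesis P_s0 : Pc *m s0 = 0.
Hypothesis s0_P : s0 *m Pc^T = 0.
Hypothesis s0_inv : forall y, y \in l -> admc y *m s0 + s0 *m (admc y)^T = 0.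

Lemma Ol_inv y : y \in l -> admc y *m Ol + Ol *m (admc y)^T = 0.
Proof.
move=> yl; have aP := admc_Pc yl.
have aPT : (admc y)^T *m Pc^T = Pc^T *m (admc y)^T by rewrite -!trmx_mul aP.
transitivity (Pc *m (admc y *m Om + Om *m (admc y)^T) *m Pc^T).
  have e1 : Pc *m (admc y *m Ol) *m Pc^T = admc y *m Ol.
    by rewrite mulmxA -aP -!mulmxA Ol_P P_Ol.
  have e2 : Pc *m (Ol *m (admc y)^T) *m Pc^T = Ol *m (admc y)^T.
    by rewrite mulmxA P_Ol -mulmxA aPT mulmxA Ol_P.
  have e3 : Pc *m (admc y *m Mm) *m Pc^T = 0 by rewrite mulmxA -aP -!mulmxA Mm_P !mulmx0.
  have e4 : Pc *m (Mm *m (admc y)^T) *m Pc^T = 0 by rewrite mulmxA P_Mm !mul0mx.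
  by rewrite Om_dec !(mulmxDr, mulmxDl) e1 e2 e3 e4 !addr0.
by rewrite Om_inv mulmx0 mul0mx.
Qed.

Local Notation sl := (sAM Ol).
Local Notation Zl := (- quarter *: (cmx n Ol *m La *m cmx n Ol)).
Local Notation Zm := (- quarter *: (cmx n Mm *m La *m cmx n Mm)).
Local Notation Z := (- quarter *: (cmx n Om *m La *m cmx n Om)).

Lemma P_cOl : P *m cmx n Ol = cmx n Ol. Proof. by rewrite -cmxM P_Ol. Qed.
Lemma cOl_P : cmx n Ol *m P^T = cmx n Ol. Proof. by rewrite cmxT -cmxM Ol_P. Qed.
Lemma P_cMm : P *m cmx n Mm = 0. Proof. by rewrite -cmxM P_Mm cmx0. Qed.
Lemma cMm_P : cmx n Mm *m P^T = 0. Proof. by rewrite cmxT -cmxM Mm_P cmx0. Qed.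

(** The radial equation decouples, as La pairs l only with l and m only with m. *)
Lemma Z_dec : Z = Zl + Zm.
Proof.
rewrite -scalerDr Om_dec cmxD sandwich_sum_mx //.
  exact: (lam_lie_mixed cOl_P P_cMm).
exact: (lam_lie_mixed' cMm_P P_cOl).
Qed.

(** The fixed point of the Riccati equation on g (x) g stays in m (x) m: its components
    P t and t P^T satisfy linear equations and vanish at 0. *)
Lemma t_exists : exists t : 'M[O]_N,
  [/\ eulermx t = t *m La *m t + Zm, coefmx 0%MM t = s0, P *m t = 0 & t *m P^T = 0].
Proof.
have Zm1 : ordgem 1 Zm.
  move=> i j; rewrite mxE; apply: ordgeMl.
  by apply: (ordgemM (j := 1) (k := 0) (ordgem_mulLa _) (ordgem_0 _)).
have [t [Et t0]] := riccati_exists s0 Zm1.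
have o0 : ordgem 1 (0 : 'M[O]_N) by move=> i j; rewrite mxE; apply: ordge0.
exists t; split=> //.
  apply: (linear_euler_unique (ordgem_Lamul t) o0).
    rewrite eulermxM eulermx_c !mul0mx add0r addr0 Et mulmxDr -scalemxAr !mulmxA.
    by rewrite P_cMm !mul0mx scaler0 addr0.
  by rewrite coefmx_cmul t0 P_s0.
apply: (linear_euler_unique o0 (ordgem_mulLa t)).
  rewrite cmxT eulermxM eulermx_c !mulmx0 add0r addr0 Et mulmxDl -scalemxAl.
  by rewrite -[X in _ + _ *: X]mulmxA -cmxT cMm_P mulmx0 scaler0 addr0 mulmxA.
by rewrite cmxT coefmx_mulc t0 s0_P.
Qed.

Lemma existence_mx : exists t : 'M[O]_N,
  [/\ t^T = - t, P *m t = 0, t *m P^T = 0, coefmx 0%MM t = s0 &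
    [/\ (sl + t)^T = - (sl + t), forall y, y \in l -> delta y (sl + t) = 0
      & radial (sl + t) Z]].
Proof.
have [t [Et t0 Pt tP]] := t_exists; exists t.
have RS : radial (sl + t) Z.
  have := sAM_radial P_Ol Ol_P Ol_inv; rewrite /radial => R1.
  rewrite Z_dec sandwich_sum_mx.
  - transitivity ((eulermx sl + P *m sl + sl *m P^T) + eulermx t).
      by rewrite eulermxD mulmxDr mulmxDl Pt tP !addr0 [RHS]addrAC [X in _ = X + _]addrAC.
    by rewrite R1 Et addrACA.
  - by apply: (lam_lie_mixed _ Pt); apply: sAM_P.
  - by apply: (lam_lie_mixed' tP); apply: P_sAM.
have S0 : coefmx 0%MM (sl + t) = s0 by rewrite coefmxD sAM0 add0r.
have SA : (sl + t)^T = - (sl + t).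
  apply: (radial_anti RS); last by rewrite S0.
  rewrite linearZ /= !trmx_mul lam_lie_anti cmxT Om_sym mulNmx mulmxN mulmxA.
  by rewrite -scalerN.
have SE y : y \in l -> delta y (sl + t) = 0.
  move=> yl; have dO : delta y (cmx n Om) = 0.
    by rewrite /delta coadmx_c // addr0 cmxT -!cmxM -cmxD Om_inv cmx0.
  apply: (delta_radial yl RS).
    have dZ (c : F) (X : 'M[O]_N) : delta y ((fpsC c : O) *: X) = (fpsC c : O) *: delta y X.
      rewrite /delta -scalemxAr -scalemxAl !scalerDr; congr (_ + _).
      apply/matrixP => i j; rewrite !mxE (coad_derivation yl).2.
      by rewrite coad_const // mul0r add0r.
    by rewrite -rmorphN dZ delta_mul // dO !mul0mx mulmx0 addr0 scaler0.
  rewrite /delta !coefmxD coefmx_cmul cmxT coefmx_mulc S0 s0_inv // add0r.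
  apply/matrixP => i j; rewrite [RHS]mxE [LHS]mxE [coadmx _ _ _ _]mxE coadE //.
  have /(_ 0%MM) -> // : ordge 1 (\sum_(k < n) lamf (lie y x`_k) * pder k ((sl + t) i j)).
    by apply: ordge_sum => k _; apply/ordgeMr/ordge_lamf.
  by rewrite mdeg0.
split=> //.
have tE : t = (1%:M - P) *m (sl + t) *m (1%:M - P)^T.
  have -> : (1%:M - P) *m (sl + t) = t.
    by rewrite mulmxBl mul1mx mulmxDr P_sAM // Pt addr0 addrAC subrr add0r.
  by rewrite linearB /= trmx1 mulmxBr mulmx1 tP subr0.
by rewrite tE !trmx_mul trmxK SA mulNmx mulmxN mulmxA.
Qed.
End Existence.

(** * Uniqueness *)
Lemma euler_pder (f : O) : euler f = \sum_(k < n) coordf F k * pder k f.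
Proof.
apply/funext => a; rewrite fps_sumE /euler mdegE natr_sum mulr_suml.
apply: eq_bigr => k _; rewrite -psmulXE /psmulX; case: ifP => [a0|/negbT]; last first.
  by rewrite -leqNgt leqn0 => /eqP ->; rewrite mul0r.
rewrite /pder /psder -[RHS]/(_ * f (a - U_(k) + U_(k))%MM).
have -> : (a - U_(k) + U_(k) = a)%MM.
  apply/mnmP => j; rewrite mnmDE mnmBE mnm1E.
  by case: eqP => [<-|]; rewrite ?subn0 ?addn0 // subnK.
by rewrite mnmBE mnm1E eqxx subn1 prednK.
Qed.

Lemma euler_dl_sum (f : O) : euler f = \sum_a lam a * dl a f.
Proof.
rewrite euler_pder /dl; under [RHS]eq_bigr => a _ do rewrite mulr_sumr.
rewrite exchange_big; apply: eq_bigr => k _ /=.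
transitivity (lamf x`_k * pder k f).
  congr (_ * _); rewrite /lamf (bigD1 k) //= (pil_id (x_in k)).
  have xb : basis_of l x by case: sp.
  rewrite (coord_free _ _ (basis_free xb)) eqxx rmorph1 mul1r big1 ?addr0 // => j jk.
  by rewrite (coord_free _ _ (basis_free xb)) eq_sym (negPf jk) rmorph0 mul0r.
rewrite {1}(vbasis_sum x`_k) lamf_sumZ mulr_suml; apply: eq_bigr => a _.
by rewrite mulrA [lamf _ * _]mulrC.
Qed.

(** The induction on the order of d = X - Y. If d has order k, so does Alt(dd), being
    the difference of two brackets. Contraction of Alt(dd) with lambda gives D d, as
    lambda kills d and its derivatives; since lambda has order 1, D d has order
    k + 1. *)
Lemma cdybe_unique (X Y : 'M[O]_N) :
  P *m (X - Y) = 0 -> coefmx 0%MM (X - Y) = 0 ->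
  (forall a b c, cdybe X a b c = 0) -> (forall a b c, cdybe Y a b c = 0) -> X = Y.
Proof.
move=> PXY XY0 DX DY; apply/eqP; rewrite -subr_eq0; apply/eqP.
have [d dE] : {d | d = X - Y} by exists (X - Y).
move: PXY XY0; rewrite -dE => Pd d0.
suff dk k : ordgem k d.
  by apply/matrixP => i j; rewrite [RHS]mxE; apply: ordge_eq0 => k; apply: dk.
elim: k => [|k IH]; first exact: ordgem_0.
have lamd c : \sum_a lam a * d a c = 0.
  transitivity (((\row_i lam i) *m d) 0 c).
    by rewrite mxE; apply: eq_bigr => i _; rewrite mxE.
  by rewrite -lam_row -mulmxA Pd mulmx0 mxE.
have lamdl b c : \sum_a lam a * dl b (d a c) = 0.
  have := congr1 (dl b) (lamd c); rewrite (derivation_sum (dl_derivation b)).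
  under eq_bigr => a _ do rewrite (dl_derivation b).2 dl_lam.
  rewrite big_split /=; have -> : \sum_a (fpsC (Pc b a) : O) * d a c = (P *m d) b c.
    by rewrite [RHS]mxE; apply: eq_bigr => i _; rewrite [P _ _]mxE.
  by rewrite Pd mxE add0r => ->; have := dl_const b (0 : F); rewrite rmorph0.
have dB a b c : dl a (X b c) - dl a (Y b c) = dl a (d b c).
  by rewrite dE mxE [(- Y) _ _]mxE (derivationD (dl_derivation a)) (derivationN (dl_derivation a)).
have colB b : col b X - col b Y = col b d by rewrite dE linearB.
have colBT b : col b X^T - col b Y^T = col b d^T by rewrite dE !linearB.
have brkB (u u' v v' : 'cV[O]_N) a : ordgem k (u - u') -> ordgem k (v - v') ->
    ordge k (B u v a 0 - B u' v' a 0).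
  move=> uk vk; have -> : B u v a 0 - B u' v' a 0 = B (u - u') v a 0 + B u' (v - v') a 0.
    by rewrite brkDl brkDr brkNl brkNr !mxE; ring.
  apply: ordgeD; rewrite brk.unlock summxE; apply: ordge_sum => i _; rewrite summxE;
    apply: ordge_sum => j _; rewrite mxE; apply: ordgeMr;
    [apply: ordgeMr; exact: uk|apply: ordgeMl; exact: vk].
have colk b : ordgem k (col b d) by move=> i j; rewrite mxE.
have colkT b : ordgem k (col b d^T) by move=> i j; rewrite !mxE.
have main a b c : ordge k (dl a (d b c) - dl b (d a c) + dl c (d a b)).
  have -> : dl a (d b c) - dl b (d a c) + dl c (d a b) =
     - (B (col b X) (col c X) a 0 - B (col b Y) (col c Y) a 0)
     - (B (col a X^T) (col c X) b 0 - B (col a Y^T) (col c Y) b 0)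
     - (B (col a X^T) (col b X^T) c 0 - B (col a Y^T) (col b Y^T) c 0).
    have := DX a b c; rewrite -(DY a b c) /cdybe => E.
    rewrite -!dB; apply/eqP; rewrite -subr_eq0; move/eqP: E; rewrite -subr_eq0 => /eqP E.
    by rewrite -[X in _ == X]E; apply/eqP; ring.
  by apply: ordgeB; [apply: ordgeB; [apply: ordgeN|]|]; apply: brkB;
    rewrite ?colB ?colBT.
have step b c : ordge k.+1 (euler (d b c)).
  have -> : euler (d b c) =
      \sum_a lam a * (dl a (d b c) - dl b (d a c) + dl c (d a b)).
    under [RHS]eq_bigr => a _ do rewrite mulrDr mulrBr.
    by rewrite big_split sumrB /= !lamdl subr0 addr0 euler_dl_sum.
  by apply: ordge_sum => a _; rewrite -add1n; apply: ordgeM (main a b c); apply: ordge_lamf.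
move=> b c a ak; case: (eqVneq a 0%MM) => [->|].
  by move/matrixP: d0 => /(_ b c); rewrite !mxE.
rewrite -mdeg_eq0 => a0; have /eqP := step b c a ak.
by rewrite /euler mulf_eq0 pnatr_eq0 (negPf a0) /= => /eqP.
Qed.

(** * Tensors on l, on m and on g / l *)
Lemma tensv_l (t : T2) : t \in tensv l l ->
  Pc *m (t : 'M[F]_N) = t /\ (t : 'M[F]_N) *m Pc^T = t.
Proof.
move: t; apply: (@tensv_ind F g).
- by rewrite mulmx0 mul0mx.
- move=> c t t' [a1 a2] [b1 b2]; rewrite -[c *: t + t']/(c *: (t : 'M[F]_N) + (t' : 'M[F]_N)).
  by rewrite mulmxDr mulmxDl -scalemxAr -scalemxAl a1 a2 b1 b2.
move=> u v ul vl; rewrite tens_vec mulmxA Pc_vec pil_id //; split=> //.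
by rewrite -mulmxA -trmx_mul Pc_vec pil_id.
Qed.

Lemma tensv_m (t : T2) : t \in tensv m m ->
  Pc *m (t : 'M[F]_N) = 0 /\ (t : 'M[F]_N) *m Pc^T = 0.
Proof.
have vec0 : vec (0 : g) = 0 by apply/matrixP => i j; rewrite !mxE linear0.
move: t; apply: (@tensv_ind F g).
- by rewrite mulmx0 mul0mx.
- move=> c t t' [a1 a2] [b1 b2]; rewrite -[c *: t + t']/(c *: (t : 'M[F]_N) + (t' : 'M[F]_N)).
  by rewrite mulmxDr mulmxDl -scalemxAr -scalemxAl a1 a2 b1 b2 scaler0 addr0.
move=> u v um vm; rewrite tens_vec mulmxA Pc_vec pil_m // vec0 mul0mx; split=> //.
by rewrite -mulmxA -trmx_mul Pc_vec pil_m // vec0 trmx0 mulmx0.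
Qed.

Lemma in_tensv_m (t : T2) : Pc *m (t : 'M[F]_N) = 0 -> (t : 'M[F]_N) *m Pc^T = 0 ->
  t \in tensv m m.
Proof.
move=> Pt tP; pose q v := v - pil v.
have qv v : vec (q v) = Q *m vec v.
  rewrite mulmxBl mul1mx Pc_vec; apply/matrixP => i j; rewrite !mxE.
  by rewrite linearB.
have -> : t = tlift (fun u v => tens (q u) (q v)) t.
  have D : \sum_i \sum_j t i j *: (tens e`_i e`_j : 'M[F]_N) = t by rewrite [RHS]tensor_decomp.
  transitivity (Q *m (t : 'M[F]_N) *m Q^T).
    by rewrite mulmxBl mul1mx Pt subr0 linearB /= trmx1 mulmxBr mulmx1 tP subr0.
  rewrite -[in LHS]D mulmx_sumr mulmx_suml; apply: eq_bigr => i _.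
  rewrite mulmx_sumr mulmx_suml; apply: eq_bigr => j _.
  by rewrite -scalemxAr -scalemxAl !tens_vec !qv trmx_mul !mulmxA.
rewrite /tlift; apply: rpred_sum => i _; apply: rpred_sum => j _; apply: rpredZ.
by apply: mem_tens; apply: pil_compl.
Qed.

Definition contr3 (M : 'M[F]_N) (h : 'I_N -> 'I_N -> 'I_N -> F) a b c : F :=
  \sum_i M a i * \sum_j M b j * \sum_k M c k * h i j k.

Implicit Types (M : 'M[F]_N) (h : 'I_N -> 'I_N -> 'I_N -> F).

Lemma contr3D M h h' a b c :
  contr3 M (fun i j k => h i j k + h' i j k) a b c = contr3 M h a b c + contr3 M h' a b c.
Proof.
rewrite /contr3 -big_split; apply: eq_bigr => i _ /=; rewrite -mulrDr; congr (_ * _).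
rewrite -big_split; apply: eq_bigr => j _ /=; rewrite -mulrDr; congr (_ * _).
by rewrite -big_split; apply: eq_bigr => k _ /=; rewrite -mulrDr.
Qed.

Lemma contr3_eq M h h' a b c : (forall i j k, h i j k = h' i j k) ->
  contr3 M h a b c = contr3 M h' a b c.
Proof.
move=> H; apply: eq_bigr => i _; congr (_ * _); apply: eq_bigr => j _; congr (_ * _).
by apply: eq_bigr => k _; rewrite H.
Qed.

Lemma contr3_slot3 M h a b c : (forall i j, \sum_k M c k * h i j k = 0) -> contr3 M h a b c = 0.
Proof.
move=> H; rewrite /contr3 big1 // => i _; rewrite big1 ?mulr0 // => j _.
by rewrite H mulr0.
Qed.

Lemma contr3_slot2 M h a b c : (forall i k, \sum_j M b j * h i j k = 0) -> contr3 M h a b c = 0.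
Proof.
move=> H; rewrite /contr3 big1 // => i _; rewrite [X in _ * X](_ : _ = 0) ?mulr0 //.
under eq_bigr => j _ do rewrite mulr_sumr.
rewrite exchange_big big1 // => k _.
transitivity (M c k * (\sum_j M b j * h i j k)); last by rewrite H mulr0.
by rewrite mulr_sumr; apply: eq_bigr => j _; rewrite mulrCA.
Qed.

Lemma contr3_slot1 M h a b c : (forall j k, \sum_i M a i * h i j k = 0) -> contr3 M h a b c = 0.
Proof.
move=> H; rewrite /contr3; under eq_bigr => i _ do rewrite mulr_sumr.
rewrite exchange_big big1 // => j _.
under eq_bigr => i _ do rewrite !mulr_sumr.
rewrite exchange_big big1 // => k _.
transitivity (M b j * M c k * (\sum_i M a i * h i j k)); last by rewrite H mulr0.
by rewrite mulr_sumr; apply: eq_bigr => i _; ring.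
Qed.

Lemma Q_dl a (f : O) k : \sum_i Q a i * (dl i f) k = 0.
Proof.
have := congr1 (fun h : O => h k) (P_dl a f); rewrite fps_sumE => E.
transitivity (dl a f k - \sum_i (P a i * dl i f) k); last by rewrite E subrr.
rewrite -(sum_delta (fun i => dl i f k)) -sumrB; apply: eq_bigr => i _.
rewrite [P a i]mxE fpsC_mulE [Q a i]mxE [1%:M _ _]mxE [(- Pc) _ _]mxE; ring.
Qed.

Lemma psconv0 (V W : lmodType F) (Bl : V -> V -> W) (X Y : mps n V) :
  psconv Bl X Y 0%MM = Bl (X 0%MM) (Y 0%MM).
Proof.
have bm0 (k : 'X_{1..n < (mdeg (0 : 'X_{1..n})%MM).+1}) : val k = 0%MM.
  apply/eqP; rewrite -mdeg_eq0 -leqn0 -ltnS; apply: leq_trans (bmdeg k) _.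
  by rewrite mdeg0.
rewrite /psconv (eq_bigr (fun=> Bl (X 0%MM) (Y 0%MM))); last first.
  by move=> k _; rewrite -![bmnm _]/(val _) !bm0.
have z : (mdeg (0 : 'X_{1..n})%MM < (mdeg (0 : 'X_{1..n})%MM).+1)%N by [].
rewrite (big_pred1 (BMultinom z, BMultinom z)) // => -[k1 k2] /=.
rewrite -[bmnm k1]/(val k1) -[bmnm k2]/(val k2) !bm0 addm0 eqxx; symmetry.
by apply/eqP; congr (_, _); apply: val_inj; rewrite bm0.
Qed.

(** At 0 the terms of Alt(dr) have a leg in l and disappear under 1 - P; only CYB(r(0))
    is left. *)
Lemma cdybe_initial (X : 'M[O]_N) :
  (forall a b c, contr3 Q (fun i j k => ev i j k (CYB (coefmx 0%MM X : T2))) a b c = 0) ->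
  forall a b c, \sum_i Q a i * \sum_j Q b j * \sum_k Q c k * cdybe X i j k 0%MM = 0.
Proof.
move=> H a b c.
have psC0 : psCYB (fromM X) 0%MM = CYB (coefmx 0%MM X : T2).
  exact: psconv0.
rewrite -/(contr3 Q (fun i j k => cdybe X i j k 0%MM) a b c).
rewrite (@contr3_eq Q _ (fun i j k =>
   ((dl i (X j k) 0%MM + - dl j (X i k) 0%MM) + dl k (X i j) 0%MM)
   + ev i j k (CYB (coefmx 0%MM X : T2))) a b c); last first.
  by move=> i j k; rewrite -psC0 ev_psCYB fromMK /cdybe !fpsE.
rewrite contr3D H addr0 contr3D contr3D contr3_slot1 ?add0r; last by move=> *; apply: Q_dl.
rewrite contr3_slot2 ?add0r; last first.
  move=> i k; transitivity (- \sum_j Q b j * dl j (X i k) 0%MM); last by rewrite Q_dl oppr0.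
  by rewrite -sumrN; apply: eq_bigr => j _; rewrite mulrN.
by apply: contr3_slot3 => i j; apply: Q_dl.
Qed.

(** The coordinates of v - P v factor through g / l, so their triple products are
    linear forms on the third tensor power of g / l. *)
Lemma quot3_contr (t : T3) : quot3 l t = 0 ->
  forall a b c, contr3 Q (fun i j k => ev i j k t) a b c = 0.
Proof.
move=> t0 a b c.
pose al (d : 'I_N) (u : quotv l) : F^o := coord e d (vsval u - pil (vsval u)).
have al_lin d : linear (al d).
  by move=> k u v; rewrite /al !linearP /= pilD pilZ opprD addrACA -scalerBr linearP.
have al_pi d v : al d (quotv_pi l v) = coord e d (v - pil v).
  rewrite /al; congr (coord e d _).
  have : v - vsval (quotv_pi l v) \in l.
    rewrite -(quotv_pi_eq0 l); have h (w : quotv l) : quotv_pi l (vsval w) = w.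
      rewrite /quotv_pi daddv_pi_id ?subvsP //; first exact: vsvalK.
      by rewrite capvC capv_compl.
    have := quotv_pi_linear l (-1) (vsval (quotv_pi l v)) v; rewrite !scaleN1r h.
    by rewrite [v - _]addrC => ->; rewrite addrC subrr.
  move=> vl; have := pil_id vl; set w := vsval _.
  have -> : pil (v - w) = pil v - pil w by rewrite /pil linearB.
  move=> E; have vE : v = pil v - pil w + w by rewrite E subrK.
  by rewrite [X in _ = X - _]vE [RHS]addrC !addrA addNr add0r addrC.
pose al2 b' c' (w : tensor (quotv l) (quotv l)) : F^o :=
  tlift (fun u v : quotv l => (al b' u * al c' v : F^o)) w.
have mul_lin (f : quotv l -> F^o) (c' : F) : linear f -> linear (fun u : quotv l => (c' * f u : F^o)).
  by move=> fl k ? ?; rewrite fl mulrDr; congr (_ + _); rewrite mulrCA.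
have mul_linr (f : quotv l -> F^o) (c' : F) : linear f -> linear (fun u : quotv l => (f u * c' : F^o)).
  by move=> fl k ? ?; rewrite fl mulrDl; congr (_ + _); rewrite -mulrA.
have al2_tens b' c' (u v : quotv l) : al2 b' c' (tens u v) = al b' u * al c' v.
  by rewrite /al2 tlift_tens //; split=> ?; [apply: mul_linr|apply: mul_lin]; apply: al_lin.
pose al3 (w : tensor (quotv l) (tensor (quotv l) (quotv l))) : F^o :=
  tlift (fun (u : quotv l) (v : tensor (quotv l) (quotv l)) => (al a u * al2 b c v : F^o)) w.
have al3_tens (u v w : quotv l) : al3 (tens u (tens v w)) = al a u * (al b v * al c w).
  rewrite /al3 tlift_tens ?al2_tens //; split=> w'; first exact/mul_linr/al_lin.
  by move=> k u' v'; rewrite /al2 tlift_linear mulrDr; congr (_ + _); rewrite mulrCA.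
have [al3D al3Z al30] := linear_rules (tlift_linear
  (fun (u : quotv l) (v : tensor (quotv l) (quotv l)) => (al a u * al2 b c v : F^o))).
have al3_sum I (r : seq I) (G : I -> tensor (quotv l) (tensor (quotv l) (quotv l))) :
    al3 (\sum_(i <- r) G i) = \sum_(i <- r) al3 (G i).
  by elim: r => [|i r IH]; rewrite ?big_nil ?[LHS]al30 // !big_cons -IH; apply: al3D.
have := congr1 al3 t0; rewrite [RHS]al30 /quot3 tlift3E => <-.
rewrite al3_sum; apply: eq_bigr => i _; rewrite al3_sum mulr_sumr; apply: eq_bigr => j _.
rewrite al3_sum !mulr_sumr; apply: eq_bigr => k _.
rewrite [RHS]al3Z -/(al3 _) al3_tens !al_pi.
have QE d k' : Q d k' = coord e d (e`_k' - pil e`_k').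
  by rewrite linearB /= coord_e !mxE.
by rewrite !QE -[_ *: _]/(_ * _); ring.
Qed.

(** * The coordinates of r_AM *)
Section AMMatrix.
Variable Oml : T2.
Local Notation Ol := (Oml : 'M[F]_N).
Hypothesis P_Ol : Pc *m Ol = Ol.
Hypothesis Ol_P : Ol *m Pc^T = Ol.
Hypothesis Ol_sym : Ol^T = Ol.
Hypothesis Ol_inv : forall y, y \in l -> admc y *m Ol + Ol *m (admc y)^T = 0.
Local Notation muM := (muv Ol).

Lemma Ol_entry (p q : 'I_N) : Ol p q = Ol q p.
Proof. by move/matrixP: Ol_sym => /(_ q p); rewrite mxE. Qed.

(** As Om_l is symmetric, lambda may be contracted with its first leg, as in the
    definition of mu, or with its second leg, as in [muv]. *)
Lemma coord_pil_sum (i : 'I_n) (q : 'I_N) :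
  \sum_p Ol p q * coord x i e`_p = \sum_p Ol q p * coord x i (pil e`_p).
Proof.
under [RHS]eq_bigr => p _ do
  rewrite (vbasis_sum (pil e`_p)) linear_sum mulr_sumr.
rewrite exchange_big; apply: eq_bigr => a _ /=.
transitivity ((Ol *m Pc^T) q a * coord x i e`_a); first by rewrite Ol_P Ol_entry.
rewrite mxE mulr_suml; apply: eq_bigr => p _.
by rewrite linearZ /= [Pc^T _ _]mxE [Pc _ _]mxE mulrA.
Qed.

Lemma mu_coord (q : 'I_N) a : coord e q (mu x Oml a) = muM q 0 a.
Proof.
rewrite /mu mps_sumE linear_sum /muv mxE fps_sumE.
under [RHS]eq_bigr => p _ do rewrite mxE fpsC_mulE mxE /lam /lamf fps_sumE mulr_sumr.
rewrite exchange_big; apply: eq_bigr => i _ /=.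
transitivity ((\sum_p Ol q p * coord x i (pil e`_p)) * coordf F i a); last first.
  by rewrite mulr_suml; apply: eq_bigr => p _; rewrite fpsC_mulE mulrA.
rewrite -coord_pil_sum.
have tE : coord e q (tlift (fun u v : g => coord x i u *: v) Oml)
    = \sum_p Ol p q * coord x i e`_p.
  rewrite /tlift linear_sum; apply: eq_bigr => p _; rewrite linear_sum.
  rewrite -[RHS](sum_delta (fun r => Ol p r * coord x i e`_p) q).
  by apply: eq_bigr => r _; rewrite !linearZ /= coord_e mulrA.
rewrite -tE; set w := tlift _ _.
transitivity ((coordf F i * fpsC (coord e q w)) a); last by rewrite mulrC fpsC_mulE.
rewrite -psmulXE /psmulX /fpsC /pscst; case: ifP => _; rewrite ?linear0 //.
by case: ifP => _; rewrite ?linear0.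
Qed.

Lemma adm_mu_coef (q j : 'I_N) a : adm muM q j a = coord e q (lie (mu x Oml a) e`_j).
Proof.
rewrite mxE brk_entry [in RHS](vbasis_sum (mu x Oml a)) lie_suml linear_sum.
apply: eq_bigr => i _; rewrite lieZl linearZ /= mu_coord.
rewrite [RHS](_ : _ = cst3 i j q * muM i 0 a); last by rewrite mulrC.
rewrite -[RHS](sum_delta (fun k => cst3 i k q * muM i 0 a) j).
apply: eq_bigr => k _; rewrite [unitc _ _ _ _]mxE eqxx andbT (eq_sym j) -mulrA.
congr (_ * _); by rewrite mulrC -(rmorph_nat (@fpsC F n)) fpsC_mulE mulrC.
Qed.

(** ad(mu) on the right leg is right multiplication by the transpose of its matrix. *)
Lemma toM_ad_step (T : mps n T2) :
  toM (psconv (fun v : g => tlift (fun a b : g => tens a (lie v b))) (mu x Oml) T)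
  = toM T *m (adm muM)^T.
Proof.
apply/matrixP => p q; apply/funext => a; rewrite toME /psconv sum_tensE mxE fps_sumE.
under [RHS]eq_bigr => j _ do rewrite mulrC fps_mulE.
rewrite exchange_big; apply: eq_bigr => k _ /=.
rewrite tlift2E exchange_big; apply: eq_bigr => j _ /=.
rewrite [(adm _)^T _ _]mxE adm_mu_coef toME mulrC.
rewrite -[RHS](sum_delta (fun i => T k.2 i j * coord e q (lie (mu x Oml k.1) e`_j)) p).
by apply: eq_bigr => i _; rewrite tensE coord_e -mulrA [in RHS]mulrC; ring.
Qed.

Lemma toM_ad_mu_pow k : toM (ad_mu_pow x Oml k) = (-1) ^+ k *: adpow Ol k.
Proof.
rewrite -(adpow_transposed P_Ol Ol_inv); elim: k => [|k IH]; first exact: toM_cst.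
by rewrite /ad_mu_pow /= -/(ad_mu_pow x Oml k) toM_ad_step IH.
Qed.

Lemma toM_r_AM : toM (r_AM x Oml) = cmx n (2^-1 *: Ol) + sAM Ol.
Proof.
rewrite /r_AM toMD toM_cst; congr (_ + _).
apply/matrixP => i j; apply/funext => a; rewrite toME sum_tensE [sAM Oml i j]mxE.
apply: eq_bigr => k _; rewrite mxE -toME toM_ad_mu_pow mxE.
rewrite /g_AM -mulrA mulrCA; congr (_ * _).
have -> : ((-1) ^+ k : O) = fpsC ((-1) ^+ k) by rewrite rmorphXn rmorphN1.
by rewrite fpsC_mulE.
Qed.
End AMMatrix.

End Splitting.

(** * The theorem *)
Theorem theorem3 (R : realType) (g : finLieType R[i]) (l m : {vspace g})
    (n : nat) (x : n.-tuple g) (Om Oml Omm r0 : tensor g g)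
    (l_subalg : forall y z, y \in l -> z \in l -> lie y z \in l)
    (lm_full : (l + m)%VS = fullv)
    (lm_direct : (l :&: m)%VS = 0%VS)
    (m_invariant : forall y z, y \in l -> z \in m -> lie y z \in m)
    (x_basis : basis_of l x)
    (Om_sym : flip Om = Om)
    (Om_invariant : forall y : g, ad2 y Om = 0)
    (Om_decomp : Om = Oml + Omm)
    (Oml_ll : Oml \in tensv l l)
    (Omm_mm : Omm \in tensv m m)
    (r0_M : in_M l m Om r0) :
  exists! r : mps n (tensor g g),
    [/\ Dynr x l Om r,
        (exists t : mps n (tensor g g),
           (forall a, in_Lambda2 m (t a)) /\
           r = r_AM x Oml + pscst n (2^-1 *: Omm) + t)
      & r 0%MM = r0].
Proof.
have sp : reductive_splitting l m x by [].
pose N := \dim {:g}; pose F : numFieldType := R[i].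
pose om : 'M[F]_N := Om; pose ol : 'M[F]_N := Oml; pose mm : 'M[F]_N := Omm.
have om_dec : om = ol + mm by rewrite /om Om_decomp.
have om_sym : om^T = om by rewrite -{2}[om]Om_sym flipE.
have om_inv y : admc y *m om + om *m (admc y)^T = 0.
  by rewrite -(Om_invariant y) ad2E.
have [P_ol ol_P] := tensv_l sp Oml_ll; have [P_mm mm_P] := tensv_m sp Omm_mm.
have ol_sym : ol^T = ol.
  have E : Pc l m *m om *m (Pc l m)^T = ol.
    by rewrite om_dec mulmxDr mulmxDl P_ol P_mm mul0mx addr0 ol_P.
  by rewrite -E !trmx_mul trmxK om_sym mulmxA.
have ol_inv := Ol_inv sp om_dec om_inv P_ol ol_P P_mm mm_P.
have [s0 [r0E [s0_m s0_anti] s0_inv quot0]] := r0_M.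
have [P_s0 s0_P] := tensv_m sp s0_m.
have s0T : (s0 : 'M[F]_N)^T = - (s0 : 'M[F]_N) by rewrite -flipE s0_anti.
have s0I y : y \in l -> admc y *m (s0 : 'M[F]_N) + (s0 : 'M[F]_N) *m (admc y)^T = 0.
  by move=> yl; rewrite -(s0_inv y yl) ad2E.
have [t [tT Pt tP t0 [ST SE SR]]] :=
  existence_mx sp om_dec om_sym om_inv P_ol ol_P P_mm mm_P s0T P_s0 s0_P s0I.
set S := sAM l m x ol + t in ST SE SR.
pose X := cmx n (2^-1 *: om) + S.
have toM_form (u : mps n (tensor g g)) :
    toM (r_AM x Oml + pscst n (2^-1 *: Omm) + u) = cmx n (2^-1 *: om) + (sAM l m x ol + toM u).
  rewrite 2!toMD toM_cst (toM_r_AM x P_ol ol_P ol_sym ol_inv) om_dec scalerDr cmxD.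
  by rewrite -!addrA; congr (_ + _); apply: addrCA.
have X0 : coefmx 0%MM X = r0.
  rewrite r0E coefmxD coefmxD sAM0 add0r t0.
  have -> : coefmx 0%MM (cmx n (2^-1 *: om)) = 2^-1 *: om.
    by apply/matrixP => i j; rewrite mxE mxE fpsCE eqxx.
  by [].
have dynX : forall a b c, cdybe x X a b c = 0.
  apply: (cdybe_vanish sp om_sym om_inv ST SE SR).
  apply: (cdybe_initial sp) => a b c; rewrite X0; exact: (quot3_contr sp quot0).
have deltaX y : y \in l -> delta x y X = 0.
  move=> yl; rewrite /X /delta (coadmxD sp) // action_add_mx -!/(delta x y _) SE // addr0.
  rewrite /delta (coadmx_c sp) // addr0 cmxT -!cmxM -cmxD -scalemxAr -scalemxAl -scalerDr.
  by rewrite om_inv scaler0 cmx0.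
have XT : X + X^T = cmx n om.
  rewrite /X linearD /= ST addrACA subrr addr0 cmxT linearZ /= om_sym -cmxD.
  by rewrite -scalerDl -mulr2n -[_ *+ 2]mulr_natl divff ?pnatr_eq0 // scale1r.
exists (fromM X); split.
  split.
  - split.
    + by move=> y yl; apply/(toM_delta x y (fromM X)); rewrite fromMK deltaX.
    + by apply/(cdybe_eq0 x (fromM X)); rewrite fromMK.
    + by apply/toM_flip; rewrite fromMK.
  - exists (fromM t); split.
      move=> a; split.
        apply: (in_tensv_m sp).
          by rewrite -[fromM t a]/(coefmx a t) -coefmx_cmul Pt; apply/matrixP => i j; rewrite !mxE fpsE.
        by rewrite -[fromM t a]/(coefmx a t) -coefmx_mulc -cmxT tP; apply/matrixP => i j; rewrite !mxE fpsE.
      rewrite flipE; apply/matrixP => i j.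
      by move/matrixP: tT => /(_ i j); rewrite !mxE => ->; rewrite fpsE.
    by rewrite -[RHS]toMK toM_form fromMK.
  - exact: X0.
move=> r [[_ r_dyn r_flip] [u [u_m rE]] r_0].
rewrite -[RHS]toMK; congr fromM.
have PU : cmx n (Pc l m) *m toM u = 0.
  apply: coefmx_inj => a; rewrite coefmx_cmul toM_coef.
  have [um _] := u_m a; rewrite (tensv_m sp um).1.
  by apply/matrixP => i j; rewrite !mxE fpsE.
apply: (cdybe_unique sp _ _ dynX).
- rewrite rE toM_form /X opprD addrACA subrr add0r opprD addrACA subrr add0r.
  by rewrite mulmxBr Pt PU subrr.
- have -> : coefmx 0%MM (X - toM r) = coefmx 0%MM X - coefmx 0%MM (toM r).
    by apply/matrixP => i j; rewrite !mxE !fpsE.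
  by rewrite X0 toM_coef r_0 subrr.
by apply/cdybe_eq0.
Qed.
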